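(* Let $q\in[-1,1]$ and let $\varrho(N)$, $N\in\mathbb{N}$, be a sequence of probability measures on $\hat U(N)$. Assume that there are real numbers $(a_k)_{k\ge 1}$ such that, for every $k\in\mathbb{N}$, every fixed index $i_0$ and every fixed indices $i_1,\dots,i_m$ with $|\{i_1,\dots,i_m\}|\ge 2$, \[ \lim_{N\to\infty}\partial_{i_0}^k\Big(\tfrac1N\log S_{\varrho(N)}\Big)(1^N)=a_k,\qquad \lim_{N\to\infty}\partial_{i_1}\cdots\partial_{i_m}\Big(\tfrac1N\log S_{\varrho(N)}\Big)(1^N)=0, \] and that the power series $\Psi(z)=\sum_{k\ge0}a_k\frac{(z-1)^k}{k!}$ (with any $a_0$) converges in a neighborhood of $1$. Then $m_{N,PP(q)}[\varrho(N)]$ converges as $N\to\infty$ in probability, in the sense of moments, to a deterministic probability measure $\mu^{(q)}$ on $\mathbb{R}$ with moments \[ \mu^{(q)}_k=\sum_{m=0}^k\binom km\frac1{(m+1)!}\frac{d^m}{du^m}\Big(u^{k-q}(\Psi'(u))^{k-m}\Big)\Big|_{u=1}. \] Moreover, for $q,q'\in[-1,1]$ the limits are related by the identity of formal power series in $z$ \[ \Big(1-q\sum_{k\ge0}\mu^{(q)}_kz^{k+1}\Big)^{1/q}=\Big(1-q'\sum_{k\ge0}\mu^{(q')}_kz^{k+1}\Big)^{1/q'}, \] where for $q=0$ the expression $\big(1-q\sum_k\mu^{(q)}_kz^{k+1}\big)^{1/q}$ is interpreted as $\exp\big(-\sum_k\mu^{(0)}_kz^{k+1}\big)$.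
   Context: A signature of length $N$ is a tuple $\lambda=(\lambda_1\ge\dots\ge\lambda_N)\in\mathbb{Z}^N$; $\hat U(N)$ denotes the set of signatures of length $N$. For $\lambda\in\hat U(N)$, $\chi^{\lambda}(u_1,\dots,u_N)=\det(u_i^{\lambda_j+N-j})_{i,j}/\prod_{i<j}(u_i-u_j)$ is the rational Schur function. For a probability measure $\varrho(N)$ on $\hat U(N)$, the Schur generating function is $S_{\varrho(N)}(u_1,\dots,u_N)=\sum_{\lambda\in\hat U(N)}\varrho(N)[\lambda]\,\chi^\lambda(u_1,\dots,u_N)/\chi^\lambda(1^N)$, where $1^N=(1,\dots,1)$; it is assumed that this series converges uniformly in a neighborhood of $1^N$. $\partial_i$ denotes the partial derivative in $u_i$. For $q\in[-1,1]$ and $\lambda\in\hat U(N)$ the $q$-deformed Perelomov–Popov measure is \[ m_{N,PP(q)}[\lambda]=\frac1N\sum_{i=1}^N\Big(\prod_{j\ne i}\frac{(\lambda_i-i)-(\lambda_j-j)-q}{(\lambda_i-i)-(\lambda_j-j)}\Big)\delta\Big(\frac{\lambda_i+N-i}{N}\Big), \] and $m_{N,PP(q)}[\varrho(N)]$ denotes the random measure $m_{N,PP(q)}[\lambda]$ with $\lambda$ distributed according to $\varrho(N)$. Random measures $m_N$ converge in probability in the sense of moments to a deterministic measure $\mu$ if for every $k\in\mathbb{N}$, $\int t^k m_N(dt)\to\int t^k\mu(dt)$ in probability. *)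

(* Defs.v *)
From HB Require Import structures.
From mathcomp Require Import all_boot all_order all_algebra.
From mathcomp Require Import all_classical all_reals all_analysis.
Set Implicit Arguments. Unset Strict Implicit. Unset Printing Implicit Defensive.
Import Order.TTheory GRing.Theory Num.Theory.
Import numFieldNormedType.Exports.
Local Open Scope classical_set_scope.
Local Open Scope ring_scope.

Section Defs.
Variable R : realType.

(* A signature of length N: a nonincreasing N-tuple of integers
   (stored 0-indexed: lambda_{j+1} is  sig_at lam j). *)
Definition sig_t (N : nat) := {t : N.-tuple int | sorted (fun x y : int => y <= x) t}.
Definition sig_at N (lam : sig_t N) (j : 'I_N) : int := tnth (val lam) j.

(* alternant det( u_i^(lambda_j + N - j) ) (1-indexed), with integer exponents *)
Definition alternant N (lam : sig_t N) (u : 'rV[R]_N) : R :=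
  \det (\matrix_(i < N, j < N)
          (u ord0 i) ^ (sig_at lam j + (N - 1 - j)%:Z)).
Definition vandermonde N (u : 'rV[R]_N) : R :=
  \prod_(i < N) \prod_(j < N | (i < j)%N) (u ord0 i - u ord0 j).
Definition distinct_coords N : set 'rV[R]_N :=
  [set v | forall i j : 'I_N, i != j -> v ord0 i != v ord0 j].
(* chi^lambda = alternant / Vandermonde, a rational function which is a
   Laurent polynomial; it is evaluated everywhere (in particular on the
   diagonal, e.g. at 1^N) by its continuous extension. *)
Definition schur N (lam : sig_t N) (u : 'rV[R]_N) : R :=
  lim ((fun v => alternant lam v / vandermonde v)
         @ within (@distinct_coords N) (nbhs u)).

Definition ones N : 'rV[R]_N := const_mx 1.

Definition is_prob N (rho : sig_t N -> R) :=
  (forall lam, 0 <= rho lam) /\ (\esum_(lam in setT) (rho lam)%:E = 1)%E.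
Definition prob N (rho : sig_t N -> R) (A : set (sig_t N)) : R :=
  fine (\esum_(lam in A) (rho lam)%:E).

(* real sum of an (absolutely summable) family, via positive and negative parts *)
Definition rsum (T : choiceType) (f : T -> R) : R :=
  fine (\esum_(x in setT) (Num.max (f x) 0)%:E) -
  fine (\esum_(x in setT) (Num.max (- f x) 0)%:E).

Definition sgf_term N (rho : sig_t N -> R) (u : 'rV[R]_N) (lam : sig_t N) : R :=
  rho lam * schur lam u / schur lam (ones N).

Definition sgf N (rho : sig_t N -> R) (u : 'rV[R]_N) : R := rsum (sgf_term rho u).

Definition sgf_unif_conv N (rho : sig_t N -> R) :=
  exists2 U : set 'rV[R]_N, nbhs (ones N) U &
    forall eps : R, 0 < eps -> exists2 F : set (sig_t N), finite_set F &
      forall u, U u ->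
        (\esum_(lam in ~` F) (`| sgf_term rho u lam |)%:E <= eps%:E)%E.

Definition evec N (i : nat) : 'rV[R]_N := \row_(j < N) ((j : nat) == i)%:R.
Definition pdiff N (i : nat) (G : 'rV[R]_N -> R) : 'rV[R]_N -> R :=
  fun u => 'D_(evec N i) G u.
Definition partials N (l : seq nat) (G : 'rV[R]_N -> R) : 'rV[R]_N -> R :=
  foldr (@pdiff N) G l.
Definition all_partials_exist N (G : 'rV[R]_N -> R) (x : 'rV[R]_N) :=
  \forall u \near x, forall (l : seq nat) (i : nat),
     derivable (partials l G) u (evec N i).

Definition logsgf N (rho : sig_t N -> R) : 'rV[R]_N -> R :=
  fun u => N%:R^-1 * ln (sgf rho u).

(* l_i = lambda_i - i (1-indexed), i.e. lambda_(j) - (j+1) 0-indexed *)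
Definition ppl N (lam : sig_t N) (j : 'I_N) : R :=
  (sig_at lam j)%:~R - (j.+1)%:R.
Definition pp_weight (q : R) N (lam : sig_t N) (i : 'I_N) : R :=
  \prod_(j < N | j != i) ((ppl lam i - ppl lam j - q) / (ppl lam i - ppl lam j)).
(* point (lambda_i + N - i)/N, 1-indexed *)
Definition pp_atom N (lam : sig_t N) (i : 'I_N) : R :=
  ((sig_at lam i)%:~R + N%:R - (i.+1)%:R) / N%:R.
Definition pp_moment (q : R) N (lam : sig_t N) (k : nat) : R :=
  N%:R^-1 * \sum_(i < N) pp_weight q lam i * (pp_atom lam i) ^+ k.

Definition Psi (a : nat -> R) (z : R) : R :=
  limn (series (fun k => a k * (z - 1) ^+ k / (k`!)%:R)).
Definition limit_moment (a : nat -> R) (q : R) (k : nat) : R :=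
  \sum_(m < k.+1) ('C(k, m))%:R / ((m.+1)`!)%:R *
    derive1n m (fun u => u `^ (k%:R - q) * (derive1 (Psi a) u) ^+ (k - m)) 1.

Definition fps := nat -> R.
Definition fps_mul (f g : fps) : fps :=
  fun n => \sum_(i < n.+1) f i * g (n - i)%N.
Definition fps_one : fps := fun n => if n is 0%N then 1 else 0.
Definition fps_exp_nat (f : fps) (j : nat) : fps := iter j (fps_mul f) fps_one.
(* exp G, for G with zero constant term *)
Definition fps_exp (G : fps) : fps :=
  fun n => \sum_(j < n.+1) (fps_exp_nat G j n) / (j`!)%:R.
(* log A, for A with constant term 1:  log(1+H) = sum_{j>=1} (-1)^(j+1) H^j / j *)
Definition fps_log (A : fps) : fps :=
  let H := fun n => if n is 0%N then 0 else A n in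
  fun n => \sum_(1 <= j < n.+1) (-1) ^+ j.+1 * fps_exp_nat H j n / j%:R.
Definition fps_rpow (A : fps) (c : R) : fps := fps_exp (fun n => c * fps_log A n).
Definition qpow (q : R) (F : fps) : fps :=
  if q == 0 then fps_exp (fun n => - F n)
  else fps_rpow (fun n => fps_one n - q * F n) q^-1.
Definition shifted_gf (mu : nat -> R) : fps :=
  fun n => if n is n'.+1 then mu n' else 0.

End Defs.
Arguments ones {R} N.
Arguments evec {R} N i.
Arguments fps_one {R} n.

(* Main.v *)
Require Import Defs.
From HB Require Import structures.
From mathcomp Require Import all_boot all_order all_fingroup all_algebra.
From mathcomp Require Import all_classical all_reals all_analysis.
From mathcomp Require Import measurable_realfun ring lra zify.
Set Implicit Arguments. Unset Strict Implicit. Unset Printing Implicit Defensive.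
Import Order.TTheory GRing.Theory Num.Theory.
Import numFieldNormedType.Exports.
Local Open Scope classical_set_scope.
Local Open Scope ring_scope.

(* For q = 1, the sum of the moment weights times the powers of the shifted
   coordinates l_i = lambda_i + N - i is an eigenvalue on Schur functions: with
   g_i = chi at step 0 and
     g_i |-> u_i d_i g_i + sum_(j != i) u_i (g_i - g_j) / (u_i - u_j),
   the sum of the g_i after k steps is the k-th moment, up to a power of N,
   times chi.  Averaging over the random signature, dividing by N^k S, and
   reading the recursion on derivatives at (1, ..., 1), only the derivatives in
   the i-th variable of the i-th vector survive in the limit; they form series G_k with
     y G_(k+1) = (1 + y) (1 + y Psi'(1 + y)) G_k - (1 + y) G_k(0),
   and Lagrange inversion evaluates G_k(0).  Restarting the recursion from the
   average of the k-th vectors gives mixed second moments, hence convergence in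
   probability.  For other q, one has
     1 - q sum_k M_k z^(k+1) = prod_i (1 - (x_i + q / N) z) / (1 - x_i z),
   whose logarithmic derivative expresses all moments through the power sums of
   the atoms; the latter are thus controlled by the case q = 1, and the limit is
   exp (- q L) with L independent of q.  The weights are nonnegative for
   |q| <= 1, so the limit moments are limits of moments of probability
   measures; the limit measure comes from Helly selection on quantile functions. *)

(** * Dunkl eigenvectors and partial fractions *)

(** The hypotheses live at the point (1, ..., 1), where every divided difference of the recursion
    has the form 0 / 0. This is why the recursion is read on whole arrays of derivatives at that
    point: multiplication by u_i - u_j shifts such an array, so the array of a divided difference is
    recovered from those of g_i and g_j by a finite recursion whose constants do not depend on N.
    The limits are assumed for fixed indices, whereas averaging over i needs bounds uniform in i;
    the symmetry of S supplies them, since a short word of indices can be moved to small indices.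
    Termwise differentiation of S rests on positivity: Schur functions have nonnegative
    coefficients, so their derivatives near the point are bounded by their values at finitely many
    corners of a slightly larger box. The value q = 1 is singled out because the coordinates of an
    eigenvector add up to a difference of two products, one of which vanishes, and the other one
    carries exactly the factors l_p - l_j - 1 of the weights. *)

Section PartialFractions.
Variables (F : fieldType) (I : finType).
Implicit Types (a b u x : I -> F) (P : pred I).

(** A product of factors affine in [1 / (y - u m)] has simple poles in [y], so it is its value at
    infinity plus its polar parts. The induction uses its hypothesis at [y] and again at [u m0], the
    latter for the residue at the new pole. *)
Lemma partial_fractions_seq (s : seq I) a b u (y : F) :
  uniq s -> {in s &, injective u} -> {in s, forall m, y != u m} ->
  \prod_(m <- s) (a m + b m / (y - u m)) =
  \prod_(m <- s) a m +
  \sum_(m <- s) b m / (y - u m) *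
     \prod_(n <- s | n != m) (a n + b n / (u m - u n)).
Proof.
elim: s y => [|m0 s IH] y /=; first by rewrite !big_nil addr0.
case/andP=> m0s us uinj yu.
have uinj' : {in s &, injective u}.
  by move=> x z xs zs; apply: uinj; rewrite inE ?xs ?zs orbT.
have yu' : {in s, forall m, y != u m}.
  by move=> m ms; apply: yu; rewrite inE ms orbT.
have u0 m : m \in s -> u m0 != u m.
  move=> ms; apply: contraNneq m0s => /uinj ->//; rewrite inE ?eqxx//.
  by rewrite ms orbT.
have y0 : y - u m0 != 0 by rewrite subr_eq0 yu // inE eqxx.
rewrite 3!big_cons IH //.
rewrite big_cons eqxx /= -[X in _ = _ + (_ * X + _)]big_filter.
have -> : [seq n <- s | n != m0] = s.
  by apply/all_filterP/allP => n ns; apply: contraNneq m0s => <-.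
rewrite (IH (u m0)) //.
have -> : \sum_(m <- s) b m / (y - u m) *
     \prod_(n <- m0 :: s | n != m) (a n + b n / (u m - u n)) =
   \sum_(m <- s) b m / (y - u m) * ((a m0 + b m0 / (u m - u m0)) *
     \prod_(n <- s | n != m) (a n + b n / (u m - u n))).
  rewrite !big_seq; apply: eq_bigr => m ms; rewrite big_cons.
  by case: eqVneq => [e|_] //; move: m0s; rewrite e ms.
have -> : \sum_(m <- s) b m / (y - u m) * ((a m0 + b m0 / (u m - u m0)) *
     \prod_(n <- s | n != m) (a n + b n / (u m - u n))) =
  \sum_(m <- s) ((a m0 + b m0 / (y - u m0)) * (b m / (y - u m) *
     \prod_(n <- s | n != m) (a n + b n / (u m - u n))) -
     b m0 / (y - u m0) * (b m / (u m0 - u m) *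
     \prod_(n <- s | n != m) (a n + b n / (u m - u n)))).
  rewrite !big_seq; apply: eq_bigr => m ms.
  set Q := \prod_(_ <- _ | _) _.
  have h1 : u m0 - u m != 0 by rewrite subr_eq0 u0.
  have h2 : u m - u m0 != 0 by rewrite subr_eq0 eq_sym u0.
  have h3 : y - u m != 0 by rewrite subr_eq0 yu'.
  by field; rewrite h1 h2 h3 y0.
rewrite sumrB -!mulr_sumr; ring.
Qed.

Lemma partial_fractions P a b u (y : F) :
  {in P &, injective u} -> {in P, forall m, y != u m} ->
  \prod_(m | P m) (a m + b m / (y - u m)) =
  \prod_(m | P m) a m +
  \sum_(m | P m) b m / (y - u m) *
     \prod_(n | P n && (n != m)) (a n + b n / (u m - u n)).
Proof.
move=> uinj yu.
rewrite -!(big_filter _ P) partial_fractions_seq.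
- congr (_ + _); apply: eq_bigr => m _; congr (_ * _).
  by rewrite big_filter_cond.
- by rewrite filter_uniq // index_enum_uniq.
- by move=> x z; rewrite !mem_filter => /andP[Px _] /andP[Pz _]; exact: uinj.
- by move=> m; rewrite mem_filter => /andP[Pm _]; exact: yu.
Qed.

(* [dunklB u (fun j => z - l j)] is an eigenvector, up to a multiple of
   [prod_j (z - l j)], of the Dunkl-type operator acting on [u ^ l]. *)
Definition dunklB u x (i : I) : F :=
  \prod_(j | j != i) (x j - u i / (u i - u j)).

(** The factors of [dunklB u x j] other than the one at [i]. They do not involve [u i], and
    [- u j * dunklE u x i j] is the residue of [dunklB u x i] at [u i = u j]. *)
Definition dunklE u x (i j : I) : F :=
  \prod_(n | (n != i) && (n != j)) (x n - u j / (u j - u n)).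

Let kE u x (a b : I) : injective u -> a != b ->
  x b - u a / (u a - u b) = (x b - 1) + (- u b) / (u a - u b).
Proof.
move=> uinj ab; have : u a - u b != 0 by rewrite subr_eq0 (inj_eq uinj).
by move=> h; field.
Qed.

(** Partial fractions of the product of the [x j - 1 - u j / (y - u j)], taken at [y = 0]: there
    each factor becomes [x j] and each simple fraction becomes 1. *)
Lemma dunklB_sum_cond u x P : injective u -> (forall i, u i != 0) ->
  \sum_(i | P i) \prod_(j | P j && (j != i)) (x j - u i / (u i - u j)) =
  \prod_(j | P j) x j - \prod_(j | P j) (x j - 1).
Proof.
move=> uinj u0.
have h m : - u m / (0 - u m) = 1.
  by rewrite sub0r divff // oppr_eq0 u0.
have := @partial_fractions P (fun j => x j - 1) (fun j => - u j) u 0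
  (in2W uinj).
under eq_bigr do rewrite h subrK.
move=> -> ; last by move=> m _; rewrite eq_sym u0.
rewrite addrC addKr; apply: eq_bigr => i _; rewrite h mul1r.
by apply: eq_bigr => j /andP[_ ji]; rewrite kE // eq_sym.
Qed.

Lemma dunklB_sum u x : injective u -> (forall i, u i != 0) ->
  \sum_i dunklB u x i = \prod_j x j - \prod_j (x j - 1).
Proof. exact: (@dunklB_sum_cond u x predT). Qed.

(** Confines the dependence on [u i] to simple fractions, which makes the derivative in [u i]
    immediate. *)
Lemma dunklB_pf u x (i : I) : injective u ->
  dunklB u x i =
  \prod_(j | j != i) (x j - 1) - \sum_(j | j != i) u j / (u i - u j) * dunklE u x i j.
Proof.
move=> uinj.
rewrite /dunklB; under eq_bigr => j ji do rewrite kE 1?eq_sym //.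
rewrite partial_fractions; last 2 first.
- exact: in2W.
- by move=> m mi; rewrite (inj_eq uinj) eq_sym.
congr (_ + _); rewrite -sumrN; apply: eq_bigr => m _.
rewrite !mulNr; congr (- (_ * _)).
by apply: eq_bigr => n /andP[_ nm]; rewrite kE // eq_sym.
Qed.

(** The sum with squared denominators is the derivative of [dunklB u x i] in [u i]. For
    [x j = z - l j] this is an eigenvalue equation with eigenvalue [z], up to the right side, which
    vanishes when [z] is one of the [l j]. *)
Lemma dunklB_eigen u x (i : I) : injective u -> (forall i, u i != 0) ->
  x i * dunklB u x i
  - u i * \sum_(j | j != i) u j / (u i - u j) ^+ 2 * dunklE u x i j
  + \sum_(j | j != i) u i / (u i - u j) * dunklB u x j
  = \prod_j x j.
Proof.
move=> uinj u0; rewrite (dunklB_pf _ _ uinj).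
have Bj j : j != i -> dunklB u x j = (x i - u j / (u j - u i)) * dunklE u x i j.
  move=> ji; rewrite /dunklB (bigD1 i) /=; last by rewrite eq_sym.
  by congr (_ * _); apply: eq_bigl => n; rewrite andbC.
(* Replaces the product of the [x j] over [j != i] by that of the [x j - 1] plus a sum over the same
   [j]; the identity then holds term by term. *)
have S1 := @dunklB_sum_cond u x (fun j => j != i) uinj u0.
rewrite [RHS](bigD1 i) //= -[X in _ = _ * X](subrK (\prod_(j | j != i) (x j - 1))).
rewrite -S1 [in RHS]mulrDr [in LHS]mulrBr [x i * \sum_(j | _) _]mulr_sumr.
rewrite -/(dunklE u x i) !mulr_sumr -!sumrN -addrA -addrA [RHS]addrC.
congr (_ + _); rewrite addrA -!big_split /=; apply: eq_bigr => j ji.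
rewrite Bj // -/(dunklE u x i j).
have h1 : u i - u j != 0 by rewrite subr_eq0 (inj_eq uinj) eq_sym.
have h2 : u j - u i != 0 by rewrite subr_eq0 (inj_eq uinj).
by field; rewrite h1 h2.
Qed.

(** With [k j = u i / (u i - u j)], expand the product over [j != i] of [1 - k j / (y - l j)] in
    partial fractions at [y = l i]: the product is the term [p = i], its polar parts are minus the
    other terms, and 1 is its value at infinity. *)
Lemma dunklB_interpolation u (l : I -> F) (i : I) : injective l ->
  \sum_p dunklB u (fun j => l p - l j) i / \prod_(j | j != p) (l p - l j) = 1.
Proof.
move=> linj.
have dl p j : j != p -> l p - l j != 0.
  by move=> jp; rewrite subr_eq0 (inj_eq linj) eq_sym.
pose k j := u i / (u i - u j).
have := @partial_fractions (fun j => j != i) (fun=> 1) (fun j => - k j) l (l i)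
  (in2W linj) _.
rewrite big1_eq => /(_ _)/[dup] H _.
rewrite (bigD1 i) //= [X in X + _](_ : _ = \prod_(m | m != i) (1 + - k m / (l i - l m))).
  rewrite H; last by move=> m mi; rewrite (inj_eq linj) eq_sym.
  rewrite -addrA -big_split /= big1 ?addr0 // => p pi.
  have -> : dunklB u (fun j => l p - l j) i = - k p *
      \prod_(j | (j != i) && (j != p)) (l p - l j - u i / (u i - u j)).
    by rewrite /dunklB (bigD1 p) //= subrr sub0r.
  have -> : \prod_(j | j != p) (l p - l j) =
      (l p - l i) * \prod_(j | (j != i) && (j != p)) (l p - l j).
    rewrite (bigD1 i) 1?eq_sym //=; congr (_ * _).
    by apply: eq_bigl => j; rewrite andbC.
  have -> : \prod_(n | (n != i) && (n != p)) (1 + - k n / (l p - l n)) =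
    (\prod_(j | (j != i) && (j != p)) (l p - l j - u i / (u i - u j))) /
      \prod_(j | (j != i) && (j != p)) (l p - l j).
    rewrite -prodf_div; apply: eq_bigr => j /andP[_ jp].
    by have h := dl _ _ jp; rewrite -/(k j); field.
  have h1 := dl _ _ pi; have h2 : l p - l i != 0 by rewrite dl // eq_sym.
  have h3 : \prod_(j | (j != i) && (j != p)) (l p - l j) != 0.
    by apply/prodf_neq0 => j /andP[_ jp]; exact: dl.
  by field; rewrite h1 h2 h3.
rewrite /dunklB -prodf_div; apply: eq_bigr => j ji.
by have h := dl _ _ ji; rewrite -/(k j); field.
Qed.

End PartialFractions.

(** * Formal power series and Lagrange inversion *)

Definition fser (R : realType) := nat -> R.

Section FormalSeries.
Variable R : realType.
Notation fser := (fser R).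
Implicit Types (f g h G H A : fser).

(** A coefficient of a product depends on finitely many coefficients only, so ring laws and the
    Leibniz rule are inherited from [{poly R}] through truncations. *)
Definition ftrunc (n : nat) f : {poly R} := \poly_(i < n.+1) f i.

Lemma ftruncE n f i : (i <= n)%N -> (ftrunc n f)`_i = f i.
Proof. by move=> hi; rewrite coef_poly ltnS hi. Qed.

Lemma coef_fps_mul (p q : {poly R}) f g n :
  (forall i, (i <= n)%N -> p`_i = f i) -> (forall i, (i <= n)%N -> q`_i = g i) ->
  (p * q)`_n = fps_mul f g n.
Proof.
move=> pf qg; rewrite coefM; apply: eq_bigr => i _.
by rewrite pf ?qg ?leq_subr // -ltnS.
Qed.

Lemma coef_ftruncM n m f g : (m <= n)%N ->
  (ftrunc n f * ftrunc n g)`_m = fps_mul f g m.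
Proof.
by move=> mn; apply: coef_fps_mul => i im; rewrite ftruncE // (leq_trans im).
Qed.

Lemma fps_mulC f g : fps_mul f g = fps_mul g f.
Proof. by apply/funext => n; rewrite -!(@coef_ftruncM n n) // mulrC. Qed.

Lemma fps_mulA f g h : fps_mul f (fps_mul g h) = fps_mul (fps_mul f g) h.
Proof.
apply/funext => n.
rewrite -(@coef_fps_mul (ftrunc n f) (ftrunc n g * ftrunc n h)); last 2 first.
- by move=> i; apply: ftruncE.
- by move=> i; apply: coef_ftruncM.
rewrite mulrA; apply: coef_fps_mul; last by move=> i; apply: ftruncE.
by move=> i; apply: coef_ftruncM.
Qed.

Lemma fps_mul1 f : fps_mul fps_one f = f.
Proof.
apply/funext => n; rewrite /fps_mul big_ord_recl /= mul1r subn0.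
by rewrite big1 ?addr0 // => i _; rewrite mul0r.
Qed.

Lemma fps_mulDl f g h :
  fps_mul (fun n => f n + g n) h = (fun n => fps_mul f h n + fps_mul g h n).
Proof.
by apply/funext => n; rewrite /fps_mul -big_split; apply: eq_bigr => i _; rewrite mulrDl.
Qed.

Lemma fps_one_neq0 : (fps_one : fser) != (fun=> 0).
Proof. by apply/eqP => /(congr1 (@^~ 0%N)) /eqP; rewrite /= oner_eq0. Qed.

HB.instance Definition _ := GRing.Lmodule.copy fser (nat -> R^o).
HB.instance Definition _ := GRing.Zmodule_isComNzRing.Build fser
  fps_mulA fps_mulC fps_mul1 fps_mulDl fps_one_neq0.

Lemma fps_scaleAl (c : R) f g : c *: (f * g : fser) = (c *: f : fser) * g.
Proof.
apply/funext => n; have -> : (c *: (f * g : fser)) n = c * (fps_mul f g n : R) by [].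
rewrite /fps_mul mulr_sumr.
by apply: eq_bigr => i _; rewrite mulrA.
Qed.
HB.instance Definition _ := GRing.Lmodule_isLalgebra.Build R fser fps_scaleAl.
HB.instance Definition _ := GRing.Lalgebra_isComAlgebra.Build R fser.

Lemma fserD f g n : (f + g) n = f n + g n. Proof. by []. Qed.
Lemma fserN f n : (- f) n = - f n. Proof. by []. Qed.
Lemma fserB f g n : (f - g) n = f n - g n. Proof. by []. Qed.
Lemma fser0 n : (0 : fser) n = 0. Proof. by []. Qed.
Lemma fserZ (c : R) f n : (c *: f) n = c * f n. Proof. by []. Qed.
Lemma fserM f g n : (f * g) n = \sum_(i < n.+1) f i * g (n - i)%N. Proof. by []. Qed.
Lemma fser1 n : (1 : fser) n = (n == 0%N)%:R. Proof. by case: n. Qed.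
Lemma fserM0 f g : (f * g) 0%N = f 0%N * g 0%N.
Proof. by rewrite fserM big_ord1. Qed.
Lemma fserX0 f k : (f ^+ k) 0%N = f 0%N ^+ k.
Proof. by elim: k => [|k IH]; rewrite ?expr0 // !exprS fserM0 IH. Qed.

Lemma fser_sum (I : Type) (r : seq I) (P : pred I) (F : I -> fser) n :
  (\sum_(i <- r | P i) F i) n = \sum_(i <- r | P i) F i n.
Proof.
elim: r => [|i r IH]; first by rewrite !big_nil.
by rewrite !big_cons; case: ifP => _ //; rewrite fserD IH.
Qed.

Lemma fps_exp_natE f j : fps_exp_nat f j = f ^+ j.
Proof. by elim: j => [//|j IH]; rewrite exprS -IH. Qed.

Definition fX : fser := fun n => (n == 1%N)%:R.

Lemma fXM f n : (fX * f) n = if n is n'.+1 then f n' else 0.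
Proof.
case: n => [|n]; first by rewrite fserM0 /fX mul0r.
rewrite fserM big_ord_recl /= mul0r add0r big_ord_recl /= mul1r subSS subn0.
by rewrite big1 ?addr0 // => i _; rewrite /fX mul0r.
Qed.

Lemma fXnM k f n : (fX ^+ k * f) n = if (k <= n)%N then f (n - k)%N else 0.
Proof.
elim: k n => [|k IH] n; first by rewrite expr0 mul1r subn0.
by rewrite exprS -mulrA fXM; case: n => [//|n]; rewrite IH.
Qed.

Definition fD f : fser := fun n => f n.+1 * n.+1%:R.

Lemma fD_eq f g : f 0%N = g 0%N -> fD f = fD g -> f = g.
Proof.
move=> e0 e; apply/funext => -[//|n]; move/(congr1 (@^~ n)): e; rewrite /fD.
by apply: mulIf; rewrite pnatr_eq0.
Qed.

Lemma fDD f g : fD (f + g) = fD f + fD g.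
Proof. by apply/funext => n; rewrite /fD !fserD mulrDl. Qed.
Lemma fDN f : fD (- f) = - fD f.
Proof. by apply/funext => n; rewrite /fD !fserN mulNr. Qed.
Lemma fDB f g : fD (f - g) = fD f - fD g.
Proof. by rewrite fDD fDN. Qed.
Lemma fDZ (c : R) f : fD (c *: f) = c *: fD f.
Proof. by apply/funext => n; rewrite /fD !fserZ mulrA. Qed.
Lemma fD1 : fD 1 = 0.
Proof. by apply/funext => n; rewrite /fD fser1 mul0r. Qed.
Lemma fDX : fD fX = 1.
Proof. by apply/funext => -[|n]; rewrite /fD /fX fser1 /= ?mul1r ?mul0r. Qed.
Lemma fD_sum (I : Type) (r : seq I) (P : pred I) (F : I -> fser) :
  fD (\sum_(i <- r | P i) F i) = \sum_(i <- r | P i) fD (F i).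
Proof.
elim: r => [|i r IH]; last by rewrite !big_cons; case: ifP => // _; rewrite fDD IH.
by rewrite !big_nil; apply/funext => n; rewrite /fD !fser0 mul0r.
Qed.

Lemma fDM f g : fD (f * g) = fD f * g + f * fD g.
Proof.
apply/funext => n.
pose p := ftrunc n.+1 f; pose q := ftrunc n.+1 g.
have -> : fD (f * g) n = (p * q)^`()`_n.
  by rewrite coef_deriv -mulr_natr coef_ftruncM.
have dE (h : fser) i : (i <= n)%N -> ((ftrunc n.+1 h)^`())`_i = fD h i.
  by move=> hi; rewrite coef_deriv ftruncE // -mulr_natr.
rewrite derivM coefD fserD.
rewrite (@coef_fps_mul _ _ (fD f) g) ?(@coef_fps_mul _ _ f (fD g)) //.
- by move=> i hi; rewrite ftruncE // (leq_trans hi).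
- exact: dE.
- exact: dE.
- by move=> i hi; rewrite ftruncE // (leq_trans hi).
Qed.

Lemma fDXn f k : fD (f ^+ k.+1) = (k.+1)%:R *: (f ^+ k * fD f).
Proof.
elim: k => [|k IH]; first by rewrite expr1 expr0 mul1r scale1r.
rewrite exprS fDM IH -scalerAr mulrA -exprS [X in X + _]mulrC.
by rewrite -[(k.+2)%:R]natr1 addrC scalerDl scale1r.
Qed.

Definition ordge (k : nat) f := forall i, (i < k)%N -> f i = 0.

Lemma ordgeM a b f g : ordge a f -> ordge b g -> ordge (a + b) (f * g).
Proof.
move=> fa gb i hi; rewrite fserM big1 // => j _.
case: (ltnP j a) => ja; first by rewrite fa ?mul0r.
rewrite gb ?mulr0 // ltn_subLR; last by rewrite -ltnS.
by rewrite (leq_trans hi) // leq_add2r.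
Qed.

Lemma ordgeX f k : f 0%N = 0 -> ordge k (f ^+ k).
Proof.
move=> f0; elim: k => [|k IH] //; rewrite exprS -add1n.
by apply: ordgeM IH; case.
Qed.

Lemma ordgeMl k f g : ordge k f -> ordge k (f * g).
Proof. by move=> fk; rewrite -[k]addn0; apply: ordgeM. Qed.

Lemma fser_mulI0 f g : g 0%N != 0 -> f * g = 0 -> f = 0.
Proof.
move=> g0 fg; apply/funext => n; rewrite fser0.
elim/ltn_ind: n => n IH; move/(congr1 (@^~ n)): fg.
rewrite fserM fser0 big_ord_recr /= big1 ?add0r; last first.
  by move=> i _; rewrite IH ?mul0r.
by move/eqP; rewrite subnn mulf_eq0 (negPf g0) orbF => /eqP.
Qed.

Lemma fser_mulI f1 f2 g : g 0%N != 0 -> f1 * g = f2 * g -> f1 = f2.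
Proof.
move=> g0 /eqP; rewrite -subr_eq0 -mulrBl => /eqP /(fser_mulI0 g0) /eqP.
by rewrite subr_eq0 => /eqP.
Qed.

(** The equation yields each coefficient from the earlier ones. Identities between exponentials are
    proved below by checking that both sides solve the same equation. *)
Lemma fD_ode_unique h f g :
  f 0%N = g 0%N -> fD f = h * f -> fD g = h * g -> f = g.
Proof.
move=> e0 ef eg; apply/funext; elim/ltn_ind => -[//|n] IH.
move/(congr1 (@^~ n)): ef; move/(congr1 (@^~ n)): eg; rewrite /fD !fserM => eg ef.
have n0 : n.+1%:R != 0 :> R by rewrite pnatr_eq0.
apply: (mulIf n0); rewrite ef eg; apply: eq_bigr => i _.
by rewrite IH // ltnS leq_subr.
Qed.

(** In [fps_exp] the number of terms depends on the coefficient. Since [G ^+ j] has order at least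
    [j], any larger common number of terms gives the same coefficient, and the resulting finite sum
    can be differentiated. *)
Lemma fps_expE G M n : G 0%N = 0 -> (n < M)%N ->
  fps_exp G n = (\sum_(j < M) (j`!%:R)^-1 *: (G ^+ j : fser)) n.
Proof.
move=> G0 nM; rewrite fser_sum /fps_exp -(big_mkord xpredT (fun j => fps_exp_nat G j n / j`!%:R)).
rewrite -(big_mkord xpredT (fun j => ((j`!%:R)^-1 *: (G ^+ j : fser)) n)).
rewrite [RHS](big_cat_nat (leq0n _) nM) //= [X in _ = _ + X]big_nat_cond [X in _ = _ + X]big1 ?addr0.
  by apply: eq_bigr => j _; rewrite fserZ fps_exp_natE mulrC.
by move=> j /andP[/andP[hj _] _]; rewrite fserZ ordgeX ?mulr0.
Qed.

Lemma fD_fps_exp G : G 0%N = 0 -> fD (fps_exp G) = fD G * fps_exp G.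
Proof.
move=> G0; apply/funext => n.
have -> : fD (fps_exp G) n =
    fD (\sum_(j < n.+2) (j`!%:R)^-1 *: (G ^+ j : fser)) n.
  by rewrite /fD (@fps_expE _ n.+2).
have -> : (fD G * fps_exp G) n =
    (fD G * \sum_(j < n.+1) (j`!%:R)^-1 *: (G ^+ j : fser)) n.
  rewrite !fserM; apply: eq_bigr => i _; congr (_ * _).
  by rewrite (@fps_expE _ n.+1) // ltnS leq_subr.
congr (_ n); rewrite fD_sum big_ord_recl /= fact0 invr1 scale1r expr0 fD1 add0r.
rewrite mulr_sumr; apply: eq_bigr => j _.
rewrite fDZ fDXn scalerA -scalerAr [G ^+ _ * _]mulrC; congr (_ *: _).
rewrite factS natrM invfM mulrC mulrA mulfV ?mul1r // pnatr_eq0 //.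
Qed.

Lemma fps_exp0 G : fps_exp G 0%N = 1.
Proof. by rewrite /fps_exp big_ord1 /= fact0 divr1. Qed.

Lemma fps_logE A M n : (n < M)%N ->
  fps_log A n = (\sum_(j < M) ((-1) ^+ j / j.+1%:R) *: ((A - (A 0%N) *: (1 : fser)) ^+ j.+1)) n.
Proof.
move=> nM; rewrite /fps_log.
have -> : (fun n0 => if n0 is 0%N then 0 else A n0) = A - (A 0%N) *: (1 : fser).
  apply/funext => -[|i]; rewrite fserB fserZ fser1 /= ?mulr1 ?subrr //.
  by rewrite mulr0 subr0.
set H := A - _; have H0 : H 0%N = 0 by rewrite /H fserB fserZ fser1 mulr1 subrr.
rewrite fser_sum big_add1 /= -(big_mkord xpredT (fun j => ((-1) ^+ j / j.+1%:R *: (H ^+ j.+1)) n)).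
rewrite [RHS](big_cat_nat (leq0n _) (ltnW nM)) //= [X in _ = _ + X]big_nat_cond [X in _ = _ + X]big1 ?addr0.
  apply: eq_bigr => j _; rewrite fserZ fps_exp_natE.
  by rewrite !exprS !mulN1r opprK mulrAC.
by move=> j /andP[/andP[hj _] _]; rewrite fserZ ordgeX ?mulr0 // ltnS.
Qed.

Lemma fps_log0 A : fps_log A 0%N = 0.
Proof. by rewrite /fps_log big_geq. Qed.

(** The derivative of the truncated logarithm is [fD A] times a geometric sum in [1 - A]; multiplied
    by [A] it telescopes, with a remainder of order [n + 2]. *)
Lemma fD_fps_log A : A 0%N = 1 -> fD (fps_log A) * A = fD A.
Proof.
move=> A0; apply/funext => n; rewrite /=.
pose H := A - (A 0%N) *: (1 : fser).
pose L := \sum_(j < n.+2) ((-1) ^+ j / j.+1%:R) *: (H ^+ j.+1).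
have H0 : H 0%N = 0 by rewrite /H fserB fserZ fser1 mulr1 subrr.
have AE : A = 1 + H by rewrite /H A0 scale1r addrC subrK.
have -> : (fD (fps_log A) * A) n = (fD L * A) n.
  rewrite !fserM; apply: eq_bigr => i _; congr (_ * _).
  by rewrite /fD (@fps_logE _ n.+2) // ltnS.
have -> : fD L = (\sum_(j < n.+2) (- H) ^+ j) * fD H.
  rewrite fD_sum mulr_suml; apply: eq_bigr => j _.
  rewrite fDZ fDXn scalerA divfK ?pnatr_eq0 // scalerAl; congr (_ * _).
  by rewrite -[in RHS]scaleN1r exprZn.
have -> : fD H = fD A by rewrite /H fDB fDZ fD1 scaler0 subr0.
have e : (\sum_(j < n.+2) (- H) ^+ j) * A = 1 - (- H) ^+ n.+2.
  have := subrX1 (- H) n.+2; move: AE; move: (\sum_(j < _) _) ((- H) ^+ _) => S T.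
  by move=> {1}-> h; rewrite -[1 - T]opprB h; ring.
rewrite mulrAC e mulrBl mul1r fserB (@ordgeMl n.+2) ?subr0 //.
by apply: (@ordgeX _ n.+2) => //; rewrite fserN H0 oppr0.
Qed.

Lemma fps_exp_neq0 G : fps_exp G 0%N != 0.
Proof. by rewrite fps_exp0 oner_eq0. Qed.

Lemma fps_expK G : G 0%N = 0 -> fps_log (fps_exp G) = G.
Proof.
move=> G0; apply: fD_eq; first by rewrite fps_log0.
apply: (@fser_mulI _ _ (fps_exp G)); first exact: fps_exp_neq0.
by rewrite fD_fps_log ?fps_exp0 // fD_fps_exp.
Qed.

Lemma fps_logK A : A 0%N = 1 -> fps_exp (fps_log A) = A.
Proof.
move=> A0; apply: (@fD_ode_unique (fD (fps_log A))).
- by rewrite fps_exp0.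
- by rewrite fD_fps_exp ?fps_log0.
- by rewrite fD_fps_log.
Qed.

Lemma fps_expD G H : G 0%N = 0 -> H 0%N = 0 ->
  fps_exp (G + H) = (fps_exp G : fser) * fps_exp H.
Proof.
move=> G0 H0; apply: (@fD_ode_unique (fD G + fD H)).
- by rewrite fserM0 !fps_exp0 mulr1.
- by rewrite fD_fps_exp ?fDD // fserD G0 H0 addr0.
- by rewrite fDM !fD_fps_exp //; ring.
Qed.
End FormalSeries.

Section Substitution.
Variable R : realType.
Notation fser := (fser R).
Implicit Types (f g h c d w phi psi G H A : fser).

(** The composite series [c (w y)]; when [w] has no constant term, the powers of [w] beyond [n] do
    not reach the coefficient [n]. *)
Definition fsub w c : fser := fun n => \sum_(m < n.+1) c m * (w ^+ m) n.

Lemma fsubE w c M n : w 0%N = 0 -> (n < M)%N ->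
  fsub w c n = (\sum_(m < M) c m *: (w ^+ m)) n.
Proof.
move=> w0 nM; rewrite fser_sum /fsub -(big_mkord xpredT (fun m => c m * (w ^+ m) n)).
rewrite -(big_mkord xpredT (fun j => (c j *: (w ^+ j)) n)).
rewrite [RHS](big_cat_nat (leq0n _) nM) //=.
rewrite [X in _ = _ + X]big_nat_cond [X in _ = _ + X]big1 ?addr0 //.
by move=> j /andP[/andP[hj _] _]; rewrite fserZ ordgeX ?mulr0.
Qed.

(** For a polynomial, substitution is the evaluation morphism; agreement up to degree [n] then
    transports multiplicativity to series. *)
Lemma fsub_horner w c (p : {poly R}) n : w 0%N = 0 ->
  (forall i, (i <= n)%N -> p`_i = c i) -> horner_alg w p n = fsub w c n.
Proof.
move=> w0 pc; rewrite (@fsubE _ _ (maxn n.+1 (size p))) ?leq_maxl //.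
rewrite /horner_alg /horner_morph (@horner_coef_wide _ (maxn n.+1 (size p))); last first.
  by rewrite size_map_poly leq_maxr.
rewrite !fser_sum; apply: eq_bigr => i _; rewrite coef_map /=.
case: (leqP i n) => hi; first by rewrite pc // mulr_algl.
by rewrite mulr_algl !fserZ ordgeX ?mulr0.
Qed.

Lemma fsubM w c d : w 0%N = 0 -> fsub w (c * d) = fsub w c * fsub w d.
Proof.
move=> w0; apply/funext => n.
rewrite -(@fsub_horner _ _ (ftrunc n c * ftrunc n d)) //; last first.
  by move=> i hi; rewrite coef_ftruncM.
rewrite rmorphM !fserM; apply: eq_bigr => i _.
have lin : (i <= n)%N by rewrite -ltnS.
by congr (_ * _); apply: fsub_horner => // j hj; apply: ftruncE;
  rewrite (leq_trans hj) // leq_subr.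
Qed.

Lemma fsub1 w : w 0%N = 0 -> fsub w 1 = 1.
Proof.
move=> w0; apply/funext => n; rewrite -(@fsub_horner _ _ 1) ?rmorph1 //.
by move=> i _; rewrite coef1 fser1.
Qed.

Lemma fsub_0 w c : fsub w c 0%N = c 0%N.
Proof. by rewrite /fsub big_ord1 expr0 fser1 mulr1. Qed.

Lemma fD_fsub w c : w 0%N = 0 -> fD (fsub w c) = fD w * fsub w (fD c).
Proof.
move=> w0; apply/funext => n.
have -> : fD (fsub w c) n = fD (\sum_(m < n.+2) c m *: (w ^+ m)) n.
  by rewrite /fD (@fsubE _ _ n.+2).
have -> : (fD w * fsub w (fD c)) n =
    (fD w * \sum_(m < n.+1) fD c m *: (w ^+ m)) n.
  rewrite !fserM; apply: eq_bigr => i _; congr (_ * _).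
  by rewrite (@fsubE _ _ n.+1) // ltnS leq_subr.
congr (_ n); rewrite fD_sum big_ord_recl /= expr0 fDZ fD1 scaler0 add0r.
rewrite mulr_sumr; apply: eq_bigr => j _.
by rewrite fDZ fDXn scalerA -scalerAr [w ^+ _ * _]mulrC.
Qed.

Lemma fps_exp_zero : fps_exp (0 : fser) = 1 :> fser.
Proof.
apply: (@fD_ode_unique _ 0).
- by rewrite fps_exp0.
- by rewrite fD_fps_exp // [fD 0](_ : _ = 0) ?mul0r //; apply/funext => n; rewrite /fD mul0r.
- by rewrite fD1 mul0r.
Qed.

Lemma fsub_exp w G : w 0%N = 0 -> G 0%N = 0 ->
  fsub w (fps_exp G) = fps_exp (fsub w G).
Proof.
move=> w0 G0; apply: (@fD_ode_unique _ (fD (fsub w G))).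
- by rewrite fsub_0 !fps_exp0.
- by rewrite !fD_fsub // fD_fps_exp // fsubM // mulrA.
- by rewrite fD_fps_exp // fsub_0.
Qed.

(* Lagrange inversion: [lagr phi h] is the expansion of [h] in powers of
   [y / phi y]. *)
Definition lagr phi h : fser :=
  fun n => if n is k.+1 then (fD h * phi ^+ n) k / n%:R else h 0%N.

(** The series [y / phi y], with [1 / phi] written as the exponential of minus the logarithm. *)
Definition lagr_var phi : fser := fX R * fps_exp (- fps_log phi).

Section Lagrange.
Variable phi : fser.
Hypothesis phi0 : phi 0%N = 1.
Let w := lagr_var phi.

Lemma lagr_varM : w * phi = fX R.
Proof.
rewrite /w /lagr_var -mulrA -{2}(fps_logK phi0) -fps_expD ?fserN ?fps_log0 ?oppr0 //.
by rewrite addNr fps_exp_zero mulr1.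
Qed.

Lemma lagr_var0 : w 0%N = 0.
Proof. by rewrite /w /lagr_var fXM. Qed.

Let Dw : fD w * phi ^+ 2 = phi - fX R * fD phi.
Proof.
have := congr1 (@fD R) lagr_varM; rewrite fDM fDX => e.
have -> : fD w * phi ^+ 2 = (fD w * phi + w * fD phi) * phi - (w * phi) * fD phi by ring.
by rewrite e lagr_varM mul1r.
Qed.

Let wXphi m : w ^+ m * phi ^+ m = fX R ^+ m.
Proof. by rewrite -exprMn lagr_varM. Qed.

(** As [phi = y / w], this is the residue of [w ^ (m - n - 1) dw]: all powers other than [-1] are
    exact or, for [m > n], regular. *)
Lemma lagr_residue m n :
  (w ^+ m * fD w * phi ^+ n.+1) n = (m == n)%:R.
Proof.
case: (ltngtP m n) => mn.
- have -> : n.+1 = (m + (n - m - 1) + 2)%N by lia.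
  set j := (n - m - 1)%N.
  have -> : w ^+ m * fD w * phi ^+ (m + j + 2) =
     (w ^+ m * phi ^+ m) * (phi ^+ j * (fD w * phi ^+ 2)) by rewrite !exprD; ring.
  rewrite wXphi Dw fXnM (ltnW mn) mulrBr.
  (* The coefficient of degree [j + 1] of [phi ^+ j.+1] occurs twice, once directly and once through
     the derivative of that power divided by [j + 1], and cancels. *)
  have -> : phi ^+ j * (fX R * fD phi) = fX R * (j.+1%:R^-1 *: fD (phi ^+ j.+1)).
    by rewrite fDXn scalerA mulVf ?pnatr_eq0 // scale1r; ring.
  have -> : (n - m = j.+1)%N by lia.
  rewrite fserB fXM fserZ /fD -exprSr mulrCA mulVf ?pnatr_eq0 // mulr1.
  by rewrite subrr.
- rewrite (@ordgeMl _ m) //.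
  by apply: ordgeMl; apply: ordgeX; exact: lagr_var0.
- rewrite mn -[X in (w ^+ X)]/n.
  have -> : w ^+ n * fD w * phi ^+ n.+1 = (w ^+ n * phi ^+ n) * (fD w * phi) by rewrite exprS; ring.
  rewrite wXphi fXnM leqnn subnn fserM0 phi0 mulr1.
  have := congr1 (@^~ 0%N) (congr1 (@fD R) lagr_varM).
  by rewrite fDM fDX fserD !fserM0 lagr_var0 mul0r addr0 phi0 mulr1 fser1.
Qed.

(** Residues pick out of the expansion in powers of [w] the only term that contributes, the one of
    index [n] of [fD c]. *)
Lemma lagr_fsub c : lagr phi (fsub w c) = c.
Proof.
apply/funext => -[|n]; rewrite /lagr ?fsub_0 //.
rewrite (fD_fsub _ lagr_var0).
have -> : fD w * fsub w (fD c) * phi ^+ n.+1 =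
   fsub w (fD c) * (fD w * phi ^+ n.+1) by ring.
have -> : (fsub w (fD c) * (fD w * phi ^+ n.+1)) n =
   ((\sum_(m < n.+1) fD c m *: (w ^+ m)) * (fD w * phi ^+ n.+1)) n.
  rewrite !fserM; apply: eq_bigr => i _; congr (_ * _).
  by rewrite (@fsubE _ _ n.+1) //; exact: lagr_var0.
rewrite [_ * (fD w * _)]mulr_suml fser_sum (bigD1 ord_max) //= big1 ?addr0; last first.
  move=> i /eqP hi; rewrite -scalerAl fserZ mulrA lagr_residue.
  by case: eqP => [e|_]; rewrite ?mulr0 //; case: hi; apply/val_inj.
by rewrite -scalerAl fserZ mulrA lagr_residue eqxx mulr1 /fD mulfK // pnatr_eq0.
Qed.

Lemma lagrB h1 h2 : lagr phi (h1 - h2) = lagr phi h1 - lagr phi h2.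
Proof.
apply/funext => -[|n]; rewrite fserB /lagr ?fserB //.
by rewrite fDB mulrBl fserB mulrBl.
Qed.

Lemma lagrZ (a : R) h : lagr phi (a *: h) = a *: lagr phi h.
Proof.
apply/funext => -[|n]; rewrite fserZ /lagr ?fserZ //.
by rewrite fDZ -scalerAl fserZ mulrA.
Qed.

(** The coefficients of [lagr phi h] are triangular in those of [fD h], with the powers of
    [phi 0 = 1] on the diagonal. Injectivity turns the one-sided inverse [lagr_fsub] into a
    two-sided one. *)
Lemma lagr_eq0 h : lagr phi h = 0 -> h = 0.
Proof.
move=> e; have e0 := congr1 (@^~ 0%N) e.
apply: fD_eq; first by rewrite -[LHS]/(lagr phi h 0%N) e.
apply/funext => n; rewrite [RHS]mul0r.
elim/ltn_ind: n => n IH.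
move/(congr1 (@^~ n.+1)): e => /eqP; rewrite /lagr fser0 mulf_eq0 invr_eq0 pnatr_eq0 orbF.
rewrite fserM big_ord_recr /= big1 ?add0r => [|i _]; last by rewrite IH ?mul0r.
by rewrite subnn fserX0 phi0 expr1n mulr1 => /eqP.
Qed.

Lemma fsub_lagr h : fsub w (lagr phi h) = h.
Proof.
apply/eqP; rewrite -subr_eq0; apply/eqP; apply: lagr_eq0.
by rewrite lagrB lagr_fsub subrr.
Qed.

Lemma lagr1 : lagr phi 1 = 1.
Proof. by rewrite -[in LHS](fsub1 lagr_var0) lagr_fsub. Qed.

(** Being inverse to a substitution, [lagr phi] commutes with the exponential although its
    definition is only visibly linear. *)
Lemma lagr_exp G : G 0%N = 0 -> lagr phi (fps_exp G) = fps_exp (lagr phi G).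
Proof.
move=> G0; rewrite -{1}(fsub_lagr G) -fsub_exp ?lagr_fsub //.
exact: lagr_var0.
Qed.

End Lagrange.

(* [fpow r] is the binomial series (1 + y)^r. *)
Definition fell : fser := fps_log (1 + fX R).
Definition fpow (r : R) : fser := fps_exp (r *: fell).

Let xX0 : ((1 : fser) + fX R) 0%N = 1.
Proof. by rewrite fserD fser1 /fX addr0. Qed.

Lemma fell0 : fell 0%N = 0. Proof. exact: fps_log0. Qed.

Lemma fpow0E r : fpow r 0%N = 1. Proof. exact: fps_exp0. Qed.

Lemma fpowD r s : fpow (r + s) = fpow r * fpow s.
Proof.
by rewrite /fpow scalerDl fps_expD // fserZ fell0 mulr0.
Qed.

Lemma fpow1 : fpow 1 = 1 + fX R.
Proof. by rewrite /fpow scale1r fps_logK. Qed.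

Lemma fpow0 : fpow 0 = 1.
Proof.
apply: (@fser_mulI _ _ _ (fpow 1)); first by rewrite fpow0E oner_eq0.
by rewrite -fpowD add0r mul1r.
Qed.

Lemma fpow_nat n : fpow n%:R = (1 + fX R) ^+ n.
Proof.
by elim: n => [|n IH]; rewrite ?fpow0 // -addn1 natrD fpowD IH fpow1 exprD expr1.
Qed.

Lemma fD_fell : fD fell = fpow (-1).
Proof.
apply: (@fser_mulI _ _ _ (1 + fX R)); first by rewrite xX0 oner_eq0.
by rewrite fD_fps_log // -{2}fpow1 -fpowD addNr fpow0 fDD fD1 fDX add0r.
Qed.

Lemma fD_fpow r : fD (fpow r) = r *: fpow (r - 1).
Proof.
rewrite /fpow fD_fps_exp; last by rewrite fserZ fell0 mulr0.
by rewrite fDZ fD_fell -scalerAl -/(fpow r) -fpowD addrC.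
Qed.

(* With [psi] the expansion of Psi' at 1, [phi psi] is the function of the
   functional equation y = z (1 + y) (1 + y Psi'(1 + y)). *)
Definition fphi psi : fser := (1 + fX R) * (1 + fX R * psi).

Lemma fphi0 psi : fphi psi 0%N = 1.
Proof. by rewrite /fphi fserM0 xX0 fserD fXM addr0 fser1 mulr1. Qed.

(** The limit moments with Taylor coefficients at 1 in place of derivatives; the factorial in
    [m! / (m + 1)!] leaves [1 / (m + 1)]. *)
Definition fmoment psi (q : R) (k : nat) : R :=
  \sum_(m < k.+1) ('C(k, m))%:R / (m.+1)%:R * (fpow (k%:R - q) * psi ^+ (k - m)) m.

(** The power of [1 + y] in [fphi psi ^+ k.+1] merges with that of [fD h], and the binomial
    expansion of the remaining factor gives the sum over [m]. For [q = 0] the series [h] is a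
    logarithm, otherwise a power of [1 + y], up to constants. *)
Lemma fmoment_lagr psi h q k : fD h = fpow (- q - 1) ->
  lagr (fphi psi) h k.+1 = fmoment psi q k.
Proof.
move=> Dh; rewrite /lagr Dh /fphi exprMn -fpow_nat mulrA -fpowD.
have -> : - q - 1 + k.+1%:R = k%:R - q by rewrite -natr1; ring.
(* The top binomial term has order [k + 1] and does not contribute; in reverse order, the term of
   index [m] carries [psi ^+ (k - m)]. *)
rewrite exprDn [fpow _ * _]mulr_sumr fser_sum mulr_suml big_ord_recr /= expr1n mul1r.
rewrite binn mulr1n exprMn [fpow _ * _](_ : _ = fX R ^+ k.+1 * (fpow (k%:R - q) * psi ^+ k.+1)); last by ring.
rewrite fXnM ltnn mul0r addr0 (reindex_inj rev_ord_inj) /=.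
apply: eq_bigr => m _; rewrite expr1n mul1r subSS.
have mk : (m <= k)%N by rewrite -ltnS.
have -> : fpow (k%:R - q) * ((fX R * psi) ^+ (k - m) *+ 'C(k.+1, k - m)) =
   fX R ^+ (k - m) * (('C(k.+1, k - m))%:R *: (fpow (k%:R - q) * psi ^+ (k - m))).
  by rewrite scaler_nat exprMn; ring.
rewrite fXnM leq_subr subKn // fserZ mulrAC; congr (_ * _).
have e : ('C(k.+1, k - m) * m.+1 = k.+1 * 'C(k, m))%N.
  by rewrite -bin_sub ?(leq_trans (leq_subr _ _)) // subSn ?leq_subr // subKn // mulnC -mul_bin_diag.
apply/eqP; rewrite eqr_div ?pnatr_eq0 //.
by rewrite -!natrM e mulnC.
Qed.

Lemma lagr_fpow psi (q : R) :
  lagr (fphi psi) (fpow (- q)) = fps_exp (- q *: lagr (fphi psi) fell).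
Proof.
rewrite /fpow (lagr_exp (fphi0 psi)) ?lagrZ //; last by rewrite fserZ fell0 mulr0.
Qed.

Lemma shifted_fmoment0 psi : shifted_gf (fmoment psi 0) = lagr (fphi psi) fell.
Proof.
apply/funext => -[|k]; first by rewrite /= fell0.
by rewrite (@fmoment_lagr _ _ 0) // oppr0 add0r fD_fell.
Qed.

(** In the variable [y] with [z = y / phi y] both sides are [(1 + y) ^ (- q)]. Its root of order [q]
    is [1 / (1 + y)] for every [q], which is the identity relating the limits. *)
Lemma shifted_fmoment psi q :
  1 - q *: (shifted_gf (fmoment psi q) : fser) =
  fps_exp (- q *: lagr (fphi psi) fell).
Proof.
case: (eqVneq q 0) => [->|q0].
  rewrite -lagr_fpow oppr0 fpow0 scale0r subr0 lagr1 //; exact: fphi0.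
rewrite -lagr_fpow; apply/funext => -[|k]; rewrite fserB fserZ fser1.
  by rewrite /= mulr0 subr0 fpow0E.
rewrite [shifted_gf _ _]/= -(@fmoment_lagr _ (q^-1 *: (1 - fpow (- q)))) ?lagrZ ?lagrB ?lagr1 ?fserZ ?fserB; try exact: fphi0.
- by rewrite mulrA mulfV // mul1r fser1 !sub0r opprK.
- by rewrite fDZ fDB fD1 sub0r fD_fpow scaleNr opprK scalerA mulVf // scale1r.
Qed.

Lemma qpow_fmoment psi q :
  qpow q (shifted_gf (fmoment psi q)) = fps_exp (- lagr (fphi psi) fell).
Proof.
rewrite /qpow; case: eqVneq => [->|q0].
  by rewrite shifted_fmoment0.
have := shifted_fmoment psi q.
set L := lagr _ fell => e.
have L0 : L 0%N = 0 by rewrite /L /lagr fell0.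
rewrite /fps_rpow -[fun n => fps_one n - _]/(1 - q *: (shifted_gf (fmoment psi q) : fser)) e.
rewrite fps_expK; last by rewrite fserZ L0 mulr0.
rewrite -[fun n => _]/(q^-1 *: (- q *: L)) scalerA mulrN mulVf // scaleN1r.
by [].
Qed.

(* The recursion satisfied, as N grows, by the Dunkl vectors of [gamma_step]. *)
Lemma dunkl_recursion_fmoment psi (G : nat -> fser) :
  G 0%N = 1 ->
  (forall k, fX R * G k.+1 = fphi psi * G k - G k 0%N *: (1 + fX R)) ->
  forall k, G k 0%N = fmoment psi 1 k.
Proof.
move=> G0 GS.
pose phi := fphi psi; have phi0 : phi 0%N = 1 := fphi0 psi.
pose w := lagr_var phi; have w0 : w 0%N = 0 := lagr_var0 phi.
pose A : fser := fun n => if n is k.+1 then G k 0%N else 0.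
have step k : phi * G k = (w * phi) * G k.+1 + G k 0%N *: fpow 1.
  by rewrite lagr_varM // GS fpow1 subrK.
(* The recursion applied [M] times: a partial expansion of [phi] in powers of [w], with a remainder
   of order at least [M]. *)
have iter M : phi = (\sum_(k < M) G k 0%N *: (w ^+ k)) * fpow 1 + w ^+ M * (phi * G M).
  elim: M => [|M IH]; first by rewrite big_ord0 mul0r add0r expr0 mul1r G0 mulr1.
  rewrite {1}IH step big_ord_recr /= mulrDl exprSr.
  rewrite [in LHS]mulrDr addrA -!addrA; congr (_ + _).
  by rewrite addrC -scalerAr -scalerAl; congr (_ + _); ring.
(* Multiplying the expansion of [phi] by [w / (1 + y)] turns the left side into
   [y / (1 + y) = 1 - 1 / (1 + y)], because [w * phi = fX]. *)
have key : fsub w A = 1 - fpow (-1).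
  apply/funext => n.
  have e1 : (w * phi) * fpow (-1) = 1 - fpow (-1).
    rewrite lagr_varM // -[fX R](addrK 1) [fX R + 1]addrC -fpow1 mulrBl -fpowD.
    by rewrite addrN fpow0 mul1r.
  have e2 : fpow 1 * fpow (-1) = 1 by rewrite -fpowD addrN fpow0.
  rewrite -e1 {1}(iter n.+1) (@fsubE _ _ n.+2) //.
  rewrite big_ord_recl /= scale0r add0r.
  have -> : w * ((\sum_(k < n.+1) G k 0%N *: w ^+ k) * fpow 1 +
      w ^+ n.+1 * (phi * G n.+1)) * fpow (-1) =
      w * (\sum_(k < n.+1) G k 0%N *: w ^+ k) * (fpow 1 * fpow (-1)) +
      w ^+ n.+1 * (w * phi * G n.+1 * fpow (-1)) by ring.
  rewrite e2 mulr1 fserD [(w ^+ n.+1 * _) n](@ordgeMl _ n.+1) ?addr0 //; last exact: ordgeX.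
  congr (_ n); rewrite mulr_sumr; apply: eq_bigr => k _.
  by rewrite -scalerAr -exprS.
move=> k; rewrite -[LHS]/(A k.+1) -(lagr_fsub phi0 A) -/w key.
by rewrite (@fmoment_lagr _ _ 1) // fDB fD1 sub0r fD_fpow scaleN1r opprK.
Qed.

End Substitution.

(** * The limit moments as coefficients *)

Section OneVariableJets.
Variable R : realType.
Notation fser := (fser R).
Implicit Types (c d : fser) (f g : R -> R).

(** Differentiability up to order [n] near 1 with Taylor coefficients [c]. The derivative is
    provided as a witness, so that sums, products and power series are handled by induction without
    computing iterated derivatives. *)
Fixpoint jet1 (n : nat) (f : R -> R) (c : fser) : Prop :=
  f 1 = c 0%N /\
  if n is m.+1 then
    exists f', (\forall x \near (1 : R), is_derive (x : R) (1 : R) f (f' x)) /\ jet1 m f' (fD c)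
  else True.

Lemma jet1W n f c : jet1 n.+1 f c -> jet1 n f c.
Proof.
elim: n f c => [|n IH] f c [f1 [f' [df jf]]]; split => //.
by exists f'; split => //; apply: IH.
Qed.

Lemma jet1_near n f g c :
  (\forall x \near (1 : R), f x = g x) -> jet1 n f c -> jet1 n g c.
Proof.
move=> fg; have e1 := nbhs_singleton fg.
case: n => [|n] [f1 H]; split; rewrite -?e1 //.
case: H => f' [df jf]; exists f'; split => //.
move: fg => /nbhs_interior fg; near=> x.
by apply: (@near_eq_is_derive _ _ _ f); [near: x | near: x].
Unshelve. all: by end_near. Qed.

Lemma jet1D n f g c d : jet1 n f c -> jet1 n g d -> jet1 n (f \+ g) (c + d).
Proof.
elim: n f g c d => [|n IH] f g c d [f1 H] [g1 K]; split; rewrite ?fserD -?f1 -?g1 //.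
case: H => f' [df jf]; case: K => g' [dg jg].
exists (f' \+ g'); split; last by rewrite fDD; apply: IH.
by near=> x; apply: is_deriveD; near: x.
Unshelve. all: by end_near. Qed.

Lemma jet1M n f g c d : jet1 n f c -> jet1 n g d -> jet1 n (f \* g) (c * d).
Proof.
elim: n f g c d => [|n IH] f g c d jf jg.
  by case: jf => f1 _; case: jg => g1 _; split => //=; rewrite fserM0 -f1 -g1.
have jf0 := jet1W jf; have jg0 := jet1W jg.
case: jf => f1 [f' [df jf]]; case: jg => g1 [g' [dg jg]].
split; first by rewrite /= fserM0 -f1 -g1.
exists ((f' \* g) \+ (f \* g')); split; last by rewrite fDM; apply: jet1D; apply: IH.
near=> x.
have dfx : is_derive (x : R) (1 : R) f (f' x) by near: x.
have dgx : is_derive (x : R) (1 : R) g (g' x) by near: x.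
apply: is_derive_eq.
by rewrite /= addrC -![_ *: _]/(_ * _) [g x * _]mulrC.
Unshelve. all: by end_near. Qed.

Lemma jet1_cst n (a : R) : jet1 n (cst a) (a *: 1).
Proof.
elim: n a => [|n IH] a; split; rewrite ?fserZ ?fser1 ?mulr1 //.
exists (cst 0); split; first by near=> x; apply: is_derive_cst.
by have := IH 0; rewrite scale0r fDZ fD1 scaler0.
Unshelve. all: by end_near. Qed.

Lemma jet1X n f c k : jet1 n f c -> jet1 n (fun x => f x ^+ k) (c ^+ k).
Proof.
move=> jf; elim: k => [|k IH].
  by have := jet1_cst n 1; rewrite scale1r expr0; under eq_fun do rewrite expr0.
by under eq_fun do rewrite exprS; rewrite exprS; apply: jet1M.
Qed.

Lemma jet1_derive1n n f c : jet1 n f c -> derive1n n f 1 = n`!%:R * c n.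
Proof.
elim: n f c => [|n IH] f c; first by case=> f1 _; rewrite derive1n0 fact0 mul1r.
case=> f1 [f' [df jf]]; rewrite derive1Sn (IH _ (fD c)).
  by rewrite /fD factS natrM; ring.
apply: jet1_near jf; near=> x; rewrite derive1E.
by have [_ ->] : is_derive (x : R) (1 : R) f (f' x) by near: x.
Unshelve. all: by end_near. Qed.

Lemma jet1_powR n (r : R) : jet1 n (fun x : R => x `^ r) (fpow r).
Proof.
elim: n r => [|n IH] r; split; rewrite /= ?powR1 ?fpow0E //.
exists (fun x => r * x `^ (r - 1)); split.
  by near=> x; apply: is_derive1_powR; near: x;
    exists 1 => //= y; rewrite /= ltr_norml => /andP[]; lra.
rewrite fD_fpow -[fpow _]mul1r scalerAl.
exact: (@jet1M n (cst r) (fun x : R => x `^ (r - 1))  _ _ (jet1_cst n r) (IH _)).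
Unshelve. all: by end_near. Qed.

(** The factor [n + 1] is absorbed by a radius [s = |z| + h] halfway between [|z|] and [|x|], since
    [(n + 1) * |z| ^ n * h <= s ^ (n + 1)]; then a geometric series of ratio [s / |x|] dominates. *)
Lemma is_cvg_pseries_diffs c (x z : R) :
  cvgn (pseries c x) -> `|z| < `|x| -> cvgn (pseries (pseries_diffs c) z).
Proof.
move=> Cx zLx; have [K [Kreal Kf]] := cvg_series_bounded Cx.
pose s := (`|z| + `|x|) / 2; pose h := s - `|z|.
have h0 : 0 < h by rewrite /h /s; lra.
have s0 : 0 < s by rewrite (lt_le_trans h0) // /h lerBlDr lerDl.
have sx : s < `|x| by rewrite /s; lra.
have x0 : 0 < `|x| by apply: lt_trans sx.
have bin n : n.+1%:R * `|z| ^+ n * h <= s ^+ n.+1.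
  have -> : s = `|z| + h by rewrite /h; ring.
  elim: n => [|n IH]; first by rewrite expr0 expr1 mulr1 mul1r lerDr.
  rewrite exprS [X in _ <= X]mulrDl.
  have h1 : `|z| ^+ n.+1 <= (`|z| + h) ^+ n.+1.
    by apply: lerXn2r; rewrite ?nnegrE; have := ltW h0; have := normr_ge0 z; lra.
  have h2 := ler_wpM2l (normr_ge0 z) IH; have h3 := ler_wpM2l (ltW h0) h1.
  apply: le_trans (lerD h2 h3).
  by rewrite -natr1 [`|z| ^+ n.+1]exprS le_eqVlt; apply/orP; left; apply/eqP; ring.
pose M := `|K + 1| / h.
apply: normed_cvg; rewrite /normed_series_of /=.
apply: (@series_le_cvg _ _ (geometric (M * (s / `|x|)) (s / `|x|))).
- by move=> n /=.
- by move=> n /=; rewrite mulr_ge0 ?exprn_ge0 ?mulr_ge0 ?divr_ge0 ?invr_ge0 // ltW.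
- move=> n /=; rewrite /pseries_diffs.
  have cK : `|c n.+1| * `|x| ^+ n.+1 <= `|K + 1|.
    rewrite -normrX -normrM; apply: Kf => //.
    by rewrite (lt_le_trans _ (ler_norm _)) // ltrDl.
  rewrite -[leRHS]mulrA -exprS exprMn exprVn !normrM normrX normr_nat /M.
  rewrite [leRHS]mulrA ler_pdivlMr ?exprn_gt0 // [leRHS]mulrAC ler_pdivlMr //.
  have -> : n.+1%:R * `|c n.+1| * `|z| ^+ n * `|x| ^+ n.+1 * h =
    (`|c n.+1| * `|x| ^+ n.+1) * (n.+1%:R * `|z| ^+ n * h) by ring.
  by apply: ler_pM => //; rewrite ?mulr_ge0 ?exprn_ge0 // ltW.
- apply: is_cvg_geometric_series.
  have sx0 : 0 <= s / `|x| by rewrite divr_ge0 // ltW.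
  by rewrite ger0_norm // ltr_pdivrMr // mul1r.
Qed.

Lemma jet1_pseries n c (r : R) : 0 < r ->
  (forall z, `|z| < r -> cvgn (pseries c z)) ->
  jet1 n (fun u => limn (pseries c (u - 1))) c.
Proof.
move=> r0; elim: n c => [|n IH] c cc.
  split => //; rewrite subrr; apply: cvg_lim => //.
  rewrite -cvg_shiftS /=.
  rewrite (_ : (fun n => _) = cst (c 0%N)); first exact: cvg_cst.
  apply/funext => n; rewrite /pseries /series /= big_nat_recl //= expr0 mulr1.
  by rewrite big1 ?addr0 // => i _; rewrite expr0n mulr0.
have cd (d : fser) : (forall z, `|z| < r -> cvgn (pseries d z)) ->
    forall z, `|z| < r -> cvgn (pseries (fD d) z).
  move=> dd z zr; have -> : fD d = pseries_diffs d by apply/funext => i; rewrite /fD mulrC.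
  apply: (@is_cvg_pseries_diffs _ ((`|z| + r) / 2)).
    by apply: dd; rewrite ger0_norm; have := normr_ge0 z; lra.
  by rewrite [ltRHS]ger0_norm; have := normr_ge0 z; lra.
split; first by have := IH c cc; case: (n) => [|n'] [].
exists (fun u => limn (pseries (fD c) (u - 1))); split; last by apply: IH; apply: cd.
have fDE (d : fser) : fD d = pseries_diffs d by apply/funext => i; rewrite /fD mulrC.
near=> x.
have xr : `|x - 1| < r.
  by near: x; exists r => //= y; rewrite /ball_ /= distrC.
(* A point between [|x - 1|] and [r], at which the series and its first two formal derivatives all
   converge. *)
pose K := (`|x - 1| + r) / 2.
have K0 : `|x - 1| < `|K| by rewrite [ltRHS]ger0_norm /K; have := normr_ge0 (x - 1); lra.
have Kr : `|K| < r by rewrite ger0_norm /K; have := normr_ge0 (x - 1); lra.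
have := @pseries_snd_diffs _ c K (x - 1) (cc _ Kr).
rewrite -!fDE => /(_ (cd _ cc _ Kr) (cd _ (cd _ cc) _ Kr) K0) dP.
have ds : is_derive (x : R) (1 : R) (fun u : R => u - 1) 1.
  by apply: is_derive_eq; rewrite subr0.
have := @is_derive1_comp _ (fun z => limn (pseries c z)) (fun u : R => u - 1) x _ _ dP ds.
by move=> H; apply: is_derive_eq; rewrite mulr1.
Unshelve. all: by end_near. Qed.

Lemma limit_moment_fmoment (a : nat -> R) (q : R) (k : nat) :
  (exists2 r : R, 0 < r & forall z : R, `|z - 1| < r ->
     cvgn (series (fun k => a k * (z - 1) ^+ k / (k`!)%:R))) ->
  limit_moment a q k = fmoment (fun n => a n.+1 / n`!%:R) q k.
Proof.
case=> r r0 ca.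
pose c : fser := fun n => a n / n`!%:R.
have cE : (fun z : R => limn (series (fun k => a k * (z - 1) ^+ k / (k`!)%:R))) =
   (fun u => limn (pseries c (u - 1))).
  by apply/funext => z; congr (limn (series _)); apply/funext => i; rewrite /c mulrAC.
have cc z : `|z| < r -> cvgn (pseries c z).
  move=> zr; have := ca (z + 1); rewrite addrK => /(_ zr).
  by congr (cvgn (series _)); apply/funext => i; rewrite /c mulrAC.
have psiE : (fun n => a n.+1 / n`!%:R) = fD c.
  apply/funext => n; rewrite /fD /c factS natrM.
  have : n`!%:R != 0 :> R by rewrite pnatr_eq0 -lt0n fact_gt0.
  have : n.+1%:R != 0 :> R by rewrite pnatr_eq0.
  by move: n.+1%:R n`!%:R => s t s0 t0; field; rewrite s0 t0.
rewrite /limit_moment /fmoment psiE; apply: eq_bigr => m _.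
rewrite (@jet1_derive1n _ _ (fpow (k%:R - q) * fD c ^+ (k - m))).
  rewrite factS natrM.
  have : m`!%:R != 0 :> R by rewrite pnatr_eq0 -lt0n fact_gt0.
  have : m.+1%:R != 0 :> R by rewrite pnatr_eq0.
  by move: m.+1%:R m`!%:R => s t s0 t0; field; rewrite s0 t0.
apply: (@jet1M m (fun x : R => x `^ (k%:R - q))); first exact: jet1_powR.
apply: jet1X.
have := @jet1_pseries m.+1 c r r0 cc; rewrite -cE -[fun z => _]/(Psi a).
case=> _ [f' [df jf]].
apply: jet1_near jf; near=> x; rewrite derive1E.
by have [_ ->] : is_derive (x : R) (1 : R) (Psi a) (f' x) by near: x.
Unshelve. all: by end_near. Qed.
End OneVariableJets.

(** * Laurent functions, jets and the shuffle ring *)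

Section Laurent.
Variables (R : realType) (N : nat).
Notation rv := 'rV[R]_N.
Implicit Types (f g h F G : rv -> R) (u v : rv).

Definition posv (u : rv) := forall i, 0 < u ord0 i.

Lemma posv_near u : posv u -> \forall v \near u, posv v.
Proof.
move=> pu; exists (fun i j => [set x : R | 0 < x]).
  by move=> i j; rewrite ord1; apply: open_nbhs_nbhs; split; [exact: open_gt|exact: pu].
by move=> v pv i; exact: pv.
Qed.

Lemma is_derive_coord (j : 'I_N) u v : is_derive u v (fun w : rv => w ord0 j) (v ord0 j).
Proof.
have E : (fun h : R => h^-1 *: ((h *: v + u) ord0 j - u ord0 j)) @ 0^' --> v ord0 j.
  apply: cvg_near_cst; near=> h.
  rewrite !mxE addrK -[_ *: _]/(_ * _) mulrA mulVf ?mul1r //.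
  by near: h; exact: nbhs_dnbhs_neq.
by apply: DeriveDef; [apply/cvg_ex; exists (v ord0 j) | apply: cvg_lim].
Unshelve. all: by end_near. Qed.

(** Laurent polynomials as functions, presented by generators so that closure properties follow by
    induction. The last constructor ignores what happens off the positive orthant, where inverse
    coordinates are not meaningful. *)
Inductive laur : (rv -> R) -> Prop :=
| laur_cst c : laur (cst c)
| laur_coord j : laur (fun u => u ord0 j)
| laur_coordV j : laur (fun u => (u ord0 j)^-1)
| laurD f g : laur f -> laur g -> laur (f \+ g)
| laurM f g : laur f -> laur g -> laur (f \* g)
| laur_ext f g : (forall u, posv u -> f u = g u) -> laur f -> laur g.

Lemma is_derive_posv_ext f g u v df : (forall u, posv u -> f u = g u) -> posv u ->
  is_derive u v f df -> is_derive u v g df.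
Proof.
move=> fg pu; apply: near_eq_is_derive.
by near=> w; apply: fg; near: w; exact: posv_near.
Unshelve. all: by end_near. Qed.

Lemma is_derive_coordV (j : 'I_N) u v : posv u ->
  is_derive u v (fun w : rv => (w ord0 j)^-1) (- (u ord0 j) ^- 2 * v ord0 j).
Proof.
move=> pu; have [d1 d2] := is_derive_coord j u v.
have u0 : u ord0 j != 0 by rewrite gt_eqF.
apply: DeriveDef; first exact: derivableV.
by rewrite deriveV // d2.
Qed.

Lemma is_deriveMm f g u v df dg : is_derive u v f df -> is_derive u v g dg ->
  is_derive u v (f \* g) (df * g u + f u * dg).
Proof.
move=> hf hg; have := @is_deriveM _ _ f g u v df dg hf hg => H.
by apply: is_derive_eq; rewrite addrC; congr (_ + _); rewrite -[_ *: _]/(_ * _) // mulrC.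
Qed.

Lemma laur_derive f : laur f -> forall i : nat, exists2 f', laur f' &
  forall u, posv u -> is_derive u (evec N i) f (f' u).
Proof.
elim=> {f} [c|j|j|f g _ If _ Ig|f g lf If lg Ig|f g fg _ If] i.
- by exists (cst 0); [exact: laur_cst|move=> u _; exact: is_derive_cst].
- exists (cst ((j : nat) == i)%:R); first exact: laur_cst.
  by move=> u _; apply: is_derive_eq (is_derive_coord j u _) _; rewrite mxE.
- exists ((cst (- ((j : nat) == i)%:R)) \* ((fun u => (u ord0 j)^-1) \* (fun u => (u ord0 j)^-1))).
    by do ?[apply: laurM|exact: laur_cst|exact: laur_coordV].
  move=> u pu; apply: is_derive_eq (is_derive_coordV j _ pu) _.
  by rewrite mxE /= -invfM -expr2 mulNr mulNr mulrC.
- have [f' lf' df] := If i; have [g' lg' dg] := Ig i.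
  exists (f' \+ g'); first exact: laurD.
  by move=> u pu; apply: is_deriveD; [exact: df|exact: dg].
- have [f' lf' df] := If i; have [g' lg' dg] := Ig i.
  exists ((f' \* g) \+ (f \* g')); first by apply: laurD; apply: laurM.
  by move=> u pu; apply: is_deriveMm; [exact: df|exact: dg].
- have [f' lf' df] := If i; exists f' => // u pu.
  exact: (is_derive_posv_ext fg pu (df _ pu)).
Qed.

Lemma laur_is_derive f i u : laur f -> posv u ->
  is_derive u (evec N i) f (pdiff i f u).
Proof.
move=> lf pu; have [f' _ df] := laur_derive lf i.
by have [d1 d2] := df _ pu; apply: DeriveDef.
Qed.

Lemma laur_derivable f i u : laur f -> posv u -> derivable f u (evec N i).
Proof. by move=> lf pu; have [] := @laur_is_derive f i u lf pu. Qed.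

Lemma laur_pdiff f i : laur f -> laur (pdiff i f).
Proof.
move=> lf; have [f' lf' df] := laur_derive lf i.
apply: laur_ext lf' => u pu; have [_ <-] := df _ pu; by [].
Qed.

Lemma pdiff_ext i f g : (forall u, posv u -> f u = g u) ->
  forall u, posv u -> pdiff i f u = pdiff i g u.
Proof.
move=> fg u pu; apply: near_eq_derive.
by near=> w; apply: fg; near: w; exact: posv_near.
Unshelve. all: by end_near. Qed.

Lemma pdiffD f g i u : derivable f u (evec N i) -> derivable g u (evec N i) ->
  pdiff i (f \+ g) u = pdiff i f u + pdiff i g u.
Proof. by move=> df dg; rewrite /pdiff deriveD. Qed.

Lemma pdiffM f g i u : derivable f u (evec N i) -> derivable g u (evec N i) ->
  pdiff i (f \* g) u = pdiff i f u * g u + f u * pdiff i g u.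
Proof.
move=> /derivableP df /derivableP dg.
by rewrite /pdiff; have [_ ->] := is_deriveMm df dg.
Qed.

Lemma pdiff_cst (c : R) i u : pdiff i (cst c) u = 0 :> R.
Proof. exact: derive_cst. Qed.

Lemma pdiff_coord j i u : pdiff i (fun w : rv => w ord0 j) u = ((j : nat) == i)%:R.
Proof. by rewrite /pdiff; have [_ ->] := is_derive_coord j u (evec N i); rewrite mxE. Qed.

Lemma pdiff_coordV j i u : posv u ->
  pdiff i (fun w : rv => (w ord0 j)^-1) u = - ((j : nat) == i)%:R * (u ord0 j)^-1 * (u ord0 j)^-1.
Proof.
move=> pu; rewrite /pdiff; have [_ ->] := is_derive_coordV j (evec N i) pu.
by rewrite mxE -mulrA -invfM -expr2 !mulNr mulrC.
Qed.

Lemma laur_pdiffC f i j u : laur f -> posv u ->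
  pdiff i (pdiff j f) u = pdiff j (pdiff i f) u.
Proof.
move=> lf; elim: lf u => {f} [c|k|k|f g lf If lg Ig|f g lf If lg Ig|f g fg lf If] u pu.
- rewrite (@pdiff_ext _ _ (cst 0)) // ?pdiff_cst; last by move=> *; rewrite pdiff_cst.
  by rewrite (@pdiff_ext _ _ (cst 0)) // ?pdiff_cst // => *; rewrite pdiff_cst.
- rewrite (@pdiff_ext _ _ (cst ((k : nat) == j)%:R)) // ?pdiff_cst; last by move=> *; rewrite pdiff_coord.
  by rewrite (@pdiff_ext _ _ (cst ((k : nat) == i)%:R)) // ?pdiff_cst // => *; rewrite pdiff_coord.
- case: (eqVneq i j) => [->//|ij].
  have H a b : a != b -> (k : nat) != a -> pdiff a (pdiff b (fun w : rv => (w ord0 k)^-1)) u = 0.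
    move=> ab ka.
    rewrite (@pdiff_ext _ _ (((cst (- ((k : nat) == b)%:R)) \* (fun u => (u ord0 k)^-1)) \* (fun u => (u ord0 k)^-1))) //; last first.
      by move=> w pw; rewrite pdiff_coordV.
    rewrite !pdiffM ?pdiff_cst ?pdiff_coordV //; try by apply: laur_derivable pu;
      do ?[apply: laurM|exact: laur_cst|exact: laur_coordV].
    by rewrite (negPf ka) oppr0 !mul0r !mulr0 !addr0 mul0r.
  have H2 a b : a != b -> (k : nat) != b -> pdiff a (pdiff b (fun w : rv => (w ord0 k)^-1)) u = 0.
    move=> ab kb; rewrite (@pdiff_ext _ _ (cst 0)) // ?pdiff_cst //.
    by move=> w pw; rewrite pdiff_coordV // (negPf kb) oppr0 !mul0r.
  case: (eqVneq (k : nat) i) => [ki|ki].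
    have kj : (k : nat) != j by rewrite ki.
    by rewrite H2 // H // eq_sym.
  by rewrite H // H2 // eq_sym.
- have df l w : posv w -> derivable f w (evec N l) by apply: laur_derivable.
  have dg l w : posv w -> derivable g w (evec N l) by apply: laur_derivable.
  have dd l h : laur h -> forall m, derivable (pdiff m h) u (evec N l).
    by move=> lh m; apply: laur_derivable => //; apply: laur_pdiff.
  have E a w : posv w -> pdiff a (f \+ g) w = (pdiff a f \+ pdiff a g) w.
    by move=> pw; rewrite pdiffD //; [exact: df|exact: dg].
  rewrite [LHS](pdiff_ext i (E j) pu) [RHS](pdiff_ext j (E i) pu).
  rewrite (pdiffD (dd i f lf j) (dd i g lg j)) (pdiffD (dd j f lf i) (dd j g lg i)).
  by rewrite (If u pu) (Ig u pu).
- have df l w : posv w -> derivable f w (evec N l) by apply: laur_derivable.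
  have dg l w : posv w -> derivable g w (evec N l) by apply: laur_derivable.
  have dd l h : laur h -> forall m, derivable (pdiff m h) u (evec N l).
    by move=> lh m; apply: laur_derivable => //; apply: laur_pdiff.
  have E a w : posv w -> pdiff a (f \* g) w = ((pdiff a f \* g) \+ (f \* pdiff a g)) w.
    by move=> pw; rewrite pdiffM //; [exact: df|exact: dg].
  rewrite [LHS](pdiff_ext i (E j) pu) [RHS](pdiff_ext j (E i) pu).
  have dM a h1 h2 : laur h1 -> laur h2 -> derivable (h1 \* h2) u (evec N a).
    by move=> l1 l2; apply: laur_derivable => //; apply: laurM.
  have lp a h : laur h -> laur (pdiff a h) by exact: laur_pdiff.
  rewrite (pdiffD (dM i _ _ (lp j _ lf) lg) (dM i _ _ lf (lp j _ lg))).
  rewrite (pdiffD (dM j _ _ (lp i _ lf) lg) (dM j _ _ lf (lp i _ lg))).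
  rewrite (pdiffM (dd i f lf j) (dg i u pu)) (pdiffM (df i u pu) (dd i g lg j)).
  rewrite (pdiffM (dd j f lf i) (dg j u pu)) (pdiffM (df j u pu) (dd j g lg i)).
  rewrite (If u pu) (Ig u pu); ring.
- rewrite -[LHS](pdiff_ext i (pdiff_ext j fg) pu) -[RHS](pdiff_ext j (pdiff_ext i fg) pu).
  exact: If.
Qed.

Definition repl (i j : 'I_N) u : rv := \row_k (if k == i then u ord0 j else u ord0 k).

(** For a product, [f g - (f g) o repl = (f - f o repl) g + (f o repl) (g - g o repl)]; the factor
    [f o repl] is a Laurent function since it is [f] minus [(u i - u j)] times the quotient already
    found. *)
Lemma laur_div F (i j : 'I_N) : laur F -> exists2 D, laur D &
  forall u, posv u -> (u ord0 i - u ord0 j) * D u = F u - F (repl i j u).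
Proof.
have rp u : posv u -> posv (repl i j u).
  by move=> pu k; rewrite mxE; case: ifP.
elim=> {F} [c|k|k|f g lf [Df l1 e1] lg [Dg l2 e2]|f g lf [Df l1 e1] lg [Dg l2 e2]|f g fg lf [D lD eD]].
- by exists (cst 0); [exact: laur_cst|move=> u _; rewrite mulr0 subrr].
- exists (cst (k == i)%:R); first exact: laur_cst.
  by move=> u _; rewrite mxE; case: eqP => [->|_]; rewrite ?mulr1 // mulr0 subrr.
- exists (if k == i then (cst (-1)) \* ((fun u => (u ord0 i)^-1) \* (fun u => (u ord0 j)^-1))
          else cst 0).
    case: ifP => _; last exact: laur_cst.
    by do ?[apply: laurM|exact: laur_cst|exact: laur_coordV].
  move=> u pu; rewrite mxE; case: eqP => [->|_]; last by rewrite mulr0 subrr.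
  have h1 : u ord0 i != 0 by rewrite gt_eqF.
  have h2 : u ord0 j != 0 by rewrite gt_eqF.
  by rewrite /=; field; rewrite h1 h2.
- exists (Df \+ Dg); first exact: laurD.
  by move=> u pu; rewrite /= mulrDr e1 // e2 //; ring.
- have lfr : exists2 f', laur f' & forall u, posv u -> f' u = f (repl i j u).
    by exists (f \+ ((cst (-1)) \* (((fun u => u ord0 i) \+ ((cst (-1)) \* (fun u => u ord0 j))) \* Df)));
      [do ?[apply: laurD|apply: laurM|exact: laur_cst|exact: laur_coord] |
       move=> u pu /=; rewrite mulN1r !mulN1r e1 //; ring].
  case: lfr => f' lf' ef'.
  exists ((Df \* g) \+ (f' \* Dg)); first by apply: laurD; apply: laurM.
  move=> u pu; rewrite /= mulrDr mulrA e1 // mulrCA e2 // ef' //; ring.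
- by exists D => // u pu; rewrite eD // !fg //; exact: rp.
Qed.

(** Only the hyperplane [u i = u j] matters. Along the direction [i] the function vanishes off that
    hyperplane, so [h] times its difference quotient is [- F u]; but it tends to 0 because the
    quotient converges. *)
Lemma laur_cancel F (i j : 'I_N) : i != j -> laur F ->
  (forall u, posv u -> (u ord0 i - u ord0 j) * F u = 0) ->
  forall u, posv u -> F u = 0.
Proof.
move=> ij lF e u pu.
case: (eqVneq (u ord0 i) (u ord0 j)) => [eij|nij]; last first.
  by move/eqP: (e _ pu); rewrite mulf_eq0 subr_eq0 (negPf nij) => /eqP.
have /cvg_ex [l dF] := @laur_derivable F i u lF pu.
have E : (fun h : R => h * (h^-1 *: (F (h *: evec N i + u) - F u))) @ 0^' --> 0 * l.
  by apply: cvgM => //; apply: cvg_within.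
have E' : (fun h : R => h * (h^-1 *: (F (h *: evec N i + u) - F u))) @ 0^' --> - F u.
  apply: cvg_near_cst; near=> h.
  have h0 : h != 0 by near: h; exact: nbhs_dnbhs_neq.
  have ph : posv (h *: evec N i + u).
    move=> k; rewrite !mxE; move: (k); near: h; apply: filter_forall => k'.
    near=> h; have hk : `|h| < u ord0 k' by near: h; exact: dnbhs0_lt.
    have := pu k'; move: hk; rewrite ltr_norml => /andP[h1 h2].
    by case: eqP => _; rewrite ?mulr1 ?mulr0; lra.
  have /eqP := e _ ph; rewrite mulf_eq0 => /orP[|/eqP ->].
    rewrite !mxE eqxx mulr1 eij.
    have -> : (j : nat) == i = false by rewrite eq_sym; apply/negbTE.
    by rewrite mulr0 add0r addrK (negPf h0).
  by rewrite sub0r -[_ *: _]/(_ * _) mulrA mulfV // mul1r.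
have e0 : 0 * l = - F u.
  apply: (cvg_unique _ E E'); exact: norm_hausdorff.
by apply: oppr_inj; rewrite -e0 mul0r oppr0.
Unshelve. all: by end_near. Qed.
End Laurent.

(* Arrays of iterated derivatives indexed by words; the Leibniz rule makes
   them a commutative ring (the shuffle algebra), in which the derivations
   [wd i] need not commute. *)
Definition warr (R : realType) (I : eqType) := seq I -> R.

Section Shuffle.
Variables (R : realType) (I : eqType).
Notation warr := (warr R I).
Implicit Types (F G H : warr) (w x : seq I) (i j : I).

Definition wd i F : warr := fun w => F (i :: w).

Fixpoint smul w F G : R :=
  if w is i :: w' then smul w' (wd i F) G + smul w' F (wd i G) else F [::] * G [::].
Definition wmul F G : warr := fun w => smul w F G.
Definition wone : warr := fun w => (w == [::])%:R.

Lemma smulC w F G : smul w F G = smul w G F.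
Proof.
elim: w F G => [|i w IH] F G /=; first exact: mulrC.
by rewrite (IH (wd i F)) (IH F) addrC.
Qed.

Lemma smulDl w F G H :
  smul w (fun x => F x + G x) H = smul w F H + smul w G H.
Proof.
elim: w F G H => [|i w IH] F G H /=; first exact: mulrDl.
by rewrite -[wd i _]/(fun x => wd i F x + wd i G x) !IH addrACA.
Qed.

Lemma smulDr w F G H :
  smul w F (fun x => G x + H x) = smul w F G + smul w F H.
Proof. by rewrite ![smul w F _]smulC smulDl. Qed.

Lemma smulA w F G H : smul w F (wmul G H) = smul w (wmul F G) H.
Proof.
elim: w F G H => [|i w IH] F G H /=; first exact: mulrA.
rewrite -[wd i (wmul G H)]/(fun x => wmul (wd i G) H x + wmul G (wd i H) x) smulDr.
rewrite -[wd i (wmul F G)]/(fun x => wmul (wd i F) G x + wmul F (wd i G) x) smulDl.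
by rewrite !IH addrA.
Qed.

Lemma smul0l w G : smul w (fun=> 0) G = 0.
Proof.
elim: w G => [|i w IH] G /=; first exact: mul0r.
by rewrite -[wd i _]/(fun=> 0) !IH addr0.
Qed.

Lemma smul1 w G : smul w wone G = G w.
Proof.
elim: w G => [|i w IH] G /=; first by rewrite /wone eqxx mul1r.
by rewrite -[wd i wone]/(fun=> 0) smul0l IH add0r.
Qed.

Lemma smulZl w (c : R) F G : smul w (fun x => c * F x) G = c * smul w F G.
Proof.
elim: w F G => [|i w IH] F G /=; first by rewrite mulrA.
by rewrite -[wd i _]/(fun x => c * wd i F x) !IH mulrDr.
Qed.

Fact wmulA F G H : wmul F (wmul G H) = wmul (wmul F G) H.
Proof. by apply/funext => w; exact: smulA. Qed.
Fact wmulC F G : wmul F G = wmul G F.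
Proof. by apply/funext => w; exact: smulC. Qed.
Fact wmul1 F : wmul wone F = F.
Proof. by apply/funext => w; exact: smul1. Qed.
Fact wmulDl F G H : wmul (fun x => F x + G x) H = (fun x => wmul F H x + wmul G H x).
Proof. by apply/funext => w; exact: smulDl. Qed.
Fact wone_neq0 : (wone : warr) != (fun=> 0).
Proof. by apply/eqP => /(congr1 (@^~ [::])) /eqP; rewrite /wone eqxx oner_eq0. Qed.

HB.instance Definition _ := GRing.Lmodule.copy warr (seq I -> R^o).
HB.instance Definition _ := GRing.Zmodule_isComNzRing.Build warr
  wmulA wmulC wmul1 wmulDl wone_neq0.
Fact wscaleAl (c : R) F G : c *: (F * G : warr) = (c *: F : warr) * G.
Proof. by apply/funext => w; rewrite -[RHS]/(smul w (fun x => c * F x) G) smulZl. Qed.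
HB.instance Definition _ := GRing.Lmodule_isLalgebra.Build R warr wscaleAl.
HB.instance Definition _ := GRing.Lalgebra_isComAlgebra.Build R warr.

Lemma warrD F G w : (F + G) w = F w + G w. Proof. by []. Qed.
Lemma warrN F w : (- F) w = - F w. Proof. by []. Qed.
Lemma warrB F G w : (F - G) w = F w - G w. Proof. by []. Qed.
Lemma warrZ (c : R) F w : (c *: F) w = c * F w. Proof. by []. Qed.
Lemma warr0 w : (0 : warr) w = 0. Proof. by []. Qed.
Lemma warr1 w : (1 : warr) w = (w == [::])%:R. Proof. by []. Qed.
Lemma warrM0 F G : (F * G) [::] = F [::] * G [::]. Proof. by []. Qed.
Lemma warrMS F G i w : (F * G) (i :: w) = (wd i F * G) w + (F * wd i G) w.
Proof. by []. Qed.

Lemma warr_sum (T : Type) (r : seq T) (P : pred T) (E : T -> warr) w :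
  (\sum_(t <- r | P t) E t) w = \sum_(t <- r | P t) E t w.
Proof.
elim: r => [|i r IH]; first by rewrite !big_nil.
by rewrite !big_cons; case: ifP => _ //; rewrite warrD IH.
Qed.

Lemma wdZ i (c : R) F : wd i (c *: F) = c *: wd i F. Proof. by []. Qed.
Lemma wdM i F G : wd i (F * G) = wd i F * G + F * wd i G. Proof. by []. Qed.

Definition wX i : warr := fun w => (w == [:: i])%:R.
Lemma wdX i j : wd i (wX j) = (i == j)%:R *: 1.
Proof.
by apply/funext => w; rewrite /wd /wX warrZ warr1 eqseq_cons -natrM mulnb.
Qed.

Lemma wmul_ext F F' G G' w :
  (forall x, (size x <= size w)%N -> F x = F' x) ->
  (forall x, (size x <= size w)%N -> G x = G' x) -> (F * G) w = (F' * G') w.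
Proof.
elim: w F F' G G' => [|i w IH] F F' G G' eF eG; first by rewrite !warrM0 eF ?eG.
rewrite !warrMS; congr (_ + _); apply: IH => x hx.
- exact: eF.
- by apply: eG; rewrite /= (leq_trans hx).
- by apply: eF; rewrite /= (leq_trans hx).
- exact: eG.
Qed.

Definition wordge (k : nat) F := forall w, (size w < k)%N -> F w = 0.

Lemma wordgeM a b F G : wordge a F -> wordge b G -> wordge (a + b) (F * G).
Proof.
move=> + + w; elim: w a b F G => [|i w IH] a b F G Fa Gb hw.
  rewrite warrM0; case: a Fa hw => [|a] Fa hw; first by rewrite Gb ?mulr0.
  by rewrite Fa ?mul0r.
have dF k H : wordge k H -> wordge k.-1 (wd i H).
  by move=> Hk x hx; apply: Hk; move: hx; rewrite /=; case: (k).
rewrite warrMS (IH a.-1 b) ?(IH a b.-1) ?addr0 //; try exact: dF.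
- by move: hw; rewrite /=; lia.
- by move: hw; rewrite /=; lia.
Qed.

Lemma wordgeX F k : F [::] = 0 -> wordge k (F ^+ k).
Proof.
move=> F0; elim: k => [|k IH] //; rewrite exprS -add1n.
by apply: wordgeM IH; case.
Qed.

(** The inverse as a geometric series in [1 - F]: for [F [::] = 1] its [n]-th power vanishes on
    words shorter than [n]. It serves to divide by the generating function. *)
Definition winv F : warr := fun w => (\sum_(n < (size w).+1) (1 - F) ^+ n) w.

Lemma winvE F M w : F [::] = 1 -> (size w < M)%N ->
  winv F w = (\sum_(n < M) (1 - F) ^+ n) w.
Proof.
move=> F1 hM; rewrite /winv !warr_sum.
rewrite -(big_mkord xpredT (fun n => ((1 - F) ^+ n) w)).
rewrite -[RHS](big_mkord xpredT (fun n => ((1 - F) ^+ n) w)).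
rewrite [RHS](big_cat_nat (leq0n _) hM) //=.
rewrite [X in _ = _ + X]big_nat_cond [X in _ = _ + X]big1 ?addr0 //.
move=> j /andP[/andP[hj _] _]; apply: (@wordgeX _ j) => //.
by rewrite warrB F1 warr1 eqxx subrr.
Qed.

Lemma winvM F : F [::] = 1 -> F * winv F = 1.
Proof.
move=> F1; apply/funext => w.
rewrite (@wmul_ext F F _ (\sum_(n < (size w).+1) (1 - F) ^+ n)) //; last first.
  by move=> x hx; apply: winvE.
have -> : F * (\sum_(n < (size w).+1) (1 - F) ^+ n) = 1 - (1 - F) ^+ (size w).+1.
  have := subrX1 (1 - F) (size w).+1; move: (\sum_(n < _) _) ((1 - F) ^+ _) => S T h.
  by rewrite -[1 - T]opprB h; ring.
rewrite warrB (@wordgeX _ (size w).+1) ?subr0 //.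
by rewrite warrB F1 warr1 eqxx subrr.
Qed.

Definition wcomm F := forall w i j x, F (w ++ i :: j :: x) = F (w ++ j :: i :: x).

Lemma wcomm_wd F i : wcomm F -> wcomm (wd i F).
Proof. by move=> cF w j k x; apply: (cF (i :: w)). Qed.

Lemma wcomm_wdwd F i j : wcomm F -> wd i (wd j F) = wd j (wd i F).
Proof. by move=> cF; apply/funext => w; apply: (cF [::]). Qed.

Lemma wcomm1 : wcomm 1. Proof. by case. Qed.
Lemma wcommD F G : wcomm F -> wcomm G -> wcomm (F + G).
Proof. by move=> cF cG w i j x; rewrite !warrD cF cG. Qed.
Lemma wcommN F : wcomm F -> wcomm (- F).
Proof. by move=> cF w i j x; rewrite !warrN cF. Qed.
Lemma wcommZ (c : R) F : wcomm F -> wcomm (c *: F).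
Proof. by move=> cF w i j x; rewrite !warrZ cF. Qed.

Lemma wcommM F G : wcomm F -> wcomm G -> wcomm (F * G).
Proof.
move=> cF cG w i j x; elim: w F G cF cG => [|k w IH] F G cF cG.
  rewrite [LHS]warrMS [RHS]warrMS !warrMS (wcomm_wdwd i j cF) (wcomm_wdwd i j cG).
  by rewrite addrACA.
by rewrite /= !warrMS !IH //; exact: wcomm_wd.
Qed.

Lemma wcommX F k : wcomm F -> wcomm (F ^+ k).
Proof.
by move=> cF; elim: k => [|k IH]; [exact: wcomm1|rewrite exprS; apply: wcommM].
Qed.

Lemma wcomm_winv F : F [::] = 1 -> wcomm F -> wcomm (winv F).
Proof.
move=> F1 cF w i j x.
have sz a b : (size (w ++ a :: b :: x) < (size (w ++ i :: j :: x)).+1)%N.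
  by rewrite !size_cat.
rewrite (winvE F1 (sz i j)) (winvE F1 (sz j i)) !warr_sum.
apply: eq_bigr => n _; apply: wcommX.
by apply: wcommD; [exact: wcomm1|exact: wcommN].
Qed.

Lemma wcomm_rem F i w : wcomm F -> i \in w -> F w = F (i :: rem i w).
Proof.
move=> cF; elim: w F cF => [//|k w IH] F cF; rewrite inE eq_sym /=.
case: eqVneq => [->//|ki] /= iw.
rewrite -[LHS]/(wd k F w) (IH (wd k F)) //; last exact: wcomm_wd.
by rewrite /wd; apply: (cF [::]).
Qed.

(** The Leibniz rule spends exactly one letter [i] on [wX i]; when letters commute, each of the
    possible choices leaves the same word. *)
Lemma wXM i F w : wcomm F -> (wX i * F) w = (count_mem i w)%:R * F (rem i w).
Proof.
elim: w F => [|k w IH] F cF; first by rewrite warrM0 /wX !mul0r.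
rewrite warrMS wdX eq_sym /= -scalerAl mul1r warrZ IH; last exact: wcomm_wd.
case: eqVneq => [e|ki] /=; last by rewrite mul0r add0n add0r /wd.
subst k.
rewrite mul1r natrD mulrDl mul1r /wd; case: (boolP (i \in w)) => iw.
  by rewrite -(wcomm_rem cF iw).
by rewrite (count_memPn iw) !mul0r.
Qed.

(** Reading [(u_i - u_j) D = F] at the word [i :: w] expresses [D w] by [F] and by [D] at a word of
    the same length with one letter [j] fewer. All bounds on divided differences come from this
    recursion. *)
Lemma wdiv_coef F D i j w : i != j -> wcomm D -> (wX i - wX j) * D = F ->
  (count_mem i w).+1%:R * D w = F (i :: w) + (count_mem j w)%:R * D (i :: rem j w).
Proof.
move=> ij cD <-; rewrite mulrBl warrB !wXM //= eqxx (negPf ij).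
by rewrite add0n add1n /=; ring.
Qed.

End Shuffle.

Section Jets.
Variables (R : realType) (N : nat).
Notation rv := 'rV[R]_N.
Notation warr := (warr R 'I_N).
Implicit Types (f g : rv -> R) (u v : rv) (U : set rv).

(** Mere existence of iterated partial derivatives on [U], without continuity, hence without
    symmetry in their order. Indices [i >= N] are allowed; they give the zero direction. *)
Fixpoint Cn (n : nat) (U : set rv) (f : rv -> R) : Prop :=
  if n is m.+1 then
    forall i : nat, (forall u, U u -> derivable f u (evec N i)) /\ Cn m U (pdiff i f)
  else True.

Definition smooth_on U f := forall n, Cn n U f.

Lemma smooth_derivable U f i u : smooth_on U f -> U u -> derivable f u (evec N i).
Proof. by move=> sf; have [H _] := sf 1%N i; exact: H. Qed.

Lemma smooth_pdiff U f i : smooth_on U f -> smooth_on U (pdiff i f).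
Proof. by move=> sf n; have [_ H] := sf n.+1 i. Qed.

Lemma pdiff_open_ext U i f g : open U -> (forall u, U u -> f u = g u) ->
  forall u, U u -> pdiff i f u = pdiff i g u.
Proof.
move=> oU fg u Uu; apply: near_eq_derive.
by near=> w; apply: fg; near: w; exact: open_nbhs_nbhs.
Unshelve. all: by end_near. Qed.

Lemma derivable_open_ext U i f g u : open U -> (forall u, U u -> f u = g u) ->
  U u -> derivable f u (evec N i) -> derivable g u (evec N i).
Proof.
move=> oU fg Uu; apply: near_eq_derivable.
by near=> w; apply: fg; near: w; exact: open_nbhs_nbhs.
Unshelve. all: by end_near. Qed.

Lemma Cn_ext n U f g : open U -> (forall u, U u -> f u = g u) -> Cn n U f -> Cn n U g.
Proof.
move=> oU; elim: n f g => [//|n IH] f g fg Cf i; have [df Cd] := Cf i.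
split; first by move=> u Uu; apply: (derivable_open_ext oU fg Uu (df u Uu)).
apply: IH Cd; exact: pdiff_open_ext.
Qed.

Lemma CnW n U f : Cn n.+1 U f -> Cn n U f.
Proof.
elim: n f => [//|n IH] f Cf i; have [df Cd] := Cf i.
by split => //; apply: IH.
Qed.

Lemma CnD n U f g : open U -> Cn n U f -> Cn n U g -> Cn n U (f \+ g).
Proof.
move=> oU; elim: n f g => [//|n IH] f g Cf Cg i.
have [df Cdf] := Cf i; have [dg Cdg] := Cg i; split.
  by move=> u Uu; apply: derivableD; [exact: df|exact: dg].
apply: Cn_ext (IH _ _ Cdf Cdg) => // u Uu.
by rewrite pdiffD; [|exact: df|exact: dg].
Qed.

Lemma CnM n U f g : open U -> Cn n U f -> Cn n U g -> Cn n U (f \* g).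
Proof.
move=> oU; elim: n f g => [//|n IH] f g Cf Cg i.
have [df Cdf] := Cf i; have [dg Cdg] := Cg i; split.
  by move=> u Uu; apply: derivableM; [exact: df|exact: dg].
apply: (@Cn_ext _ _ ((pdiff i f \* g) \+ (f \* pdiff i g))) => //.
  by move=> u Uu; rewrite pdiffM; [|exact: df|exact: dg].
by apply: CnD => //; apply: IH => //; exact: CnW.
Qed.

Lemma partials_rcons l i f : partials (rcons l i) f = partials l (pdiff i f).
Proof. by rewrite /partials foldr_rcons. Qed.

Lemma all_partials_smooth f u0 : all_partials_exist f u0 ->
  exists U, [/\ open U, U u0 & smooth_on U f].
Proof.
move=> H; exists (interior [set u | forall (l : seq nat) (i : nat),
   derivable (partials l f) u (evec N i)]).
split; [exact: open_interior|exact: H|].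
have {H} := @interior_subset _ [set u | forall (l : seq nat) (i : nat),
   derivable (partials l f) u (evec N i)].
move: (interior _) => U UP n.
have {UP} : forall u, U u -> forall l i, derivable (partials l f) u (evec N i).
  by move=> u /UP.
elim: n f => [//|n IH] f H i; split; first by move=> u Uu; apply: (H u Uu [::]).
by apply: IH => u Uu l j; rewrite -partials_rcons; exact: H.
Qed.

Lemma open_posv : open [set u : rv | posv u].
Proof. by rewrite openE => u pu; exact: posv_near. Qed.

Lemma laur_smooth f : laur f -> smooth_on [set u | posv u] f.
Proof.
move=> lf n; elim: n f lf => [//|n IH] f lf i; split.
  by move=> u pu; exact: laur_derivable.
by apply: IH; exact: laur_pdiff.
Qed.

Lemma partials_ext U l f g : open U -> (forall u, U u -> f u = g u) ->
  forall u, U u -> partials l f u = partials l g u.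
Proof.
move=> oU fg; elim: l => [//|i l IH] u Uu /=.
exact: (pdiff_open_ext i oU IH).
Qed.

Lemma partialsD U l f g : open U -> smooth_on U f -> smooth_on U g ->
  forall u, U u -> partials l (f \+ g) u = partials l f u + partials l g u.
Proof.
move=> oU; elim/last_ind: l f g => [//|l i IH] f g sf sg u Uu.
rewrite !partials_rcons -IH //; try exact: smooth_pdiff.
apply: partials_ext oU _ _ Uu => w Uw.
by rewrite pdiffD //; apply: smooth_derivable Uw.
Qed.

(** The word is reversed so that its first letter is the derivative taken first; then [wd i] of a
    jet is the jet of [pdiff i] without exchanging any derivatives. *)
Definition jet f : warr := fun w => partials (map val (rev w)) f (ones N).

Lemma jet0 f : jet f [::] = f (ones N). Proof. by []. Qed.

Lemma wd_jet i f : wd i (jet f) = jet (pdiff i f).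
Proof.
by apply/funext => w; rewrite /wd /jet rev_cons map_rcons partials_rcons.
Qed.

Lemma jet_ext U f g : open U -> U (ones N) -> (forall u, U u -> f u = g u) ->
  jet f = jet g.
Proof. by move=> oU U1 fg; apply/funext => w; apply: partials_ext oU fg _ U1. Qed.

Lemma jetD U f g : open U -> U (ones N) -> smooth_on U f -> smooth_on U g ->
  jet (f \+ g) = jet f + jet g.
Proof. by move=> oU U1 sf sg; apply/funext => w; apply: partialsD oU sf sg _ U1. Qed.

Lemma jetM U f g : open U -> U (ones N) -> smooth_on U f -> smooth_on U g ->
  jet (f \* g) = jet f * jet g.
Proof.
move=> oU U1 sf sg; apply/funext => w; elim: w f g sf sg => [//|i w IH] f g sf sg.
rewrite warrMS !wd_jet -!IH //; try exact: smooth_pdiff.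
rewrite -[LHS]/(wd i (jet (f \* g)) w) wd_jet -warrD -(jetD oU U1).
- congr (_ w); apply: jet_ext oU U1 _ => u Uu.
  by rewrite pdiffM //; apply: smooth_derivable Uu.
- by move=> n; apply: CnM => //; exact: smooth_pdiff.
- by move=> n; apply: CnM => //; exact: smooth_pdiff.
Qed.

Lemma posv1 : posv (ones N : rv).
Proof. by move=> i; rewrite mxE ltr01. Qed.

Lemma ljet_ext f g : (forall u, posv u -> f u = g u) -> jet f = jet g.
Proof. exact: jet_ext open_posv posv1. Qed.

Lemma ljetD f g : laur f -> laur g -> jet (f \+ g) = jet f + jet g.
Proof. by move=> lf lg; apply: jetD open_posv posv1 _ _; exact: laur_smooth. Qed.

Lemma ljetM f g : laur f -> laur g -> jet (f \* g) = jet f * jet g.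
Proof. by move=> lf lg; apply: jetM open_posv posv1 _ _; exact: laur_smooth. Qed.

Lemma jet_cst (c : R) : jet (cst c) = c *: 1.
Proof.
apply/funext => w; elim: w c => [|i w IH] c; first by rewrite warrZ warr1 mulr1.
rewrite -[LHS]/(wd i (jet _) w) wd_jet (@ljet_ext _ (cst 0)) ?IH ?scale0r //.
  by rewrite warr0 warrZ warr1 mulr0.
by move=> u _; rewrite pdiff_cst.
Qed.

Lemma jetZ (c : R) f : laur f -> jet (fun u => c * f u) = c *: jet f.
Proof.
move=> lf; rewrite -[fun u => _]/(cst c \* f) ljetM ?jet_cst -?scalerAl ?mul1r //.
exact: laur_cst.
Qed.

Lemma jet_coord (j : 'I_N) : jet (fun u => u ord0 j) = 1 + wX R j.
Proof.
apply/funext => -[|i w]; first by rewrite jet0 mxE warrD warr1 /wX addr0.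
rewrite -[LHS]/(wd i (jet _) w) wd_jet (@ljet_ext _ (cst (i == j)%:R)).
  by rewrite jet_cst -wdX warrD warr1 add0r.
by move=> u _; rewrite pdiff_coord eq_sym.
Qed.

Lemma wcomm_jet f : laur f -> wcomm (jet f).
Proof.
move=> lf w i j x; elim: w f lf => [|k w IH] f lf.
  have e : wd j (wd i (jet f)) = wd i (wd j (jet f)).
    by rewrite !wd_jet; apply: ljet_ext => u pu; exact: laur_pdiffC.
  exact: (congr1 (fun F => F x) e).
have := IH (pdiff k f) (laur_pdiff k lf); rewrite -wd_jet; apply.
Qed.

Lemma laur_sum (T : Type) (r : seq T) (P : pred T) (F : T -> rv -> R) :
  (forall t, laur (F t)) -> laur (fun u => \sum_(t <- r | P t) F t u).
Proof.
move=> lF; elim: r => [|t r IH].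
  by apply: laur_ext (laur_cst _ 0) => u _; rewrite big_nil.
case: (boolP (P t)) => Pt.
  by apply: laur_ext (laurD (lF t) IH) => u _; rewrite big_cons Pt.
by apply: laur_ext IH => u _; rewrite big_cons (negPf Pt).
Qed.

Lemma laur_prod (T : Type) (r : seq T) (P : pred T) (F : T -> rv -> R) :
  (forall t, laur (F t)) -> laur (fun u => \prod_(t <- r | P t) F t u).
Proof.
move=> lF; elim: r => [|t r IH].
  by apply: laur_ext (laur_cst _ 1) => u _; rewrite big_nil.
case: (boolP (P t)) => Pt.
  by apply: laur_ext (laurM (lF t) IH) => u _; rewrite big_cons Pt.
by apply: laur_ext IH => u _; rewrite big_cons (negPf Pt).
Qed.

Lemma jet_sum (T : Type) (r : seq T) (P : pred T) (F : T -> rv -> R) :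
  (forall t, laur (F t)) ->
  jet (fun u => \sum_(t <- r | P t) F t u) = \sum_(t <- r | P t) jet (F t).
Proof.
move=> lF; elim: r => [|t r IH].
  rewrite big_nil (@ljet_ext _ (cst 0)) ?jet_cst ?scale0r //.
  by move=> u _; rewrite big_nil.
rewrite big_cons -IH; case: (boolP (P t)) => Pt.
  rewrite -ljetD //; last exact: laur_sum.
  by apply: ljet_ext => u _; rewrite big_cons Pt.
by apply: ljet_ext => u _; rewrite big_cons (negPf Pt).
Qed.

End Jets.

(** * Positivity of Schur functions *)

Section Branching.
Variable R : realType.

Definition mon N (m : 'I_N -> int) (u : 'rV[R]_N) : R := \prod_i (u ord0 i) ^ (m i).

Definition altf N (l : 'I_N -> int) (u : 'rV[R]_N) : R :=
  \det (\matrix_(i < N, j < N) (u ord0 i) ^ (l j)).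

Definition strictly_dec N (l : 'I_N -> int) := forall i j : 'I_N, (i < j)%N -> l j < l i.

(* Nonzero Laurent polynomials with nonnegative integer coefficients, as lists
   of exponents; only values on the positive orthant matter. *)
Definition pospoly N (F : 'rV[R]_N -> R) := exists s : seq ('I_N -> int),
  s <> [::] /\ forall u, posv u -> F u = \sum_(m <- s) mon m u.

(** Multilinearity in the columns. The common bound [K] gives all columns one index type, and the
    true ranges [d j] become a condition on [c]. *)
Lemma det_sum_cols n K (d : 'I_n -> nat) (f : 'I_n -> 'I_n -> nat -> R) :
  \det (\matrix_(i, j) \sum_(c < K | (c < d j)%N) f i j c) =
  \sum_(c : {ffun 'I_n -> 'I_K} | [forall j, (c j < d j)%N])
     \det (\matrix_(i, j) f i j (c j)).
Proof.
rewrite -det_tr /determinant.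
transitivity (\sum_(c : {ffun 'I_n -> 'I_K} | [forall j, (c j < d j)%N])
   \det (\matrix_(i, j) f i j (c j))^T); last by apply: eq_bigr => c _; rewrite det_tr.
rewrite /determinant exchange_big /=; apply: eq_bigr => s _.
rewrite -mulr_sumr; congr (_ * _).
under eq_bigr do rewrite !mxE.
rewrite bigA_distr_big_dep /=; apply: eq_big => [c|c _].
  apply/familyP/forallP => H j; have := H j; by rewrite unfold_in.
by apply: eq_bigr => j _; rewrite !mxE.
Qed.

Lemma pospoly_sum N (T : eqType) (r : seq T) (F : T -> 'rV[R]_N -> R) :
  r <> [::] -> (forall t, t \in r -> pospoly (F t)) ->
  pospoly (fun u => \sum_(t <- r) F t u).
Proof.
elim: r => [//|t r IH] _ H.
have [s [s0 es]] := H t (mem_head _ _).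
case: (eqVneq r [::]) => [->|/eqP r0].
  by exists s; split=> // u pu; rewrite big_seq1 es.
have [|s' [_ es']] := IH r0; first by move=> x xr; apply: H; rewrite inE xr orbT.
exists (s ++ s'); split; first by case: (s) s0.
by move=> u pu; rewrite big_cons big_cat es // es'.
Qed.

Definition rvtail N (u : 'rV[R]_N.+1) : 'rV[R]_N := \row_i u ord0 (lift ord0 i).

Lemma posv_tail N (u : 'rV[R]_N.+1) : posv u -> posv (rvtail u).
Proof. by move=> pu i; rewrite mxE. Qed.

Lemma pospoly_tail N (F : 'rV[R]_N -> R) (e : int) : pospoly F ->
  pospoly (fun u : 'rV[R]_N.+1 => (u ord0 ord0) ^ e * F (rvtail u)).
Proof.
case=> s [s0 es].
pose ext (m : 'I_N -> int) (k : 'I_N.+1) := if unlift ord0 k is Some i then m i else e.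
exists [seq ext m | m <- s]; split; first by case: (s) s0.
move=> u pu; rewrite es; last exact: posv_tail.
rewrite big_map mulr_sumr; apply: eq_bigr => m _.
rewrite /mon [RHS]big_ord_recl /ext unlift_none; congr (_ * _).
by apply: eq_bigr => i _; rewrite liftK mxE.
Qed.

Lemma vandermonde_recl N (u : 'rV[R]_N.+1) :
  vandermonde u = (\prod_(j < N) (u ord0 ord0 - u ord0 (lift ord0 j))) * vandermonde (rvtail u).
Proof.
rewrite /vandermonde big_ord_recl; congr (_ * _).
  rewrite big_mkcond big_ord_recl /= mul1r.
  by apply: eq_bigr => j _.
apply: eq_bigr => i _; rewrite big_mkcond big_ord_recl /= mul1r [RHS]big_mkcond.
apply: eq_bigr => j _; rewrite !mxE /= /bump /= ltnS.
by case: ltnP.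
Qed.

Section Step.
Variables (N : nat) (l : 'I_N.+1 -> int).
Hypothesis ldec : strictly_dec l.
Let wj (j : 'I_N) : 'I_N.+1 := lift ord_max j.
Let sj (j : 'I_N) : 'I_N.+1 := lift ord0 j.
Let d (j : 'I_N) : nat := `|l (wj j) - l (sj j)|%N.

Let wjE j : wj j = j :> nat. Proof. by rewrite /wj /= /bump leqNgt ltn_ord. Qed.
Let sjE j : sj j = j.+1 :> nat. Proof. by []. Qed.

Let dE j : l (wj j) = l (sj j) + (d j)%:Z.
Proof.
have : l (sj j) < l (wj j) by apply: ldec; rewrite wjE sjE.
by rewrite /d; lia.
Qed.

Let d_gt0 j : (0 < d j)%N.
Proof.
have : l (sj j) < l (wj j) by apply: ldec; rewrite wjE sjE.
by rewrite /d; lia.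
Qed.

(** The branching rule. Subtracting from each column a multiple of the next one clears the first row
    except for its last entry; then [u_i - x] comes out of every other row, and the remaining
    geometric sums give by multilinearity alternants in one variable fewer. *)
Lemma altf_step (K : nat) (u : 'rV[R]_N.+1) : posv u -> (forall j, (d j <= K)%N) ->
  altf l u = (\prod_(j < N) (u ord0 ord0 - u ord0 (lift ord0 j))) *
    \sum_(c : {ffun 'I_N -> 'I_K} | [forall j, (c j < d j)%N])
       ((u ord0 ord0) ^ (l ord_max + (\sum_j (d j - 1 - c j))%N%:Z) *
        altf (fun j => l (sj j) + (c j)%:Z) (rvtail u)).
Proof.
move=> pu dK; set x := u ord0 ord0.
have x0 : x != 0 by rewrite gt_eqF // pu.
pose A := \matrix_(i < N.+1, j < N.+1) (u ord0 i) ^ (l j).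
(* The unitriangular matrix of these column operations, with determinant 1. *)
pose C := \matrix_(k < N.+1, j < N.+1)
   ((k == j)%:R - ((k : nat) == j.+1)%:R * x ^ (l j - l k)) : 'M[R]_N.+1.
have detC : \det C = 1.
  have trC : is_trig_mx C.
    apply/is_trig_mxP => i j ij; rewrite !mxE.
    rewrite (_ : (i == j) = false); last by apply/negbTE/eqP => e; rewrite e ltnn in ij.
    rewrite (_ : ((i : nat) == j.+1) = false) ?mul0r ?subrr //.
    by apply/negbTE; rewrite neq_ltn ltnS ltnW.
  rewrite det_trig // big1 // => i _; rewrite !mxE eqxx.
  by rewrite (_ : ((i : nat) == i.+1) = false) ?mul0r ?subr0 // ltn_eqF.
have AC i j : (A *m C) i (wj j) = (u ord0 i) ^ (l (wj j)) -
    (u ord0 i) ^ (l (sj j)) * x ^ (l (wj j) - l (sj j)).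
  rewrite mxE.
  under eq_bigr => k _ do rewrite !mxE mulrBr.
  have S1 : \sum_k (u ord0 i) ^ (l k) * (k == wj j)%:R = (u ord0 i) ^ (l (wj j)).
    rewrite (bigD1 (wj j)) // eqxx mulr1 big1; first exact: addr0.
    by move=> k /negbTE ->; rewrite mulr0.
  have S2 : \sum_k (u ord0 i) ^ (l k) * (((k : nat) == (wj j).+1)%:R * x ^ (l (wj j) - l k))
      = (u ord0 i) ^ (l (sj j)) * x ^ (l (wj j) - l (sj j)).
    rewrite (bigD1 (sj j)) // sjE wjE eqxx mul1r big1; first exact: addr0.
    move=> k ksj; rewrite (_ : ((k : nat) == _) = false) ?mul0r ?mulr0 //.
    by apply/negbTE; apply: contra ksj => /eqP e; apply/eqP/val_inj; rewrite /= e.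
  by rewrite sumrB S1 S2.
have AC0 j : (A *m C) ord0 (wj j) = 0.
  by rewrite AC -/x -expfzDr // [l (sj j) + _]addrC subrK subrr.
have ACmax : (A *m C) ord0 ord_max = x ^ (l ord_max).
  rewrite mxE (bigD1 ord_max) //= !mxE eqxx big1 ?addr0.
    by rewrite (_ : (N == N.+1) = false) ?mul0r ?subr0 ?mulr1 // ltn_eqF.
  move=> k km; rewrite !mxE (negbTE km) (_ : ((k : nat) == N.+1) = false) ?mul0r ?subrr ?mulr0 //.
  by apply/negbTE; rewrite ltn_eqF.
have -> : altf l u = \det (A *m C) by rewrite det_mulmx detC mulr1.
rewrite (expand_det_row _ ord0) (bigD1 ord_max) //= big1 ?addr0; last first.
  move=> k km; have [j ->] : exists j, k = wj j.
    by case: (unliftP ord_max k) km => [j ->|->]; [exists j|rewrite eqxx].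
  by rewrite AC0 mul0r.
rewrite ACmax /cofactor add0n.
pose f := fun (i j : 'I_N) (c : nat) =>
  x ^+ (d j - 1 - c) * (u ord0 (lift ord0 i)) ^ (l (sj j) + c%:Z).
have -> : row' ord0 (col' ord_max (A *m C)) =
  diag_mx (\row_i (u ord0 (lift ord0 i) - x)) *m
  \matrix_(i, j) \sum_(c < K | (c < d j)%N)
     f i j c.
  apply/matrixP => i j; rewrite 2!mxE -/(wj j) AC mul_diag_mx !mxE /f.
  set y := u ord0 (lift ord0 i); have y0 : y != 0 by rewrite gt_eqF // pu.
  have -> : l (wj j) - l (sj j) = (d j)%:Z by rewrite dE addrC addKr.
  rewrite dE expfzDr // -mulrBr -!exprnP subrXX mulrCA; congr (_ * _).
  rewrite -(big_ord_widen_cond _ xpredT (fun c => x ^+ (d j - 1 - c) * y ^ (l (sj j) + c%:Z))) //.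
  rewrite mulr_sumr (reindex_inj rev_ord_inj) /=; apply: eq_bigr => c _.
  rewrite expfzDr // [RHS]mulrCA; congr (_ * _); rewrite [LHS]mulrC -exprnP.
  have := ltn_ord c; move: (nat_of_ord c) => c' hc.
  by congr (_ ^+ _ * _ ^+ _); lia.
rewrite det_mulmx det_diag (det_sum_cols K d f).
have -> : \prod_i (\row_i0 (u ord0 (lift ord0 i0) - x)) ord0 i =
   (-1) ^+ N * \prod_(j < N) (x - u ord0 (lift ord0 j)).
  rewrite -[X in (-1) ^+ X](card_ord N) -prodrN; apply: eq_bigr => i _.
  by rewrite mxE opprB.
(* The sign of the cofactor in the last column cancels the one from reversing the [N] factors
   [u_i - x]. *)
have sg : (-1) ^+ N * (-1) ^+ N = 1 :> R by rewrite -exprD addnn -signr_odd odd_double.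
set Pd := \prod_(j < N) _; set S := \sum_(c | _) _.
transitivity (Pd * (x ^ (l ord_max) * S)).
  move: sg; rewrite /=; move: ((-1) ^+ N) => e sg.
  by rewrite -[RHS]mul1r -sg; ring.
congr (_ * _); rewrite mulr_sumr; apply: eq_bigr => c /forallP hc.
rewrite expfzDr // -mulrA; congr (_ * _).
set M := \matrix_(i, j) _.
have -> : M = (\matrix_(i, j) ((rvtail u) ord0 i ^ (l (sj j) + (c j)%:Z))) *m
    diag_mx (\row_j x ^+ (d j - 1 - c j)).
  by apply/matrixP => i j; rewrite mul_mx_diag !mxE mulrC.
rewrite det_mulmx det_diag mulrC; congr (_ * _).
by rewrite -exprnP -prodrXr; apply: eq_bigr => j _; rewrite mxE.
Qed.

Let K := (\max_j d j).+1.

Lemma altf_branch : (forall l' : 'I_N -> int, strictly_dec l' ->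
    exists2 F, pospoly F & forall u : 'rV[R]_N, posv u -> altf l' u = vandermonde u * F u) ->
  exists2 F, pospoly F & forall u : 'rV[R]_N.+1, posv u -> altf l u = vandermonde u * F u.
Proof.
move=> IH.
have dK j : (d j <= K)%N by rewrite /K ltnW // ltnS leq_bigmax.
(* Interlacing: the new exponent of index [j] is at least [l (sj j)] and less than [l (wj j)], and
   these ranges are disjoint and ordered. *)
have dec (c : {ffun 'I_N -> 'I_K}) : [forall j, (c j < d j)%N] ->
    strictly_dec (fun j => l (sj j) + (c j)%:Z).
  move=> /forallP hc i j ij.
  have h1 : l (wj j) <= l (sj i).
    have : (sj i <= wj j)%N by rewrite sjE wjE.
    rewrite leq_eqVlt => /orP[/eqP e|/ldec/ltW //].
    by rewrite (_ : wj j = sj i) //; apply/val_inj.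
  have := hc j; have := dE j; lia.
pose P (c : {ffun 'I_N -> 'I_K}) := [forall j, (c j < d j)%N].
have /choice [G HG] : forall c : {ffun 'I_N -> 'I_K}, exists G, P c -> pospoly G /\
    forall u : 'rV[R]_N, posv u -> altf (fun j => l (sj j) + (c j)%:Z) u = vandermonde u * G u.
  move=> c; case: (boolP (P c)) => Pc; last by exists (fun=> 0).
  by have [G pG eG] := IH _ (dec c Pc); exists G.
pose e (c : {ffun 'I_N -> 'I_K}) := l ord_max + (\sum_j (d j - 1 - c j))%N%:Z.
exists (fun u : 'rV[R]_N.+1 => \sum_(c <- enum P) (u ord0 ord0) ^ (e c) * G c (rvtail u)).
  apply: pospoly_sum.
    have P0 : P [ffun=> ord0] by apply/forallP => j; rewrite ffunE.
    by move=> E; have := mem_enum P [ffun=> ord0]; rewrite E inE [RHS]P0.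
  move=> c; rewrite mem_enum => /HG [pG _].
  exact: (@pospoly_tail _ (G c)).
move=> u pu; rewrite (altf_step pu dK) vandermonde_recl -mulrA; congr (_ * _).
rewrite mulr_sumr big_enum /=.
apply: eq_bigr => c /HG [_ ->]; last exact: posv_tail.
by rewrite mulrCA.
Qed.

End Step.

Lemma altf_pospoly N (l : 'I_N -> int) : strictly_dec l ->
  exists2 F, pospoly F & forall u : 'rV[R]_N, posv u -> altf l u = vandermonde u * F u.
Proof.
elim: N l => [|N IH] l ldec; last exact: altf_branch.
exists (fun=> 1).
  exists [:: l]; split => // u _; rewrite big_seq1 /mon big_ord0 //.
by move=> u _; rewrite /altf det_mx00 /vandermonde big_ord0 mulr1.
Qed.

End Branching.

(** * The Dunkl recursion on Schur functions *)

Section DunklData.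
Variables (R : realType) (N : nat).
Notation rv := 'rV[R]_N.
Implicit Types (f : rv -> R) (u v : rv).

Definition permv (s : 'S_N) u : rv := \row_j u ord0 (s j).

Lemma posv_perm s u : posv u -> posv (permv s u).
Proof. by move=> pu i; rewrite mxE. Qed.

Lemma laur_perm s f : laur f -> laur (f \o permv s).
Proof.
elim=> {f} [c|k|k|f g _ lf _ lg|f g _ lf _ lg|f g fg _ lf].
- by apply: laur_ext (laur_cst _ c).
- by apply: laur_ext (laur_coord R (s k)) => u _; rewrite /= mxE.
- by apply: laur_ext (laur_coordV R (s k)) => u _; rewrite /= mxE.
- exact: laur_ext (laurD lf lg).
- exact: laur_ext (laurM lf lg).
- by apply: laur_ext lf => u pu; apply: fg; exact: posv_perm.
Qed.

Lemma pdiff_perm (s : 'S_N) (i : 'I_N) f u :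
  pdiff (s i) (f \o permv s) u = pdiff i f (permv s u).
Proof.
rewrite /pdiff /derive.
have e : (fun h : R => h^-1 *: ((f \o permv s \o shift u) (h *: evec N (s i)) -
    (f \o permv s) u)) =
  (fun h : R => h^-1 *: ((f \o shift (permv s u)) (h *: evec N i) - f (permv s u))).
  apply/funext => h /=; congr (_ *: (f _ - _)).
  by apply/rowP => j; rewrite !mxE (inj_eq val_inj) (inj_eq perm_inj).
by rewrite e.
Qed.

(** The form in which the symmetry of [chi] survives the recursion: the single vectors are not
    symmetric, but they are permuted along with the variables. *)
Definition covariant (g : 'I_N -> rv -> R) := forall (s : 'S_N) i u,
  posv u -> g i (permv s u) = g (s i) u.

(** On the hyperplane [u i = u j] the transposition of [i] and [j] fixes the point, so covariance
    gives [g i = g j] there and the difference is divisible. *)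
Lemma divided_difference (g : 'I_N -> rv -> R) (i j : 'I_N) : (forall i, laur (g i)) ->
  covariant g -> exists2 D, laur D & i != j ->
    forall u, posv u -> (u ord0 i - u ord0 j) * D u = g i u - g j u.
Proof.
move=> lg cg.
have lF : laur (g i \+ (cst (-1) \* g j)).
  by apply: laurD => //; apply: laurM => //; exact: laur_cst.
have [D lD eD] := laur_div i j lF; exists D => // ij u pu; rewrite eD // /=.
have pr : posv (repl i j u) by move=> k; rewrite mxE; case: ifP.
have -> : g i (repl i j u) = g j (repl i j u).
  have := cg (tperm i j) i _ pr; rewrite tpermL => <-; congr (g i).
  apply/rowP => k; rewrite !mxE; case: tpermP => [->|->|] //.
  - by rewrite eqxx eq_sym (negPf ij).
  - by rewrite eqxx eq_sym (negPf ij).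
by rewrite !mulN1r subrr subr0.
Qed.

Definition dunkl_step (g : 'I_N -> rv -> R) (D : 'I_N -> 'I_N -> rv -> R)
    (g' : 'I_N -> rv -> R) :=
  [/\ forall i j, laur (D i j),
      forall i j u, i != j -> posv u -> (u ord0 i - u ord0 j) * D i j u = g i u - g j u &
      forall i u, posv u -> g' i u =
        u ord0 i * pdiff i (g i) u + \sum_(j | j != i) u ord0 i * D i j u].

Lemma dunkl_step_exists (g : 'I_N -> rv -> R) : (forall i, laur (g i)) -> covariant g ->
  exists D (g' : 'I_N -> rv -> R), [/\ dunkl_step g D g', forall i, laur (g' i) & covariant g'].
Proof.
move=> lg cg.
have /choice [D HD] : forall ij : 'I_N * 'I_N, exists D, laur D /\ (ij.1 != ij.2 ->
    forall u, posv u -> (u ord0 ij.1 - u ord0 ij.2) * D u = g ij.1 u - g ij.2 u).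
  by move=> [i j]; have [D lD eD] := divided_difference i j lg cg; exists D.
pose g' i u := u ord0 i * pdiff i (g i) u + \sum_(j | j != i) u ord0 i * D (i, j) u.
have lD i j : laur (D (i, j)) by have [] := HD (i, j).
have eD i j u : i != j -> posv u -> (u ord0 i - u ord0 j) * D (i, j) u = g i u - g j u.
  by move=> ij pu; have [_ H] := HD (i, j); exact: H.
exists (fun i j => D (i, j)), g'; split; first by split.
- move=> i; apply: (@laurD _ _ ((fun u => u ord0 i) \* pdiff i (g i))).
    by apply: laurM; [exact: laur_coord|exact: laur_pdiff].
  by apply: laur_sum => j; apply: (@laurM _ _ (fun u => u ord0 i)); [exact: laur_coord|].
(* Both sides have the same product with [u (s i) - u (s j)], and this factor may be cancelled even
   where it vanishes. *)
have cD (s : 'S_N) i j u : i != j -> posv u -> D (i, j) (permv s u) = D (s i, s j) u.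
  move=> ij pu; have sij : s i != s j by rewrite (inj_eq perm_inj).
  have lE : laur ((D (i, j) \o permv s) \+ (cst (-1) \* D (s i, s j))).
    by apply: laurD; [exact: laur_perm|apply: laurM => //; exact: laur_cst].
  have /(_ _ u pu) := laur_cancel sij lE.
  rewrite /= mulN1r => /(_ _)/eqP; rewrite subr_eq0 => H; apply/eqP/H => {H} w pw.
  rewrite mulN1r mulrBr eD // -!cg //.
  have := eD i j _ ij (posv_perm s pw); rewrite !mxE => ->.
  by rewrite subrr.
move=> s i u pu; rewrite /g' mxE; congr (_ + _).
  congr (_ * _); rewrite -pdiff_perm; apply: pdiff_ext pu => w pw.
  exact: cg.
rewrite [RHS](reindex_inj (@perm_inj _ s)) /=; apply: eq_big => j.
  by rewrite (inj_eq perm_inj).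
by move=> ji; rewrite cD // eq_sym.
Qed.

Lemma dunkl_sequence (chi : rv -> R) : laur chi ->
  (forall s u, posv u -> chi (permv s u) = chi u) ->
  exists (g : nat -> 'I_N -> rv -> R) (D : nat -> 'I_N -> 'I_N -> rv -> R),
  [/\ forall i, g 0%N i = chi, forall k i, laur (g k i) &
      forall k, dunkl_step (g k) (D k) (g k.+1)].
Proof.
move=> lchi schi.
pose good (g : 'I_N -> rv -> R) := (forall i, laur (g i)) /\ covariant g.
have good0 : good (fun=> chi) by split => // s i u pu; exact: schi.
have step (g : {g | good g}) : exists Dg : ('I_N -> 'I_N -> rv -> R) * {g | good g},
    dunkl_step (sval g) Dg.1 (sval Dg.2).
  case: g => g [lg cg]; have [D [g' [st lg' cg']]] := dunkl_step_exists lg cg.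
  by exists (D, exist good g' (conj lg' cg')).
have /choice [F HF] := step.
pose G k := iter k (fun g => (F g).2) (exist good _ good0).
exists (fun k => sval (G k)), (fun k => (F (G k)).1); split.
- by [].
- by move=> k i; have [] := svalP (G k).
- by move=> k; exact: HF.
Qed.

End DunklData.

Section Eigen.
Variables (R : realType) (N : nat).
Notation rv := 'rV[R]_N.
Implicit Types (f g : rv -> R) (u v : rv).

Definition injv u := injective (fun i : 'I_N => u ord0 i).

Lemma injv_near u : injv u -> \forall v \near u, injv v.
Proof.
move=> iu.
have H : \forall v \near u, forall ij : 'I_N * 'I_N,
    ij.1 != ij.2 -> (v : rv) ord0 ij.1 != v ord0 ij.2.
  refine (@filter_forall _ _ (fun (ij : 'I_N * 'I_N) (v : rv) =>
    ij.1 != ij.2 -> v ord0 ij.1 != v ord0 ij.2) _ (nbhs_filter u) _).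
  move=> -[i j] /=.
  case: (eqVneq i j) => [_|ij]; first by near=> v.
  have uij : u ord0 i - u ord0 j != 0 by rewrite subr_eq0; apply: contra ij => /eqP/iu ->.
  have c : (fun v : rv => v ord0 i - v ord0 j) @ u --> u ord0 i - u ord0 j.
    have C k : (fun v : rv => v ord0 k) @ u --> u ord0 k.
      have H := @coord_continuous R 1 N ord0 k.
      exact: (H u).
    exact: (cvgB (C i) (C j)).
  near=> v => _; rewrite -subr_eq0; near: v.
  exact: (cvgr_neq0 _ c).
near=> v => i j /= e; apply/eqP; apply: contraT => ij.
have /(_ (i, j) ij) /= : forall ij : 'I_N * 'I_N, ij.1 != ij.2 -> v ord0 ij.1 != v ord0 ij.2.
  by near: v.
by rewrite e eqxx.
Unshelve. all: by end_near. Qed.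

Lemma is_derive_line_cst f u v : (forall h, f (h *: v + u) = f u) -> is_derive u v f 0.
Proof.
move=> H.
have E : (fun h : R => h^-1 *: (f (h *: v + u) - f u)) @ 0^' --> (0 : R).
  by apply: cvg_near_cst; near=> h; rewrite H subrr scaler0.
by apply: DeriveDef; [apply/cvg_ex; exists 0 | apply: cvg_lim].
Unshelve. all: by end_near. Qed.

Lemma is_derive_bigsum (T : Type) (r : seq T) (P : pred T) (F : T -> rv -> R) dF u v :
  (forall t, P t -> is_derive u v (F t) (dF t)) ->
  is_derive u v (fun w => \sum_(t <- r | P t) F t w) (\sum_(t <- r | P t) dF t).
Proof.
move=> H; elim: r => [|t r IH].
  rewrite big_nil (_ : (fun w => _) = cst 0); first exact: is_derive_cst.
  by apply/funext => w; rewrite big_nil.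
rewrite big_cons; case: ifP => Pt.
  rewrite (_ : (fun w => _) = F t \+ (fun w => \sum_(t <- r | P t) F t w)).
    by apply: is_deriveD => //; exact: H.
  by apply/funext => w; rewrite big_cons Pt.
rewrite (_ : (fun w => _) = (fun w => \sum_(t <- r | P t) F t w)) //.
by apply/funext => w; rewrite big_cons Pt.
Qed.

Lemma is_derive_bigprod (T : Type) (r : seq T) (P : pred T) (F : T -> rv -> R) c u v :
  (forall t, P t -> is_derive u v (F t) (c t * F t u)) ->
  is_derive u v (fun w => \prod_(t <- r | P t) F t w)
    ((\sum_(t <- r | P t) c t) * \prod_(t <- r | P t) F t u).
Proof.
move=> H; elim: r => [|t r IH].
  rewrite !big_nil mul0r (_ : (fun w => _) = cst 1); first exact: is_derive_cst.
  by apply/funext => w; rewrite big_nil.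
rewrite !big_cons; case: ifP => Pt.
  rewrite (_ : (fun w => _) = F t \* (fun w => \prod_(t <- r | P t) F t w)).
    by apply: is_derive_eq (is_deriveMm (H _ Pt) IH) _; ring.
  by apply/funext => w; rewrite big_cons Pt.
rewrite (_ : (fun w => _) = (fun w => \prod_(t <- r | P t) F t w)) //.
by apply/funext => w; rewrite big_cons Pt.
Qed.

Lemma laur_exprz (j : 'I_N) (n : int) : laur (fun u : rv => u ord0 j ^ n).
Proof.
case: n => n.
  elim: n => [|n IH]; first exact: (laur_ext _ (laur_cst _ 1)).
  apply: laur_ext (laurM (laur_coord R j) IH) => u pu /=.
  by rewrite -!exprnP exprS.
have H : laur (fun u : rv => ((u ord0 j)^-1) ^+ n.+1).
  elim: n.+1 => [|k IH]; first exact: (laur_ext _ (laur_cst _ 1)).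
  by apply: laur_ext (laurM (laur_coordV R j) IH) => u pu /=; rewrite exprS.
by apply: laur_ext H => u pu; rewrite exprVn.
Qed.

Lemma laur_mon (m : 'I_N -> int) : laur (@mon R N m).
Proof. by apply: laur_prod => i; exact: laur_exprz. Qed.

Lemma is_derive_exprz (j : 'I_N) (n : int) (i : nat) u : posv u ->
  is_derive u (evec N i) (fun w : rv => w ord0 j ^ n)
    (((j : nat) == i)%:R * n%:~R * (u ord0 j)^-1 * (u ord0 j) ^ n).
Proof.
move=> pu; have u0 : u ord0 j != 0 by rewrite gt_eqF.
have P (k : nat) : is_derive u (evec N i) (fun w : rv => w ord0 j ^+ k)
    (((j : nat) == i)%:R * k%:R * (u ord0 j)^-1 * (u ord0 j) ^+ k).
  elim: k => [|k IH].
    rewrite mulr0 !mul0r (_ : (fun w : rv => _) = cst 1); first exact: is_derive_cst.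
    by apply/funext => w; rewrite expr0.
  rewrite (_ : (fun w : rv => _) = (fun w : rv => w ord0 j) \* (fun w : rv => w ord0 j ^+ k)).
    apply: is_derive_eq (is_deriveMm (is_derive_coord j u _) IH) _.
    by rewrite mxE exprS -natr1; field.
  by apply/funext => w; rewrite exprS.
case: n => k; first exact: P.
rewrite (_ : (fun w : rv => _) = fun w => (w ord0 j ^+ k.+1)^-1); last by [].
have [d1 d2] := P k.+1.
have n0 : u ord0 j ^+ k.+1 != 0 by rewrite expf_neq0.
have := @deriveV _ _ (fun w : rv => w ord0 j ^+ k.+1) u (evec N i) n0 d1.
rewrite d2 => e; apply: DeriveDef; first exact: derivableV.
rewrite e -[_ *: _]/(_ * _) NegzE -exprnN mulrNz.
rewrite -[(k.+1)%:~R]/((k.+1)%:R); set X := u ord0 j ^+ k.+1.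
by field; rewrite u0 n0.
Qed.

Lemma is_derive_mon (m : 'I_N -> int) (i : 'I_N) u : posv u ->
  is_derive u (evec N i) (@mon R N m) ((m i)%:~R * (u ord0 i)^-1 * mon m u).
Proof.
move=> pu; have := @is_derive_bigprod _ (index_enum 'I_N) xpredT
  (fun j (w : rv) => w ord0 j ^ (m j)) _ u (evec N i) (fun j _ => is_derive_exprz j (m j) i pu).
move=> H; apply: is_derive_eq H _; rewrite -/(mon m u); congr (_ * _).
rewrite (bigD1 i) //= eqxx mul1r big1 ?addr0 // => j ji.
by rewrite (inj_eq val_inj) (negPf ji) !mul0r.
Qed.

Lemma is_derive_vandermonde (i : 'I_N) u : injv u ->
  is_derive u (evec N i) (@vandermonde R N)
    ((\sum_(j | j != i) (u ord0 i - u ord0 j)^-1) * vandermonde u).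
Proof.
move=> iu.
pose c (a b : 'I_N) : R := ((a == i)%:R - (b == i)%:R) / (u ord0 a - u ord0 b).
have H (a b : 'I_N) : (a < b)%N -> is_derive u (evec N i)
    (fun w : rv => w ord0 a - w ord0 b) (c a b * (u ord0 a - u ord0 b)).
  move=> ab; rewrite /c mulfVK; last first.
    by rewrite subr_eq0 (inj_eq iu) -(inj_eq val_inj) ltn_eqF.
  have := @is_deriveB _ _ _ _ _ _ _ _ _ (is_derive_coord a u (evec N i)) (is_derive_coord b u (evec N i)).
  by move=> K; apply: is_derive_eq K _; rewrite !mxE !(inj_eq val_inj).
have H2 (a : 'I_N) : is_derive u (evec N i)
    (fun w : rv => \prod_(b < N | (a < b)%N) (w ord0 a - w ord0 b))
    ((\sum_(b < N | (a < b)%N) c a b) * \prod_(b < N | (a < b)%N) (u ord0 a - u ord0 b)).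
  by apply: is_derive_bigprod => b; exact: H.
have H3 := @is_derive_bigprod _ (index_enum 'I_N) xpredT _ _ u (evec N i) (fun a _ => H2 a).
apply: is_derive_eq H3 _; congr (_ * _).
under eq_bigr => a _.
  under eq_bigr => b _ do rewrite /c mulrBl.
  rewrite sumrB; over.
rewrite sumrB [X in _ - X](exchange_big_dep xpredT) //=.
rewrite (bigD1 i) //= [X in _ + X - _]big1 ?addr0; last first.
  by move=> a ai; rewrite big1 // => b _; rewrite (negPf ai) mul0r.
rewrite [X in _ - X](bigD1 i) //= [X in _ - (_ + X)]big1 ?addr0; last first.
  by move=> a ai; rewrite big1 // => b _; rewrite (negPf ai) mul0r.
rewrite [RHS](bigID (fun j : 'I_N => (i < j)%N)) /= -sumrN; congr (_ + _).
  apply: eq_big => [j|j _]; last by rewrite eqxx mul1r.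
  by rewrite -(inj_eq val_inj); case: ltngtP.
apply: eq_big => [j|j ji].
  by rewrite -(inj_eq val_inj); case: ltngtP.
by rewrite eqxx mul1r -invrN opprB.
Qed.

End Eigen.

(** * Explicit eigenvectors of the recursion *)

Section EigenIdentity.
Variables (R : realType) (N : nat).
Notation rv := 'rV[R]_N.
Implicit Types (u v w : rv).
Let co u : 'I_N -> R := fun k => u ord0 k.

(** In the partial fraction form the coefficients [h j] are constant along the direction [i], so
    only simple fractions are differentiated. *)
Lemma is_derive_dunklB (x : 'I_N -> R) (i : 'I_N) u : injv u ->
  is_derive u (evec N i) (fun w : rv => dunklB (co w) x i)
    (\sum_(j | j != i) u ord0 j / (u ord0 i - u ord0 j) ^+ 2 * dunklE (co u) x i j).
Proof.
move=> iu.
pose h (j : 'I_N) (w : rv) := w ord0 j * dunklE (co w) x i j.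
pose F (w : rv) := \prod_(j | j != i) (x j - 1) - \sum_(j | j != i) (h j w * (w ord0 i - w ord0 j)^-1).
have FE : \forall w \near u, F w = dunklB (co w) x i.
  near=> w; have iw : injv w by near: w; exact: injv_near.
  rewrite dunklB_pf // /F; congr (_ - _); apply: eq_bigr => j _.
  by rewrite /h mulrAC.
apply: near_eq_is_derive FE _.
have dh (j : 'I_N) : j != i -> is_derive u (evec N i) (h j) 0.
  move=> ji; apply: is_derive_line_cst => t.
  have ev (k : 'I_N) : k != i -> co (t *: evec N i + u) k = co u k.
    by move=> ki; rewrite /co !mxE (inj_eq val_inj) (negPf ki) mulr0 add0r.
  rewrite /h -!/(co _ _) -/(co u j) ev // /dunklE; congr (_ * _).
  by apply: eq_bigr => n /andP[ni _]; rewrite !ev.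
have dv (j : 'I_N) : j != i -> is_derive u (evec N i) (fun w : rv => (w ord0 i - w ord0 j)^-1)
    (- (u ord0 i - u ord0 j) ^- 2).
  move=> ji; have n0 : u ord0 i - u ord0 j != 0 by rewrite subr_eq0 (inj_eq iu) eq_sym.
  have H := @is_deriveB _ _ _ _ _ _ _ _ _ (is_derive_coord i u (evec N i)) (is_derive_coord j u (evec N i)).
  have [d1 d2] := H.
  have := @deriveV _ _ (fun w : rv => w ord0 i - w ord0 j) u (evec N i) n0 d1.
  rewrite d2 => e; apply: DeriveDef; first exact: derivableV.
  rewrite e !mxE eqxx (inj_eq val_inj) (negPf ji) subr0 -[_ *: _]/(_ * _) mulr1 //.
have dS := @is_derive_bigsum R N _ (index_enum 'I_N) (fun j => j != i) _ _ u (evec N i)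
  (fun j ji => is_deriveMm (dh j ji) (dv j ji)).
have := @is_deriveB _ _ _ _ _ u (evec N i) _ _
  (@is_derive_cst _ _ _ (\prod_(j | j != i) (x j - 1) : R) u (evec N i)) dS.
move=> H; apply: is_derive_eq H _; rewrite sub0r -sumrN.
apply: eq_bigr => j ji; rewrite mul0r add0r /h.
have n0 : u ord0 i - u ord0 j != 0 by rewrite subr_eq0 (inj_eq iu) eq_sym.
by field.
Unshelve. all: by end_near. Qed.

Lemma laur_cancel_seq (F : rv -> R) (r : seq ('I_N * 'I_N)) : laur F ->
  (forall p, p \in r -> p.1 != p.2) ->
  (forall u, posv u -> (\prod_(p <- r) (u ord0 p.1 - u ord0 p.2)) * F u = 0) ->
  forall u, posv u -> F u = 0.
Proof.
elim: r F => [|p r IH] F lF H E.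
  by move=> u pu; have := E u pu; rewrite big_nil mul1r.
have lG : laur (((fun u => u ord0 p.1) \+ (cst (-1) \* (fun u => u ord0 p.2))) \* F).
  by do ?[apply: laurM|apply: laurD|exact: laur_coord|exact: laur_cst|].
apply: (@laur_cancel _ _ _ p.1 p.2) => //; first by apply: H; rewrite mem_head.
move=> u pu; have := IH _ lG _ _ u pu; rewrite /= mulN1r; apply.
  by move=> x xr; apply: H; rewrite inE xr orbT.
move=> w pw; have := E w pw; rewrite big_cons mulN1r => <-; ring.
Qed.

(** Reduces identities between Laurent functions to points with distinct coordinates, where division
    by the differences is legitimate. *)
Lemma laur_vandermonde_cancel (F : rv -> R) : laur F ->
  (forall u, posv u -> injv u -> vandermonde u * F u = 0) ->
  forall u, posv u -> F u = 0.
Proof.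
move=> lF H.
pose r := seq.filter (fun p : 'I_N * 'I_N => (p.1 < p.2)%N) (index_enum ('I_N * 'I_N)%type).
have VE u : vandermonde u = \prod_(p <- r) (u ord0 p.1 - u ord0 p.2).
  by rewrite /vandermonde pair_big_dep /= /r big_filter.
apply: (@laur_cancel_seq F r) => // [p|u pu].
  by rewrite mem_filter => /andP[h _]; rewrite -(inj_eq val_inj) ltn_eqF.
rewrite -VE; case: (pselect (injv u)) => [iu|niu]; first exact: H.
suff -> : vandermonde u = 0 by rewrite mul0r.
apply/eqP; apply: contraT => V0; case: niu => a b /= e; apply: val_inj.
have K (c d : 'I_N) : (c < d)%N -> u ord0 c = u ord0 d -> False.
  move=> cd ecd; move/negP: V0; apply; rewrite /vandermonde.
  by rewrite (bigD1 c) //= (bigD1 d) //= ecd subrr !mul0r.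
by case: (ltngtP a b) => // ab; [case: (K a b)|case: (K b a)].
Qed.

Section Main.
Variables (l : 'I_N -> int) (chi : rv -> R).
Variables (g : nat -> 'I_N -> rv -> R) (D : nat -> 'I_N -> 'I_N -> rv -> R).
Hypothesis ldec : strictly_dec l.
Hypothesis chiE : forall u, posv u -> altf l u = vandermonde u * chi u.
Hypothesis lchi : laur chi.
Hypothesis g0 : forall i, g 0%N i = chi.
Hypothesis lg : forall k i, laur (g k i).
Hypothesis gS : forall k, dunkl_step (g k) (D k) (g k.+1).

Let lr (i : 'I_N) : R := (l i)%:~R.
Let Delta p := \prod_(j | j != p) (lr p - lr j).
(** The eigenvector [dunklB] at [z = l p] times [u ^ l], to be antisymmetrized over [s]. For fixed
    [p] the resulting family in [i] is an eigenvector with eigenvalue [lr p] of the recursion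
    conjugated by the Vandermonde product. *)
Let term (s : 'S_N) p i u := (-1) ^+ s * (mon (l \o s) u *
    dunklB (co u) (fun j => lr p - lr (s j)) i).
Let closed p i u := \sum_(s : 'S_N) term s p i u.

Lemma lr_inj : injective lr.
Proof.
move=> i j /eqP; rewrite eqr_int => /eqP e.
apply: val_inj; case: (ltngtP i j) => // /ldec; rewrite e ltxx //.
Qed.

Let posv_neq0 u i : posv u -> u ord0 i != 0. Proof. by move=> pu; rewrite gt_eqF. Qed.

Lemma altf_sum u : altf l u = \sum_(s : 'S_N) (-1) ^+ s * mon (l \o s) u.
Proof.
by apply: eq_bigr => s _; congr (_ * _); apply: eq_bigr => i _; rewrite mxE.
Qed.

(** Decomposes the starting vector, the Vandermonde product times [chi] in every coordinate, into
    eigenvectors. *)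
Lemma closed0 (i : 'I_N) u : injv u -> \sum_p closed p i u / Delta p = altf l u.
Proof.
move=> iu; rewrite altf_sum.
under eq_bigr do rewrite /closed mulr_suml.
rewrite exchange_big /=; apply: eq_bigr => s _.
under eq_bigr do rewrite /term -!mulrA.
rewrite -!mulr_sumr -[RHS]mulr1; rewrite -[RHS]mulrA; congr (_ * (_ * _)).
have inj : injective (lr \o s) by apply: inj_comp lr_inj perm_inj.
rewrite -(@dunklB_interpolation _ _ (co u) (lr \o s) i inj).
rewrite (reindex_inj (@perm_inj _ s)) /=; apply: eq_bigr => p _; congr (_ / _).
rewrite /Delta (reindex_inj (@perm_inj _ s)) /=; apply: eq_bigl => j.
by rewrite (inj_eq perm_inj).
Qed.

Lemma closed_derive p (i : 'I_N) u : posv u -> injv u -> exists2 c,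
  is_derive u (evec N i) (closed p i) c &
  u ord0 i * c - \sum_(j | j != i) u ord0 i / (u ord0 i - u ord0 j) * closed p j u
    = lr p * closed p i u.
Proof.
move=> pu iu.
pose dB (s : 'S_N) := \sum_(j | j != i) u ord0 j / (u ord0 i - u ord0 j) ^+ 2 *
   dunklE (co u) (fun j => lr p - lr (s j)) i j.
pose dt (s : 'S_N) := (-1) ^+ s * ((lr (s i) / u ord0 i * mon (l \o s) u) *
    dunklB (co u) (fun j => lr p - lr (s j)) i + mon (l \o s) u * dB s).
exists (\sum_(s : 'S_N) dt s).
  apply: is_derive_bigsum => s _.
  have H := is_deriveMm (is_derive_mon (l \o s) i pu)
    (is_derive_dunklB (fun j => lr p - lr (s j)) i iu).
  apply: is_derive_eq (is_deriveMm (is_derive_cst _ _ _) H) _.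
  by rewrite mul0r add0r.
rewrite mulr_sumr.
have -> : \sum_(j | j != i) u ord0 i / (u ord0 i - u ord0 j) * closed p j u =
   \sum_(s : 'S_N) \sum_(j | j != i) u ord0 i / (u ord0 i - u ord0 j) * term s p j u.
  by rewrite exchange_big /=; apply: eq_bigr => j _; rewrite mulr_sumr.
rewrite -sumrB mulr_sumr; apply: eq_bigr => s _.
have := @dunklB_eigen _ _ (co u) (fun j => lr p - lr (s j)) i iu (fun j => posv_neq0 j pu).
(* The factor at [j = s^-1 p] is zero, so the right side of [dunklB_eigen] disappears. *)
rewrite [RHS](bigD1 ((s^-1)%g p)) //= permKV subrr mul0r.
have u0 := posv_neq0 i pu.
rewrite -/(dB s) => E.
have -> : \sum_(j | j != i) u ord0 i / (u ord0 i - u ord0 j) * term s p j u =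
  (-1) ^+ s * mon (l \o s) u * \sum_(j | j != i) co u i / (co u i - co u j) *
     dunklB (co u) (fun j0 : 'I_N => lr p - lr (s j0)) j.
  by rewrite mulr_sumr; apply: eq_bigr => j _; rewrite /term /co;
    move: ((-1) ^+ s) (mon _ _) (dunklB _ _ _) => e b c; ring.
move: E; set SB := \sum_(j | _) _ * dunklB _ _ _ => E.
have -> : SB = co u i * dB s - (lr p - lr (s i)) * dunklB (co u) (fun j => lr p - lr (s j)) i.
  move: E; move: (dunklB _ _ _) (dB s) SB => b d e E.
  by apply/eqP; rewrite -subr_eq0 -E; apply/eqP; ring.
rewrite /dt /term /co; move: u0.
move: (u ord0 i) (lr p) (lr (s i)) ((-1) ^+ s) (mon _ _) (dunklB _ _ _) (dB s).
by move=> x y z e b c d x0; field.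
Qed.

(** After multiplication by the Vandermonde product, the logarithmic derivative of that product
    cancels the [g k i] part of the divided differences. What remains is the operator of
    [closed_derive], so each step multiplies the component of index [p] by [lr p]. *)
Lemma dunkl_closed k (i : 'I_N) u : posv u -> injv u ->
  vandermonde u * g k i u = \sum_p lr p ^+ k / Delta p * closed p i u.
Proof.
elim: k i u => [|k IH] i u pu iu.
  rewrite g0 -chiE // -(closed0 i iu); apply: eq_bigr => p _.
  by rewrite expr0 mul1r mulrC.
have [lD eD gE] := gS k; rewrite gE //.
have /choice [c Hc] : forall p, exists c, is_derive u (evec N i) (closed p i) c /\
  u ord0 i * c - \sum_(j | j != i) u ord0 i / (u ord0 i - u ord0 j) * closed p j u
    = lr p * closed p i u.
  by move=> p; have [c h1 h2] := closed_derive p i pu iu; exists c.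
have dVg : is_derive u (evec N i) (@vandermonde R N \* g k i) (\sum_p lr p ^+ k / Delta p * c p).
  apply: (@near_eq_is_derive _ _ _ (fun w => \sum_p lr p ^+ k / Delta p * closed p i w)).
    near=> w; rewrite -IH //; near: w; [exact: posv_near|exact: injv_near].
  apply: is_derive_bigsum => p _.
  apply: is_derive_eq (is_deriveMm (is_derive_cst _ _ _) (proj1 (Hc p))) _.
  by rewrite mul0r add0r.
have := is_deriveMm (is_derive_vandermonde i iu) (laur_is_derive i (lg k i) pu).
move=> [_ e1]; case: dVg => _; rewrite e1 => e2.
transitivity (u ord0 i * (\sum_p lr p ^+ k / Delta p * c p) -
   \sum_(j | j != i) u ord0 i / (u ord0 i - u ord0 j) * (vandermonde u * g k j u)).
  rewrite -e2 mulrDr mulr_sumr.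
  have -> : \sum_(j | j != i) vandermonde u * (u ord0 i * D k i j u) =
     \sum_(j | j != i) (u ord0 i / (u ord0 i - u ord0 j) * (vandermonde u * g k i u) -
        u ord0 i / (u ord0 i - u ord0 j) * (vandermonde u * g k j u)).
    apply: eq_bigr => j ji; rewrite -mulrBr -mulrBr -eD // 1?eq_sym //.
    have n0 : u ord0 i - u ord0 j != 0 by rewrite subr_eq0 (inj_eq iu) eq_sym.
    by field.
  rewrite sumrB -mulr_suml.
  have -> : \sum_(j | j != i) u ord0 i / (u ord0 i - u ord0 j) =
     u ord0 i * \sum_(j | j != i) (u ord0 i - u ord0 j)^-1 by rewrite mulr_sumr.
  ring.
under [X in _ - X]eq_bigr => j _ do rewrite IH // mulr_sumr.
rewrite [X in _ - X]exchange_big /= mulr_sumr -sumrB; apply: eq_bigr => p _.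
have [_ h] := Hc p.
have -> : lr p ^+ k.+1 / Delta p * closed p i u =
    lr p ^+ k / Delta p * (lr p * closed p i u).
  by rewrite exprSr; move: (lr p ^+ k) (lr p) (Delta p)^-1 (closed p i u) => a b d e; ring.
rewrite -h mulrBr mulr_sumr; congr (_ - _); first by rewrite mulrCA.
by apply: eq_bigr => j _; rewrite mulrCA.
Unshelve. all: by end_near. Qed.

Definition dunkl_eig (k : nat) : R :=
  \sum_p (\prod_(j | j != p) ((lr p - lr j - 1) / (lr p - lr j))) * lr p ^+ k.

(** By [dunklB_sum] the coordinates of an eigenvector add up to a difference of two products. The
    first is zero, the second gives the [lr p - lr j - 1] with [j != p]; divided by [Delta p] they
    are the weights for [q = 1]. *)
Lemma dunkl_eigen k u0 : posv u0 -> \sum_i g k i u0 = dunkl_eig k * chi u0.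
Proof.
move=> pu0.
pose F u := (\sum_i g k i u) + (- dunkl_eig k) * chi u.
have lF : laur F.
  apply: (@laurD _ _ (fun u => \sum_i g k i u) (cst (- dunkl_eig k) \* chi)).
    by apply: laur_sum => i.
  by apply: laurM => //; exact: laur_cst.
suff : F u0 = 0 by rewrite /F mulNr => /eqP; rewrite subr_eq0 => /eqP.
apply: laur_vandermonde_cancel pu0 => // u pu iu.
rewrite /F mulrDr mulrCA -chiE // mulr_sumr.
under eq_bigr => i _ do rewrite dunkl_closed //.
rewrite exchange_big /= /dunkl_eig mulNr mulr_suml -sumrB big1 // => p _.
rewrite -mulr_sumr /closed exchange_big /=.
have xp0 (s : 'S_N) : \prod_j (lr p - lr (s j)) = 0.
  by rewrite (bigD1 ((s^-1)%g p)) //= permKV subrr mul0r.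
have xp1 (s : 'S_N) : \prod_j (lr p - lr (s j) - 1) = - \prod_(j | j != p) (lr p - lr j - 1).
  transitivity (\prod_j (lr p - lr j - 1)); first by rewrite [RHS](reindex_inj (@perm_inj _ s)).
  by rewrite (bigD1 p) //= subrr sub0r mulN1r.
have -> : \sum_(s : 'S_N) \sum_i term s p i u =
   (\prod_(j | j != p) (lr p - lr j - 1)) * altf l u.
  rewrite altf_sum mulr_sumr; apply: eq_bigr => s _.
  rewrite /term -mulr_sumr -mulr_sumr.
  rewrite (@dunklB_sum _ _ (co u)) //; last by move=> j; exact: posv_neq0.
  by rewrite xp0 xp1 sub0r opprK mulrA mulrC.
rewrite prodf_div -/(Delta p).
by ring.
Qed.

End Main.
End EigenIdentity.

(** * Sums over signatures *)

Section RealSums.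
Variables (R : realType) (T : choiceType).
Implicit Types (f g h : T -> R).
Local Open Scope ereal_scope.

Definition nsum f : \bar R := \esum_(x in setT) (f x)%:E.
Definition asum f := nsum (fun x => `|f x|%R) < +oo.

Lemma nsum_ge0 f : (forall x, 0 <= f x)%R -> 0 <= nsum f.
Proof. by move=> f0; apply: esum_ge0 => x _; rewrite lee_fin. Qed.

Lemma nsumD f g : (forall x, 0 <= f x)%R -> (forall x, 0 <= g x)%R ->
  nsum (fun x => f x + g x)%R = nsum f + nsum g.
Proof.
move=> f0 g0; rewrite /nsum -esumD; first by apply: eq_esum => x _; rewrite EFinD.
- by move=> x _; rewrite lee_fin.
- by move=> x _; rewrite lee_fin.
Qed.

Lemma nsum_le f g : (forall x, f x <= g x)%R -> nsum f <= nsum g.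
Proof. by move=> fg; apply: le_esum => x _; rewrite lee_fin. Qed.

Lemma nsum_fin f : (forall x, 0 <= f x)%R -> asum f -> nsum f \is a fin_num.
Proof.
move=> f0 sf; rewrite ge0_fin_numE ?nsum_ge0 // (le_lt_trans _ sf) //.
by apply: nsum_le => x; exact: ler_norm.
Qed.

Lemma asum_le f g : (forall x, `|f x| <= `|g x|)%R -> asum g -> asum f.
Proof. by move=> fg; apply: le_lt_trans; exact: nsum_le. Qed.

Lemma asumD f g : asum f -> asum g -> asum (fun x => f x + g x)%R.
Proof.
move=> sf sg; apply: le_lt_trans (lte_add_pinfty sf sg).
by rewrite -nsumD //; apply: nsum_le => x; exact: ler_normD.
Qed.

Lemma asum0 : asum (fun=> 0%R).
Proof. by rewrite /asum /nsum esum1 ?ltry // => i _; rewrite normr0. Qed.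

(** Repeated addition handles integer factors, and an integer above [|c|] dominates the rest. *)
Lemma asumZ (c : R) f : asum f -> asum (fun x => c * f x)%R.
Proof.
move=> sf.
have H n : asum (fun x => n%:R * f x)%R.
  elim: n => [|n IH]; first by apply: asum_le asum0 => x; rewrite mul0r.
  by apply: asum_le (asumD IH sf) => x; rewrite -natr1 mulrDl mul1r.
apply: asum_le (H (Num.bound `|c|%R)) => x.
rewrite !normrM ler_wpM2r // [X in (_ <= X)%R]ger0_norm // ltW //.
by apply: archi_boundP.
Qed.

Lemma asumN f : asum f -> asum (fun x => - f x)%R.
Proof. by apply: asum_le => x; rewrite normrN. Qed.

Lemma asum_abs f : asum f -> asum (fun x => `|f x|)%R.
Proof. by apply: asum_le => x; rewrite normr_id. Qed.

Lemma asum_sum (J : Type) (r : seq J) (F : J -> T -> R) :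
  (forall j, asum (F j)) -> asum (fun x => \sum_(j <- r) F j x)%R.
Proof.
move=> H; elim: r => [|j r IH].
  by apply: asum_le asum0 => x; rewrite big_nil.
by apply: asum_le (asumD (H j) IH) => x; rewrite big_cons.
Qed.

(** Any splitting into nonnegative summable parts computes [rsum], not only the one into positive
    and negative parts; this is what makes [rsum] linear. *)
Lemma rsum_split f g h : (forall x, f x = g x - h x)%R ->
  (forall x, 0 <= g x)%R -> (forall x, 0 <= h x)%R -> asum g -> asum h ->
  rsum f = (fine (nsum g) - fine (nsum h))%R.
Proof.
move=> fE g0 h0 sg sh.
have sf : asum f.
  by apply: asum_le (asumD sg (asumN sh)) => x; rewrite fE.
pose fp x := Num.max (f x) 0%R; pose fm x := Num.max (- f x)%R 0%R.
have fp0 x : (0 <= fp x)%R by rewrite /fp le_max lexx orbT.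
have fm0 x : (0 <= fm x)%R by rewrite /fm le_max lexx orbT.
have sfp : asum fp.
  apply: asum_le sf => x; rewrite ger0_norm // /fp ge_max normr_ge0 andbT; exact: ler_norm.
have sfm : asum fm.
  by apply: asum_le sf => x; rewrite ger0_norm // /fm ge_max normr_ge0 andbT -normrN; exact: ler_norm.
rewrite -[rsum f]/(fine (nsum fp) - fine (nsum fm))%R.
have e : nsum fp + nsum h = nsum g + nsum fm.
  rewrite -!nsumD //; congr nsum; apply/funext => x.
  rewrite /fp /fm; have := fE x.
  by case: (lerP (f x) 0%R) => h1; case: (lerP (- f x) 0%R) => h2; lra.
have := congr1 (@fine R) e; rewrite !fineD ?nsum_fin //; lra.
Qed.

Lemma rsum_ge0E f : (forall x, 0 <= f x)%R -> asum f -> rsum f = fine (nsum f).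
Proof.
move=> f0 sf; rewrite (@rsum_split f f (fun=> 0%R)) //.
- by rewrite (_ : nsum (fun=> 0%R) = 0) ?subr0 //; apply: esum1.
- by move=> x; rewrite subr0.
- exact: asum0.
Qed.

Lemma rsum_ge0 f : (forall x, 0 <= f x)%R -> asum f -> (0 <= rsum f)%R.
Proof. by move=> f0 sf; rewrite rsum_ge0E // fine_ge0 // nsum_ge0. Qed.

Let pp f x := Num.max (f x) 0%R.
Let pm f x := Num.max (- f x)%R 0%R.
Let pp0 f x : (0 <= pp f x)%R. Proof. by rewrite /pp le_max lexx orbT. Qed.
Let pm0 f x : (0 <= pm f x)%R. Proof. by rewrite /pm le_max lexx orbT. Qed.
Let ppm f x : (f x = pp f x - pm f x)%R.
Proof. by rewrite /pp /pm; case: (lerP (f x) 0%R) => h1; case: (lerP (- f x) 0%R) => h2; lra. Qed.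
Let spp f : asum f -> asum (pp f).
Proof.
apply: asum_le => x; rewrite ger0_norm // /pp ge_max normr_ge0 andbT; exact: ler_norm.
Qed.
Let spm f : asum f -> asum (pm f).
Proof.
by apply: asum_le => x; rewrite ger0_norm // /pm ge_max normr_ge0 andbT -normrN; exact: ler_norm.
Qed.

Lemma rsumD f g : asum f -> asum g -> rsum (fun x => f x + g x)%R = (rsum f + rsum g)%R.
Proof.
move=> sf sg.
rewrite (@rsum_split _ (fun x => pp f x + pp g x)%R (fun x => pm f x + pm g x)%R).
- rewrite (nsumD (pp0 f) (pp0 g)) (nsumD (pm0 f) (pm0 g)).
  rewrite (fineD (nsum_fin (pp0 f) (spp sf)) (nsum_fin (pp0 g) (spp sg))).
  rewrite (fineD (nsum_fin (pm0 f) (spm sf)) (nsum_fin (pm0 g) (spm sg))).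
  rewrite -[rsum f]/(fine (nsum (pp f)) - fine (nsum (pm f)))%R.
  rewrite -[rsum g]/(fine (nsum (pp g)) - fine (nsum (pm g)))%R; lra.
- by move=> x; have := ppm f x; have := ppm g x; lra.
- by move=> x; rewrite addr_ge0.
- by move=> x; rewrite addr_ge0.
- by apply: asumD; exact: spp.
- by apply: asumD; exact: spm.
Qed.

Lemma rsumN f : asum f -> rsum (fun x => - f x)%R = (- rsum f)%R.
Proof.
move=> sf; have e x : (- f x = pm f x - pp f x)%R by have := ppm f x; lra.
rewrite (rsum_split e (pm0 f) (pp0 f) (spm sf) (spp sf)).
by rewrite -[rsum f]/(fine (nsum (pp f)) - fine (nsum (pm f)))%R opprB.
Qed.

Lemma rsumB f g : asum f -> asum g -> rsum (fun x => f x - g x)%R = (rsum f - rsum g)%R.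
Proof. by move=> sf sg; rewrite rsumD ?rsumN //; exact: asumN. Qed.

Lemma rsum_le f g : asum f -> asum g -> (forall x, f x <= g x)%R -> (rsum f <= rsum g)%R.
Proof.
move=> sf sg fg; rewrite -subr_ge0 -rsumB // rsum_ge0 //.
  by move=> x; rewrite subr_ge0.
by apply: asumD => //; exact: asumN.
Qed.

Lemma eq_rsum f g : (forall x, f x = g x) -> rsum f = rsum g.
Proof. by move=> fg; congr rsum; apply/funext. Qed.

Lemma ler_rsum_abs f : asum f -> (`|rsum f| <= rsum (fun x => `|f x|))%R.
Proof.
move=> sf; rewrite ler_norml -rsumN ?rsum_le //; try exact: asum_abs.
- by move=> x; rewrite ler_norm.
- by apply: asumN; exact: asum_abs.
- by move=> x; have := ler_norm (- f x)%R; rewrite normrN; lra.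
Qed.

Lemma rsum0 : rsum (fun _ : T => 0%R) = 0%R :> R.
Proof.
by rewrite (rsum_ge0E (fun=> lexx _) asum0) (_ : nsum (fun=> 0%R) = 0) //; apply: esum1.
Qed.

Lemma nsumZ (c : R) f : (0 < c)%R -> (forall x, 0 <= f x)%R ->
  nsum (fun x => c * f x)%R = c%:E * nsum f.
Proof.
have H c' f' : (0 < c')%R -> (forall x, 0 <= f' x)%R ->
    nsum (fun x => c' * f' x)%R <= c'%:E * nsum f'.
  move=> c0 f0; apply: ge_ereal_sup => _ [X [fX _] <-].
  under eq_fsbigr do rewrite EFinM.
  rewrite -ge0_mule_fsumr; last by move=> x; rewrite lee_fin.
  rewrite lee_pmul2l //; apply: ereal_sup_ubound; exists X => //.
move=> c0 f0; apply/eqP; rewrite eq_le H //=.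
have ci : (0 < c^-1)%R by rewrite invr_gt0.
have := H _ (fun x => c * f x)%R ci (fun x => mulr_ge0 (ltW c0) (f0 x)).
rewrite (_ : (fun x => _) = f); last by apply/funext => x; rewrite mulKf // gt_eqF.
by move=> h; rewrite -lee_pdivlMl.
Qed.

Lemma rsumZ (c : R) f : asum f -> rsum (fun x => c * f x)%R = (c * rsum f)%R.
Proof.
have P (d : R) : (0 < d)%R -> asum f -> rsum (fun x => d * f x)%R = (d * rsum f)%R.
  move=> d0 sf; rewrite (@rsum_split _ (fun x => d * pp f x)%R (fun x => d * pm f x)%R).
  - rewrite (nsumZ d0 (pp0 f)) (nsumZ d0 (pm0 f)).
    rewrite (fineM (isT : d%:E \is a fin_num) (nsum_fin (pp0 f) (spp sf))).
    rewrite (fineM (isT : d%:E \is a fin_num) (nsum_fin (pm0 f) (spm sf))).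
    by rewrite -[rsum f]/(fine (nsum (pp f)) - fine (nsum (pm f)))%R mulrBr.
  - by move=> x; rewrite {1}(ppm f x) mulrBr.
  - by move=> x; rewrite mulr_ge0 // ltW.
  - by move=> x; rewrite mulr_ge0 // ltW.
  - by apply: asumZ; exact: spp.
  - by apply: asumZ; exact: spm.
move=> sf; case: (ltrgt0P c) => [c0|c0|->].
- exact: P.
- rewrite (@eq_rsum _ (fun x => - ((- c) * f x))%R) ?rsumN ?P ?oppr_gt0 //.
  + by rewrite mulNr opprK.
  + exact: asumZ.
  + by move=> x; rewrite mulNr opprK.
- by rewrite mul0r (@eq_rsum _ (fun=> 0%R)) ?rsum0 // => x; rewrite mul0r.
Qed.

End RealSums.

(** * Schur functions on the positive orthant *)

Section SchurFunctions.
Variables (R : realType) (N : nat).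
Notation rv := 'rV[R]_N.
Implicit Types (u v w : rv) (lam : sig_t N).

Definition sigl lam (j : 'I_N) : int := sig_at lam j + (N - 1 - j)%:Z.

Lemma sigl_dec lam : strictly_dec (sigl lam).
Proof.
move=> i j ij; rewrite /sigl /sig_at.
have : (tnth (val lam) j <= tnth (val lam) i).
  rewrite !(tnth_nth 0); have := valP lam => /= srt.
  have tr : transitive (fun x y : int => y <= x) by move=> y x z h1 h2; exact: le_trans h2 h1.
  apply: (sorted_ltn_nth tr 0 srt) => //; rewrite inE size_tuple //; exact: ltn_ord.
by have := ltn_ord j; have := ltn_ord i; move: ij; lia.
Qed.

Lemma alternantE lam u : alternant lam u = altf (sigl lam) u.
Proof. by []. Qed.

Lemma altf_perm (s : 'S_N) (l : 'I_N -> int) u : altf l (permv s u) = (-1) ^+ s * altf l u.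
Proof.
rewrite /altf -det_perm -det_mulmx; congr (\det _).
rewrite -row_permE; apply/matrixP => i j; rewrite !mxE //.
Qed.

Lemma vandermonde_perm (s : 'S_N) u : vandermonde (permv s u) = (-1) ^+ s * vandermonde u.
Proof.
pose c : R := \prod_(i < N) \prod_(j < N | (i < j)%N) (-1).
have VE w : vandermonde w = c * \det (Vandermonde N w).
  rewrite det_Vandermonde /vandermonde /c -big_split /=; apply: eq_bigr => i _.
  by rewrite -big_split /=; apply: eq_bigr => j _; rewrite mulN1r opprB.
rewrite !VE mulrCA; congr (_ * _).
have -> : Vandermonde N (permv s u) = col_perm s (Vandermonde N u).
  by apply/matrixP => i j; rewrite !mxE.
by rewrite col_permE det_mulmx det_perm odd_permV mulrC.
Qed.

Lemma chi_sym (l : 'I_N -> int) (chi : rv -> R) : laur chi ->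
  (forall u, posv u -> altf l u = vandermonde u * chi u) ->
  forall s u, posv u -> chi (permv s u) = chi u.
Proof.
move=> lc ce s u pu.
have lF : laur ((chi \o permv s) \+ (cst (-1) \* chi)).
  by apply: laurD; [exact: laur_perm|apply: laurM => //; exact: laur_cst].
have := laur_vandermonde_cancel lF; rewrite /= => H.
apply/eqP; rewrite -subr_eq0 -mulN1r; apply/eqP; apply: H => // w pw iw.
have := ce _ (posv_perm s pw); rewrite altf_perm vandermonde_perm (ce _ pw) => e.
rewrite mulrDr mulN1r mulrN.
apply: (mulfI (_ : (-1) ^+ s != 0)); first by rewrite signr_eq0.
by rewrite mulr0 mulrBr mulrA -e subrr.
Qed.

Lemma laur_continuous (f : rv -> R) u : laur f -> posv u -> f @ u --> f u.
Proof.
have C k w : (fun v : rv => v ord0 k) @ w --> w ord0 k.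
  by have H := @coord_continuous R 1 N ord0 k; exact: (H w).
move=> lf; elim: lf u => {f} [c|j|j|f g _ If _ Ig|f g _ If _ Ig|f g fg _ If] u pu.
- by have := @cvg_cst R c rv (nbhs u) _; apply.
- exact: C.
- by apply: (cvgV _ (C j u)); rewrite gt_eqF.
- exact: (cvgD (If u pu) (Ig u pu)).
- exact: (cvgM (If u pu) (Ig u pu)).
- have nr : \forall w \near u, f w = g w.
    by near=> w; apply: fg; near: w; exact: posv_near.
  by rewrite -fg //; exact: (cvg_trans (near_eq_cvg nr) (If u pu)).
Unshelve. all: by end_near. Qed.

(** Without this the limit defining [schur] would carry no information. The points
    [u + t (0, 1, 2, ...)] have distinct coordinates for small nonzero [t] and tend to [u]. *)
Lemma distinct_within_proper u : ProperFilter (within (@distinct_coords R N) (nbhs u)).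
Proof.
apply: Build_ProperFilter_ex => A [P HP PA].
pose p (t : R) : rv := \row_j (t * j%:R + u ord0 j).
have H1 : \forall t \near (0 : R)^', forall j : 'I_N, P ord0 j (p t ord0 j).
  apply: filter_forall => j; under eq_near do rewrite mxE.
  have C : (fun t : R => t * j%:R + u ord0 j) @ (0 : R)^' --> u ord0 j.
    have C1 : (fun t : R => t) @ (0 : R)^' --> (0 : R) by exact: cvg_within.
    have C2 := @cvg_cst R (j%:R : R) R (0 : R)^' _.
    have C3 := @cvg_cst R (u ord0 j : R) R (0 : R)^' _.
    by have := cvgD (cvgM C1 (C2 _)) (C3 _); rewrite mul0r add0r; apply.
  exact: (C _ (HP ord0 j)).
have H2 : \forall t \near (0 : R)^', forall ij : 'I_N * 'I_N,
    ij.1 != ij.2 -> p t ord0 ij.1 != p t ord0 ij.2.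
  apply: filter_forall => -[i j]; rewrite /=.
  case: (eqVneq i j) => [_|ij]; first by near=> t.
  case: (eqVneq (u ord0 i) (u ord0 j)) => uij.
    near=> t => _; rewrite !mxE uij -subr_eq0 opprD addrACA subrr addr0 -mulrBr.
    rewrite mulf_neq0 //; first by near: t; exact: nbhs_dnbhs_neq.
    by rewrite subr_eq0 eqr_nat (inj_eq val_inj).
  have d0 : 0 < `|u ord0 i - u ord0 j| by rewrite normr_gt0 subr_eq0.
  (* Since [|j - i| <= N + 1], a [t] below this bound cannot close the gap between two coordinates
     that differ in [u]. *)
  have e0 : 0 < `|u ord0 i - u ord0 j| / (N%:R + 1) by rewrite divr_gt0 // ltr_wpDl.
  near=> t => _; rewrite !mxE; apply/eqP => e.
  have : `|t| < `|u ord0 i - u ord0 j| / (N%:R + 1) by near: t; exact: dnbhs0_lt.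
  rewrite ltr_pdivlMr; last by rewrite ltr_wpDl.
  have -> : u ord0 i - u ord0 j = t * (j%:R - i%:R) by lra.
  rewrite normrM => h.
  have : `|j%:R - i%:R| <= N%:R + 1 :> R.
    have : (j : nat)%:R <= N%:R :> R by rewrite ler_nat ltnW.
    have : (i : nat)%:R <= N%:R :> R by rewrite ler_nat ltnW.
    have : 0 <= (i : nat)%:R :> R by [].
    have : 0 <= (j : nat)%:R :> R by [].
    by rewrite ler_norml => *; apply/andP; split; lra.
  by move/(ler_wpM2l (normr_ge0 t)); rewrite leNgt h.
have PF0 : ProperFilter ((0 : R)^') by apply: (Proper_dnbhs_numFieldType).
have [t [h1 h2]] := @filter_ex _ ((0 : R)^') PF0 _ (@filterI _ _ (filter_filter) _ _ H1 H2).
exists (p t); apply: PA; first by move=> i j; rewrite !ord1.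
by move=> i j ij; exact: (h2 (i, j)).
Unshelve. all: by end_near. Qed.

Lemma schurE lam (chi : rv -> R) u : laur chi ->
  (forall u, posv u -> altf (sigl lam) u = vandermonde u * chi u) ->
  posv u -> schur lam u = chi u.
Proof.
move=> lc ce pu; rewrite /schur; have PF := distinct_within_proper u.
apply: cvg_lim => //.
have C : chi @ within (@distinct_coords R N) (nbhs u) --> chi u.
  by apply: cvg_within_filter; exact: laur_continuous.
have nr : \forall w \near within (@distinct_coords R N) (nbhs u),
    chi w = alternant lam w / vandermonde w.
  rewrite near_withinE; near=> w => dw.
  have pw' : posv w by near: w; exact: posv_near.
  symmetry; rewrite alternantE ce // mulrAC mulfV ?mul1r //.
  apply/prodf_neq0 => i _; apply/prodf_neq0 => j ij.
  by rewrite subr_eq0; apply: dw; rewrite -(inj_eq val_inj) ltn_eqF.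
exact: (cvg_trans (near_eq_cvg nr) C).
Unshelve. all: by end_near. Qed.

End SchurFunctions.

(** * Termwise differentiation *)

Section TermwiseDifferentiation.
Variables (R : realType) (N : nat).
Notation rv := 'rV[R]_N.
Implicit Types (u v w : rv).

(** Induction with the square root [s] of [a]: one factor [s ^ k] pays for [k ^ n], the other for
    the additional factor [k] by [k (s - 1) <= s ^ k]. *)
Lemma pow_le_exp (n : nat) (a : R) : 1 < a ->
  exists2 C, 0 <= C & forall k : nat, k%:R ^+ n <= C * a ^+ k.
Proof.
elim: n a => [|n IH] a a1.
  exists 1 => // k; rewrite expr0 mul1r; apply: exprn_ege1; exact: ltW.
pose s := Num.sqrt a.
have a0 : 0 <= a by lra.
have s2 : s ^+ 2 = a by rewrite sqr_sqrtr.
have s0 : 0 <= s by exact: sqrtr_ge0.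
have s1 : 1 < s by rewrite -(ltr_pXn2r (_ : 0 < 2)%N) ?nnegrE // expr1n s2.
have [C C0 HC] := IH s s1.
have B k : k%:R * (s - 1) <= s ^+ k.
  elim: k => [|k Ik]; first by rewrite mul0r expr0.
  rewrite exprS -natr1; have : 1 <= s ^+ k by apply: exprn_ege1; exact: ltW.
  by have := Ik; nra.
exists (C / (s - 1)); first by rewrite divr_ge0 //; lra.
move=> k; rewrite -s2 -exprM mulnC muln2 -addnn exprD exprSr.
rewrite mulrAC ler_pdivlMr; last by lra.
rewrite -mulrA [leRHS]mulrA; apply: ler_pM (HC k) (B k); first by rewrite exprn_ge0.
by rewrite mulr_ge0 //; lra.
Qed.

Definition msize (m : 'I_N -> int) : nat := (\sum_i absz (m i))%N.

Lemma partials_mon (l : seq nat) (m : 'I_N -> int) : exists c m',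
  [/\ forall u, posv u -> partials l (@mon R N m) u = c * mon m' u,
      `|c| <= (msize m + size l)%:R ^+ (size l) &
      forall i, (absz (m' i - m i) <= size l)%N].
Proof.
elim: l => [|i l [c [m' [H1 H2 H3]]]].
  by exists 1, m; split=> [u _|//|j]; rewrite ?mul1r ?normr1 ?expr0 ?subrr.
have E u : posv u -> partials (i :: l) (@mon R N m) u = pdiff i (fun w => c * mon m' w) u.
  by move=> pu; rewrite /=; apply: pdiff_ext pu.
have le0 : (msize m + size l)%:R ^+ size l <= (msize m + size (i :: l))%:R ^+ size l :> R.
  by apply: lerXn2r; rewrite ?nnegrE ?ler0n // ler_nat leq_add2l /=.
(* An index beyond [N] means the zero direction, in which every derivative is zero. *)
case: (ltnP i N) => iN; last first.
  exists 0, m'; split.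
  - move=> u pu; rewrite E // mul0r /pdiff (_ : evec N i = 0) ?derive0 //.
    apply/rowP => j; rewrite !mxE; case: eqP => // e.
    by have := ltn_ord j; rewrite e ltnNge iN.
  - by rewrite normr0 exprn_ge0.
  - by move=> j; rewrite (leq_trans (H3 j)) /=.
pose io := Ordinal iN.
exists (c * (m' io)%:~R), (fun j => m' j - (j == io)%:Z); split.
- move=> u pu; rewrite E //.
  have D := is_deriveMm (is_derive_cst c u (evec N io)) (is_derive_mon m' io pu).
  have [_] := D; rewrite /pdiff -[fun w => c * _]/(cst c \* mon m') -[i]/(io : nat) => ->.
  rewrite mul0r add0r -!mulrA; congr (_ * (_ * _)).
  have u0 : u ord0 io != 0 by rewrite gt_eqF.
  rewrite /mon [in LHS](bigD1 io) //= [in RHS](bigD1 io) //= eqxx expfzDr //.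
  rewrite exprN1 mulrA; congr (_ * _); first by rewrite mulrC.
  by apply: eq_bigr => j /negPf ->; rewrite subr0.
- rewrite normrM exprSr; apply: ler_pM => //; first exact: le_trans H2 le0.
  rewrite -intr_norm -pmulrn ler_nat /=.
  have h1 : (absz (m io) <= msize m)%N by rewrite /msize (bigD1 io) //= leq_addr.
  by have := H3 io; lia.
- by move=> j /=; have := H3 j; case: eqP => _; lia.
Qed.

Definition box (a : R) : set rv := [set u | forall i, a^-1 < u ord0 i /\ u ord0 i < a].

Lemma box_posv a u : 1 < a -> box a u -> posv u.
Proof. by move=> a1 bu i; have [h _] := bu i; apply: lt_trans h; rewrite invr_gt0; lra. Qed.

Lemma open_box a : open (box a).
Proof.
rewrite openE => u bu.
exists (fun i j => [set x : R | a^-1 < x /\ x < a]); last by move=> v pv i; exact: pv.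
move=> i j; rewrite ord1; have [h1 h2] := bu j.
have o1 : nbhs (u ord0 j) [set x : R | a^-1 < x] by apply: open_nbhs_nbhs; split; [exact: open_gt|].
have o2 : nbhs (u ord0 j) [set x : R | x < a] by apply: open_nbhs_nbhs; split; [exact: open_lt|].
exact: (filterI o1 o2).
Qed.

Lemma box1 a : 1 < a -> box a (ones N).
Proof. by move=> a1 i; rewrite mxE; split => //; rewrite invf_lt1 //; lra. Qed.

(** Whatever the signs of its exponents, a monomial on a box is bounded by its value at one of the
    corners, hence by the sum over all of them. *)
Definition corner (B : R) (e : {ffun 'I_N -> bool}) : rv := \row_i (if e i then B else B^-1).

Lemma mon_corner_sum (B : R) (m : 'I_N -> int) : 0 < B ->
  \sum_(e : {ffun 'I_N -> bool}) mon m (corner B e) = \prod_i (B ^ (m i) + (B^-1) ^ (m i)).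
Proof.
move=> B0.
have E i : B ^ (m i) + (B^-1) ^ (m i) = \sum_(b : bool) (if b then B else B^-1) ^ (m i).
  by rewrite big_bool.
under [RHS]eq_bigr do rewrite E.
rewrite bigA_distr_bigA /=; apply: eq_bigr => e _.
by apply: eq_bigr => i _; rewrite mxE.
Qed.

Lemma exprz_abs_le (a x : R) (n : int) : 1 < a -> a^-1 < x -> x < a ->
  x ^ n <= a ^+ (absz n).
Proof.
move=> a1 h1 h2; have a0 : 0 < a by lra.
have x0 : 0 < x by apply: lt_trans h1; rewrite invr_gt0.
case: n => n /=; first by apply: lerXn2r; rewrite ?nnegrE; lra.
rewrite -[x ^ _]/(x ^+ n.+1)^-1 -exprVn; apply: lerXn2r; rewrite ?nnegrE ?invr_ge0; try lra.
by rewrite -[a]invrK lef_pV2 ?posrE ?invr_gt0 // ltW.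
Qed.

(** The corners have ratio [a ^+ 2] although the points lie in [box a]: one factor [a ^+ msize m]
    bounds the monomial, the other absorbs the coefficient produced by the derivatives, which is
    polynomial in the exponents. The constant does not depend on [m]. *)
Lemma partials_mon_bound (a : R) (l : seq nat) : 1 < a -> exists2 C, 0 <= C &
  forall m u, box a u -> `|partials l (@mon R N m) u| <=
    C * \sum_(e : {ffun 'I_N -> bool}) mon m (corner (a ^+ 2) e).
Proof.
move=> a1; have a0 : 0 < a by lra.
pose n := size l.
have [C C0 HC] := @pow_le_exp n a a1.
exists (C * a ^+ n * a ^+ (N * n)); first by rewrite !mulr_ge0 //; exact/exprn_ge0/ltW.
move=> m u bu; have pu := box_posv a1 bu.
have [c [m' [H1 H2 H3]]] := partials_mon l m; rewrite H1 // normrM.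
have b1 : `|mon m' u| <= a ^+ (msize m) * a ^+ (N * n).
  rewrite ger0_norm; last by apply: prodr_ge0 => i _; apply: exprz_ge0; exact/ltW/pu.
  rewrite -exprD /mon.
  have -> : (msize m + N * n = \sum_(i < N) (absz (m i) + n))%N.
    by rewrite big_split /= sum_nat_const card_ord.
  rewrite -prodrXr; apply: ler_prod => i _.
  rewrite exprz_ge0 ?(ltW (pu i)) //=; have [h1 h2] := bu i.
  apply: le_trans (exprz_abs_le _ a1 h1 h2) _.
  by rewrite ler_weXn2l ?ltW //; have := H3 i; rewrite /n; lia.
have b2 : (msize m + n)%:R ^+ n <= C * a ^+ n * a ^+ msize m.
  by apply: le_trans (HC _) _; rewrite exprD -mulrA [_ ^+ n * _]mulrC.
apply: le_trans (ler_pM (normr_ge0 _) (normr_ge0 _) (le_trans H2 b2) b1) _.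
rewrite mon_corner_sum ?exprn_gt0 //.
have -> : C * a ^+ n * a ^+ msize m * (a ^+ msize m * a ^+ (N * n)) =
   C * a ^+ n * a ^+ (N * n) * (a ^+ 2) ^+ msize m.
  have -> : (a ^+ 2) ^+ msize m = a ^+ msize m * a ^+ msize m by rewrite -exprM mul2n -addnn exprD.
  by ring.
apply: ler_wpM2l; first by rewrite !mulr_ge0 //; exact/exprn_ge0/ltW.
rewrite /msize -prodrXr; apply: ler_prod => i _; rewrite (exprn_ge0 _ (exprn_ge0 2 (ltW a0))) /=.
have A0 : 0 < a ^+ 2 by rewrite exprn_gt0.
case: (m i) => k /=.
  by rewrite -[_ ^ Posz k]/(_ ^+ k) lerDl exprz_ge0 // invr_ge0 ltW.
rewrite -[X in _ <= _ + X]/((((a ^+ 2)^-1) ^+ k.+1)^-1) exprVn invrK lerDr.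
by rewrite exprz_ge0 // ltW.
Qed.

Lemma partials_sum U (T : Type) (s : seq T) (F : T -> rv -> R) l u : open U -> U u ->
  (forall t, smooth_on U (F t)) ->
  partials l (fun u => \sum_(t <- s) F t u) u = \sum_(t <- s) partials l (F t) u.
Proof.
move=> oU Uu sF.
have cs n c : Cn n U (cst c : rv -> R).
  elim: n c => [//|n IH] c i; split; first by move=> w _; exact: derivable_cst.
  by apply: Cn_ext oU _ (IH 0) => w _; rewrite pdiff_cst.
elim: s => [|t s IH].
  rewrite big_nil; under eq_fun do rewrite big_nil.
  have := @partialsD R N U l (cst 0) (cst 0) oU (fun n => cs n 0) (fun n => cs n 0) u Uu.
  rewrite (_ : cst 0 \+ cst 0 = cst 0 :> (rv -> R)).
    by move=> /eqP; rewrite -subr_eq0 opprD addrA subrr sub0r oppr_eq0 => /eqP.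
  by apply/funext => w; rewrite /= addr0.
have sS : smooth_on U (fun u => \sum_(t <- s) F t u).
  move=> n; elim: s {IH} => [|t' s IH].
    by apply: Cn_ext oU _ (cs n 0) => w _; rewrite big_nil.
  by apply: Cn_ext oU _ (CnD oU (sF t' n) IH) => w _; rewrite big_cons.
rewrite big_cons -IH -(partialsD l oU (sF t) sS Uu); congr (partials l _ u).
by apply/funext => w; rewrite big_cons.
Qed.

(** Because the coefficients are nonnegative, the bounds on the monomials add up to values of the
    function itself, so convergence at the corners controls all derivatives. *)
Lemma partials_pospoly_bound (a : R) (l : seq nat) : 1 < a -> exists2 C, 0 <= C &
  forall (s : seq ('I_N -> int)) u, box a u ->
   `|partials l (fun u => \sum_(m <- s) mon m u) u| <=
    C * \sum_(e : {ffun 'I_N -> bool}) \sum_(m <- s) mon m (corner (a ^+ 2) e).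
Proof.
move=> a1; have [C C0 HC] := partials_mon_bound l a1; exists C => // s u bu.
have pu := box_posv a1 bu.
rewrite (partials_sum s l (@open_posv R N) pu); last first.
  by move=> m; apply: laur_smooth; exact: laur_mon.
apply: le_trans (ler_norm_sum _ _ _) _.
rewrite exchange_big /= mulr_sumr; apply: ler_sum => m _; exact: HC.
Qed.

End TermwiseDifferentiation.

Section TermwiseDerivative.
Variables (R : realType) (N : nat).
Notation rv := 'rV[R]_N.
Implicit Types (u v w : rv).

Lemma is_derive_line (G : rv -> R) u v (s : R) (df : R) :
  is_derive (s *: v + u) v G df -> is_derive s (1 : R) (fun t : R => G (t *: v + u)) df.
Proof.
have E : (fun h : R => h^-1 *: (((fun t : R => G (t *: v + u)) \o shift s) (h *: (1 : R)) - G (s *: v + u))) =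
         (fun h : R => h^-1 *: ((G \o shift (s *: v + u)) (h *: v) - G (s *: v + u))).
  apply/funext => h /=; congr (_ *: (G _ - _)).
  by rewrite -[h *: 1]/(h * 1) mulr1 scalerDl addrA.
case=> d1 d2; apply: DeriveDef; first by rewrite /derivable E.
by rewrite -d2 /derive E.
Qed.

Lemma mvt_centered (f df : R -> R) (x d : R) :
  (forall s, `|s| < d -> is_derive s (1 : R) f (df s)) -> `|x| < d ->
  exists2 c, `|c| <= `|x| & f x - f 0 = df c * x.
Proof.
move=> H xd.
have cont a b : (forall s, a <= s -> s <= b -> `|s| < d) -> {within `[a, b], continuous f}.
  move=> ab; apply: derivable_within_continuous => s; rewrite in_itv /= => /andP[h1 h2].
  by have [] := H s (ab s h1 h2).
case: (ltrgt0P x) xd => [x0|x0|->] xd.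
- have [||c] := @MVT_segment _ f df 0 x (ltW x0).
  + move=> s; rewrite in_itv /= => /andP[h1 h2]; apply: H.
    by rewrite gtr0_norm //; lra.
  + by apply: cont => s h1 h2; rewrite ger0_norm //; lra.
  rewrite in_itv /= => /andP[h1 h2] e; exists c; last by rewrite e subr0.
  by rewrite ger0_norm //; lra.
- have [||c] := @MVT_segment _ f df x 0 (ltW x0).
  + move=> s; rewrite in_itv /= => /andP[h1 h2]; apply: H.
    by rewrite ltr0_norm //; lra.
  + by apply: cont => s h1 h2; rewrite ler0_norm //; lra.
  rewrite in_itv /= => /andP[h1 h2] e; exists c; last by rewrite -opprB e; ring.
  by rewrite ler0_norm //; lra.
- by exists 0; rewrite ?normr0 // subrr mulr0.
Qed.

Lemma laur_taylor (G : rv -> R) i u (d K h : R) : laur G ->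
  (forall s, `|s| < d -> posv (s *: evec N i + u)) ->
  (forall s, `|s| < d -> `|pdiff i (pdiff i G) (s *: evec N i + u)| <= K) ->
  `|h| < d ->
  `|G (h *: evec N i + u) - G u - h * pdiff i G u| <= K * h ^+ 2.
Proof.
move=> lG pos bnd hd; set e := evec N i.
have D1 s : `|s| < d -> is_derive s (1 : R) (fun t : R => G (t *: e + u)) (pdiff i G (s *: e + u)).
  by move=> sd; apply: is_derive_line; apply: laur_is_derive => //; exact: pos.
have D2 s : `|s| < d -> is_derive s (1 : R) (fun t : R => pdiff i G (t *: e + u))
    (pdiff i (pdiff i G) (s *: e + u)).
  move=> sd; apply: is_derive_line; apply: laur_is_derive; [exact: laur_pdiff|exact: pos].
have [c ch] := mvt_centered D1 hd; rewrite scale0r add0r => ->.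
have [c' cc] := mvt_centered D2 (le_lt_trans ch hd); rewrite scale0r add0r => e2.
rewrite [h * _]mulrC -mulrBl e2 !normrM expr2 -mulrA.
have K0 := bnd c' (le_lt_trans cc (le_lt_trans ch hd)).
apply: ler_pM => //.
have -> : h * h = `|h| * `|h| by rewrite -!expr2 real_normK // num_real.
exact: ler_wpM2r.
Qed.

Section Series.
Variables (T : choiceType) (c M : T -> R) (f : T -> rv -> R) (a : R).
Hypothesis a1 : 1 < a.
Hypothesis lf : forall t, laur (f t).
Hypothesis c0 : forall t, 0 <= c t.
Hypothesis M0 : forall t, 0 <= M t.
Hypothesis sM : asum (fun t => c t * M t).
Hypothesis bnd : forall l : seq nat, exists2 C, 0 <= C &
  forall t u, box a u -> `|partials l (f t) u| <= C * M t.

Lemma laur_partials l (g : rv -> R) : laur g -> laur (partials l g).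
Proof. by move=> lg; elim: l => [//|i l IH] /=; exact: laur_pdiff. Qed.

Lemma asum_partials l u : box a u -> asum (fun t => c t * partials l (f t) u).
Proof.
move=> bu; have [C C0 HC] := bnd l.
apply: asum_le (asumZ C sM) => t.
rewrite normrM (ger0_norm (c0 t)) [leRHS]ger0_norm ?mulr_ge0 // mulrCA.
by apply: ler_wpM2l => //; exact: HC.
Qed.

Lemma box_line i u : box a u -> exists2 d, 0 < d &
  forall s, `|s| < d -> box a (s *: evec N i + u).
Proof.
move=> bu.
have H : \forall s \near (0 : R), forall j : 'I_N, a^-1 < (s *: evec N i + u) ord0 j /\ (s *: evec N i + u) ord0 j < a.
  refine (@filter_forall _ _ (fun (j : 'I_N) (s : R) => a^-1 < (s *: evec N i + u) ord0 j /\
    (s *: evec N i + u) ord0 j < a) _ (nbhs_filter (0 : R)) _) => j.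
  have [h1 h2] := bu j.
  have d0 : 0 < Num.min (u ord0 j - a^-1) (a - u ord0 j) by rewrite lt_min !subr_gt0 h1.
  exists (Num.min (u ord0 j - a^-1) (a - u ord0 j)) => //= s.
  rewrite /ball_ /= sub0r normrN !mxE lt_min => /andP[s1 s2].
  move: s1 s2; rewrite !ltr_norml => /andP[s1 s1'] /andP[s2 s2'].
  by case: eqP => _; rewrite ?mulr1 ?mulr0; split; lra.
case: H => d /= d0 H; exists d => // s sd; apply: H.
by rewrite /ball_ /= sub0r normrN.
Qed.

(** Each term has a Taylor remainder at most [C * M t * h ^+ 2]. Summed against [c], these give a
    quadratic remainder for the whole series. *)
Lemma is_derive_series l i u : box a u ->
  is_derive u (evec N i) (fun w => rsum (fun t => c t * partials l (f t) w))
    (rsum (fun t => c t * partials (i :: l) (f t) u)).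
Proof.
move=> bu; have [d d0 Hd] := box_line i bu.
have [C C0 HC] := bnd (i :: i :: l).
pose F w := rsum (fun t => c t * partials l (f t) w).
pose L := rsum (fun t => c t * partials (i :: l) (f t) u).
pose S := rsum (fun t => c t * M t).
have S0 : 0 <= S by apply: rsum_ge0 => // t; rewrite mulr_ge0.
have key h : `|h| < d -> `|F (h *: evec N i + u) - F u - h * L| <= C * S * h ^+ 2.
  move=> hd; have bh := Hd h hd.
  rewrite /F /L -rsumZ; last exact: asum_partials.
  rewrite -rsumB; try exact: asum_partials.
  have s1 : asum (fun t => c t * partials l (f t) (h *: evec N i + u) - c t * partials l (f t) u).
    by apply: asumD; [|apply: asumN]; exact: asum_partials.
  have s2 : asum (fun t => h * (c t * partials (i :: l) (f t) u)).
    by apply: asumZ; exact: asum_partials.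
  rewrite -rsumB //; apply: le_trans (ler_rsum_abs _) _; first by apply: asumD => //; exact: asumN.
  have s3 : asum (fun t => C * h ^+ 2 * (c t * M t)) by exact: asumZ.
  rewrite [leRHS](_ : _ = rsum (fun t => C * h ^+ 2 * (c t * M t))); last first.
    by rewrite rsumZ // mulrAC.
  apply: rsum_le => // [|t].
    by apply: asum_abs; apply: asumD => //; exact: asumN.
  rewrite [h * _]mulrCA -mulrBr -mulrBr normrM (ger0_norm (c0 t)) mulrCA.
  apply: ler_wpM2l => //.
  apply: le_trans (@laur_taylor (partials l (f t)) i u d (C * M t) h _ _ _ hd) _.
  - exact: laur_partials.
  - by move=> s sd; apply: (box_posv a1); exact: Hd.
  - by move=> s sd; apply: HC; exact: Hd.
  - by rewrite mulrAC.
have E : (fun h : R => h^-1 *: (F (h *: evec N i + u) - F u)) @ (0 : R)^' --> L.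
  apply/cvgrPdist_le => eps e0; near=> h.
  have h0 : h != 0 by near: h; exact: nbhs_dnbhs_neq.
  have hd : `|h| < d by near: h; exact: dnbhs0_lt.
  have hp : 0 < `|h| by rewrite normr_gt0.
  have -> : L - h^-1 *: (F (h *: evec N i + u) - F u) =
     - (h^-1 * (F (h *: evec N i + u) - F u - h * L)).
    by rewrite -[_ *: _]/(_ * _); field.
  rewrite normrN normrM normfV mulrC ler_pdivrMr //; apply: le_trans (key h hd) _.
  have -> : h ^+ 2 = `|h| * `|h| by rewrite -expr2 real_normK // num_real.
  rewrite mulrA; apply: ler_wpM2r => //.
  have : `|h| < eps / (C * S + 1).
    by near: h; apply: dnbhs0_lt; rewrite divr_gt0 // ltr_wpDl // mulr_ge0.
  have CS : 0 <= C * S by rewrite mulr_ge0.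
  rewrite ltr_pdivlMr; last by rewrite ltr_wpDl.
  by move: (C * S) CS => x x0; nra.
by apply: DeriveDef; [apply/cvg_ex; exists L|apply: cvg_lim].
Unshelve. all: by end_near. Qed.

Lemma partials_series l u : box a u ->
  partials l (fun w => rsum (fun t => c t * f t w)) u =
  rsum (fun t => c t * partials l (f t) u).
Proof.
elim: l u => [//|i l IH] u bu.
have -> : partials (i :: l) (fun w => rsum (fun t => c t * f t w)) u =
   pdiff i (fun w => rsum (fun t => c t * partials l (f t) w)) u.
  rewrite /=; exact: (pdiff_open_ext i (@open_box R N a) IH).
by have [_ <-] := is_derive_series l i bu.
Qed.

Lemma smooth_series : smooth_on (box a) (fun w => rsum (fun t => c t * f t w)).
Proof.
have H n l : Cn n (box a) (fun w => rsum (fun t => c t * partials l (f t) w)).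
  elim: n l => [//|n IH] l i; split.
    by move=> u bu; have [] := is_derive_series l i bu.
  apply: Cn_ext (@open_box R N a) _ (IH (i :: l)) => u bu.
  by have [_ <-] := is_derive_series l i bu.
by move=> n; exact: (H n [::]).
Qed.

End Series.
End TermwiseDerivative.

(** * The Schur generating function *)

Section SchurData.
Variables (R : realType) (N : nat).
Notation rv := 'rV[R]_N.

Record schur_data (lam : sig_t N) := SchurData {
  sd_exps : seq ('I_N -> int);
  sd_g : nat -> 'I_N -> rv -> R;
  sd_D : nat -> 'I_N -> 'I_N -> rv -> R }.

Definition sd_chi lam (d : schur_data lam) (u : rv) : R := \sum_(m <- sd_exps d) mon m u.

Definition schur_data_spec lam (d : schur_data lam) :=
  [/\ sd_exps d <> [::],
      forall u, posv u -> schur lam u = sd_chi d u,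
      forall s u, posv u -> sd_chi d (permv s u) = sd_chi d u,
      [/\ forall i, sd_g d 0%N i = sd_chi d, forall k i, laur (sd_g d k i) &
          forall k, dunkl_step (sd_g d k) (sd_D d k) (sd_g d k.+1)] &
      forall k u, posv u -> \sum_i sd_g d k i u =
        dunkl_eig R (sigl lam) k * sd_chi d u].

Lemma schur_data_exists lam : exists d : schur_data lam, schur_data_spec d.
Proof.
have [F [s [s0 Fs]] eF] := altf_pospoly R (sigl_dec lam).
pose chi (u : rv) := \sum_(m <- s) mon m u.
have lchi : laur chi by apply: laur_sum => m; exact: laur_mon.
have echi u : posv u -> altf (sigl lam) u = vandermonde u * chi u.
  by move=> pu; rewrite eF // Fs.
have sym := chi_sym lchi echi.
have [g [D [g0 lg gS]]] := dunkl_sequence lchi sym.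
exists (@SchurData lam s g D); split => //.
- by move=> u pu; exact: schurE.
- move=> k u pu; exact: (dunkl_eigen (sigl_dec lam) echi lchi g0 lg gS k pu).
Qed.

End SchurData.

Section LineChain.
Variables (R : realType) (N : nat).
Notation rv := 'rV[R]_N.

Lemma is_derive_line0 (G : rv -> R) u v (df : R) :
  is_derive (0 : R) (1 : R) (fun t : R => G (t *: v + u)) df -> is_derive u v G df.
Proof.
have E : (fun h : R => h^-1 *: (((fun t : R => G (t *: v + u)) \o shift 0) (h *: (1 : R)) - G (0 *: v + u))) =
         (fun h : R => h^-1 *: ((G \o shift u) (h *: v) - G u)).
  apply/funext => h /=; rewrite scale0r add0r; congr (_ *: (G _ - _)).
  by rewrite -[h *: 1]/(h * 1) mulr1 addr0.
case; rewrite /derivable /derive E => d1 d2; exact: DeriveDef.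
Qed.

Lemma pdiff_ln (G : rv -> R) i u : 0 < G u -> derivable G u (evec N i) ->
  pdiff i (fun w => ln (G w)) u = pdiff i G u / G u.
Proof.
move=> G0 /derivableP dG.
have dG' : is_derive (0 *: evec N i + u) (evec N i) G (pdiff i G u) by rewrite scale0r add0r.
have d1 := is_derive_line dG'.
have G0' : 0 < (fun t : R => G (t *: evec N i + u)) 0 by rewrite scale0r add0r.
have d2 := @is_derive1_comp _ (@ln R) (fun t : R => G (t *: evec N i + u)) 0 _ _
  (is_derive1_ln G0') d1.
have [_] := is_derive_line0 (G := fun w => ln (G w)) d2.
by rewrite /pdiff => ->; rewrite scale0r add0r mulrC.
Qed.

End LineChain.

Section Expectation.
Variables (R : realType) (N : nat) (rho : sig_t N -> R).
Notation rv := 'rV[R]_N.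
Notation warr := (warr R 'I_N).
Hypothesis rhoP : is_prob rho.
Hypothesis rhoU : sgf_unif_conv rho.
Variable sd : forall lam : sig_t N, schur_data R lam.
Hypothesis sdP : forall lam, schur_data_spec (sd lam).

Let chi lam := sd_chi (sd lam).
Let g lam := sd_g (sd lam).
Let D lam := sd_D (sd lam).
Let wt lam := rho lam / chi lam (ones N).

Let lchi lam : laur (chi lam).
Proof. by apply: laur_sum => m; exact: laur_mon. Qed.

Lemma mon_gt0 (m : 'I_N -> int) (u : rv) : posv u -> 0 < mon m u.
Proof. by move=> pu; apply: prodr_gt0 => i _; apply: exprz_gt0. Qed.

Let chi_gt0 lam u : posv u -> 0 < chi lam u.
Proof.
move=> pu; have [s0 _ _ _ _] := sdP lam; rewrite /chi /sd_chi.
case: (sd_exps _) s0 => [//|m s] _; rewrite big_cons ltr_pwDl ?mon_gt0 //.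
by apply: sumr_ge0 => m' _; exact/ltW/mon_gt0.
Qed.

Let wt_ge0 lam : 0 <= wt lam.
Proof.
by rewrite /wt divr_ge0 //; [case: rhoP => h _; exact: h|apply/ltW/chi_gt0/posv1].
Qed.

Let sgf_termE u lam : posv u -> sgf_term rho u lam = wt lam * chi lam u.
Proof.
move=> pu; have [_ e _ _ _] := sdP lam; rewrite /sgf_term !e //; last exact: posv1.
by rewrite mulrAC.
Qed.

Let sgfE u : posv u -> sgf rho u = rsum (fun lam => wt lam * chi lam u).
Proof. by move=> pu; apply: eq_rsum => lam; exact: sgf_termE. Qed.

(** For [a] close to 1 the corners lie in the neighbourhood of uniform convergence; the later
    majorants use absolute convergence at these finitely many points. *)
Lemma sgf_corner : exists2 a : R, 1 < a &
  forall e, asum (fun lam => wt lam * chi lam (corner (a ^+ 2) e)).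
Proof.
have [U [P HP PU] HU] := rhoU.
have [d d0 Hd] : exists2 d : R, 0 < d & forall u : rv, (forall j, `|1 - u ord0 j| < d) -> U u.
  have : \forall e \near (0 : R)^'+, forall j : 'I_N, forall x, `|1 - x| < e -> P ord0 j x.
    apply: filter_forall => j; have := HP ord0 j; rewrite mxE => -[e /= e0 He].
    near=> d => x hx; apply: He; rewrite /ball_ /=; apply: lt_le_trans hx _.
    by near: d; exact: nbhs_right_le.
  move=> H.
  have : \forall e \near (0 : R)^'+, 0 < e by exact: nbhs_right_gt.
  move=> /(filterI H) /filter_ex [d [Hd d0]].
  by exists d => // u hu; apply: PU => i j; rewrite ord1; apply: Hd.
pose d' := Num.min d 1; have d'0 : 0 < d' by rewrite lt_min d0 ltr01.
have d'1 : d' <= 1 by rewrite ge_min lexx orbT.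
have d'd : d' <= d by rewrite ge_min lexx.
(* Chosen so that both [a ^+ 2] and its inverse are within [d'] of 1. *)
pose a := 1 + d' / 4; exists a; first by rewrite /a; lra.
have a2 : a ^+ 2 < 1 + d' by rewrite /a; nra.
have a21 : 1 < a ^+ 2 by rewrite /a; nra.
have ai : 1 - d' < (a ^+ 2)^-1.
  have A0 : 0 < a ^+ 2 by lra.
  rewrite -(ltr_pM2r A0) mulVf ?gt_eqF //; move: a2 a21; move: (a ^+ 2) => A; nra.
move=> e.
have pc : posv (corner (a ^+ 2) e).
  by move=> j; rewrite mxE; case: ifP => _; rewrite ?invr_gt0; lra.
have Uc : U (corner (a ^+ 2) e).
  apply: Hd => j; rewrite mxE; apply: lt_le_trans d'd.
  have i1 : (a ^+ 2)^-1 < 1 by rewrite invf_lt1; lra.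
  by case: ifP => _; rewrite ltr_norml; apply/andP; split; lra.
have [F finF HF] := HU 1 ltr01.
have H1 := HF _ Uc.
have : asum (sgf_term rho (corner (a ^+ 2) e)).
  rewrite /asum /nsum (esumID F) ?setTI; last by move=> x _; rewrite lee_fin.
  rewrite lte_add_pinfty //; last by apply: le_lt_trans H1 _; rewrite ltry.
  rewrite (esum_fset finF) => [|x _]; last by rewrite lee_fin.
  by rewrite fsumEFin // ltry.
by apply: asum_le => lam; rewrite sgf_termE.
Unshelve. all: by end_near. Qed.

Section WithRadius.
Variable a : R.
Hypothesis a1 : 1 < a.
Hypothesis aS : forall e, asum (fun lam => wt lam * chi lam (corner (a ^+ 2) e)).

Let M lam := \sum_(e : {ffun 'I_N -> bool}) chi lam (corner (a ^+ 2) e).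

Let M0 lam : 0 <= M lam.
Proof.
apply: sumr_ge0 => e _; apply/ltW/chi_gt0 => j; rewrite mxE.
by have := a1; case: ifP => _ h; rewrite ?invr_gt0 exprn_gt0 //; lra.
Qed.

Let sM : asum (fun lam => wt lam * M lam).
Proof. by apply: asum_le (asum_sum _ aS) => lam; rewrite mulr_sumr. Qed.

Let bnd (l : seq nat) : exists2 C, 0 <= C &
  forall lam u, box a u -> `|partials l (chi lam) u| <= C * M lam.
Proof.
have [C C0 HC] := @partials_pospoly_bound R N a l a1; exists C => // lam u bu.
exact: HC.
Qed.

Lemma sgf_smooth : smooth_on (box a) (sgf rho).
Proof.
move=> n; apply: Cn_ext (@open_box R N a) _
  (smooth_series a1 lchi wt_ge0 M0 sM bnd n) => u bu.
by rewrite sgfE //; exact: box_posv bu.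
Qed.

(** The additional factor [cf] allows averages weighted by a moment, which are needed for mixed
    second moments. *)
Definition Av (cf : sig_t N -> R) (F : sig_t N -> warr) : warr :=
  fun w => rsum (fun lam => wt lam * cf lam * F lam w).
Definition Avok (cf : sig_t N -> R) (F : sig_t N -> warr) :=
  forall w, asum (fun lam => wt lam * cf lam * F lam w).

Lemma Avok_chi : Avok (fun=> 1) (fun lam => jet (chi lam)).
Proof.
move=> w.
have := asum_partials wt_ge0 M0 sM bnd (map val (rev w)) (@box1 R N a a1).
by apply: asum_le => lam; rewrite mulr1.
Qed.

Lemma jet_sgf : jet (sgf rho) = Av (fun=> 1) (fun lam => jet (chi lam)).
Proof.
apply/funext => w; rewrite /Av.
rewrite (jet_ext (@open_box R N a) (@box1 R N a a1)
  (fun u bu => sgfE (box_posv a1 bu))).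
rewrite /jet (partials_series a1 lchi wt_ge0 M0 sM bnd _ (@box1 R N a a1)).
by apply: eq_rsum => lam; rewrite mulr1.
Qed.

Lemma sgf_gt0 u : box a u -> 0 < sgf rho u.
Proof.
move=> bu; have pu := box_posv a1 bu; rewrite sgfE //.
have sF : asum (fun lam => wt lam * chi lam u).
  by have := asum_partials wt_ge0 M0 sM bnd [::] bu.
have F0 lam : 0 <= wt lam * chi lam u by rewrite mulr_ge0 //; exact/ltW/chi_gt0.
have [lam0 r0] : exists lam, 0 < rho lam.
  apply: contrapT => H; case: rhoP => r0 /eqP.
  rewrite esum1 => [|lam _]; first by rewrite eqe eq_sym oner_eq0.
  apply/eqP; rewrite eqe eq_le r0 andbT leNgt; apply/negP => h.
  by apply: H; exists lam.
have w0 : 0 < wt lam0 * chi lam0 u.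
  rewrite mulr_gt0 ?chi_gt0 // /wt divr_gt0 // chi_gt0 //; exact: posv1.
rewrite rsum_ge0E //; apply: (lt_le_trans w0).
rewrite -lee_fin fineK; last exact: nsum_fin.
apply: esum_ge; exists [set lam0]; last by rewrite fsbig_set1.
by split; [exact: finite_set1|].
Qed.

Lemma sgf1 : sgf rho (ones N) = 1.
Proof.
rewrite sgfE; last exact: posv1.
have e lam : wt lam * chi lam (ones N) = rho lam.
  by rewrite /wt divfK // gt_eqF // chi_gt0 //; exact: posv1.
rewrite (eq_rsum e); case: rhoP => r0 r1.
have sr : asum rho.
  by rewrite /asum /nsum (eq_esum (b := fun lam => (rho lam)%:E)) ?r1 ?ltry // => lam _; rewrite ger0_norm.
by rewrite rsum_ge0E // /nsum r1.
Qed.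

Lemma rsum_rho (X : sig_t N -> R) :
  (forall lam, wt lam * X lam * chi lam (ones N) = rho lam * X lam).
Proof.
move=> lam; rewrite mulrAC /wt divfK // gt_eqF // chi_gt0 //; exact: posv1.
Qed.

Lemma Av_wd i cf F : wd i (Av cf F) = Av cf (fun lam => wd i (F lam)).
Proof. by []. Qed.

Lemma AvD cf F G : Avok cf F -> Avok cf G ->
  Av cf (fun lam => F lam + G lam) = Av cf F + Av cf G.
Proof.
move=> oF oG; apply/funext => w; rewrite warrD /Av -rsumD //.
by apply: eq_rsum => lam; rewrite warrD mulrDr.
Qed.

Lemma AvokD cf F G : Avok cf F -> Avok cf G -> Avok cf (fun lam => F lam + G lam).
Proof.
by move=> oF oG w; apply: asum_le (asumD (oF w) (oG w)) => lam; rewrite warrD mulrDr.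
Qed.

Lemma AvB cf F G : Avok cf F -> Avok cf G ->
  Av cf (fun lam => F lam - G lam) = Av cf F - Av cf G.
Proof.
move=> oF oG; apply/funext => w; rewrite warrB /Av -rsumB //.
by apply: eq_rsum => lam; rewrite warrB mulrBr.
Qed.

Lemma Avok_wd i cf F : Avok cf F -> Avok cf (fun lam => wd i (F lam)).
Proof. by move=> oF w; exact: (oF (i :: w)). Qed.

Lemma Avok_wX i cf F : (forall lam, wcomm (F lam)) -> Avok cf F ->
  Avok cf (fun lam => wX R i * F lam).
Proof.
move=> cF oF w; apply: asum_le (asumZ (count_mem i w)%:R (oF (rem i w))) => lam.
by rewrite wXM // mulrCA.
Qed.

Lemma Av_wX i cf F : (forall lam, wcomm (F lam)) -> Avok cf F ->
  Av cf (fun lam => wX R i * F lam) = wX R i * Av cf F.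
Proof.
move=> cF oF; apply/funext => w.
have cA : wcomm (Av cf F) by move=> x j k y; apply: eq_rsum => lam; rewrite cF.
rewrite wXM // /Av -rsumZ //; apply: eq_rsum => lam.
by rewrite wXM // mulrCA.
Qed.

Lemma wcomm_Av cf F : (forall lam, wcomm (F lam)) -> wcomm (Av cf F).
Proof. by move=> cF x j k y; apply: eq_rsum => lam; rewrite cF. Qed.

Lemma Avok_sum cf (J : Type) (r : seq J) (P : pred J) (F : J -> sig_t N -> warr) :
  (forall j, P j -> Avok cf (F j)) -> Avok cf (fun lam => \sum_(j <- r | P j) F j lam).
Proof.
move=> H; elim: r => [|j r IH].
  by move=> w; apply: asum_le (@asum0 R _) => lam; rewrite big_nil warr0 mulr0.
case: (boolP (P j)) => Pj.
  by move=> w; apply: asum_le (AvokD (H j Pj) IH w) => lam; rewrite big_cons Pj.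
by move=> w; apply: asum_le (IH w) => lam; rewrite big_cons (negPf Pj).
Qed.

Lemma Av_sum cf (J : Type) (r : seq J) (P : pred J) (F : J -> sig_t N -> warr) :
  (forall j, P j -> Avok cf (F j)) ->
  Av cf (fun lam => \sum_(j <- r | P j) F j lam) = \sum_(j <- r | P j) Av cf (F j).
Proof.
move=> H; elim: r => [|j r IH].
  rewrite big_nil; apply/funext => w.
  transitivity (rsum (fun _ : sig_t N => 0 : R)); last exact: rsum0.
  by apply: eq_rsum => lam; rewrite big_nil warr0 mulr0.
rewrite big_cons -IH; case: (boolP (P j)) => Pj.
  rewrite -AvD //; [|exact: H|exact: Avok_sum].
  by congr Av; apply/funext => lam; rewrite big_cons Pj.
by congr Av; apply/funext => lam; rewrite big_cons (negPf Pj).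
Qed.

Let lg lam k i : laur (g lam k i). Proof. by have [_ _ _ [_ h _] _] := sdP lam; exact: h. Qed.
Let lD lam k i j : laur (D lam k i j).
Proof. by have [_ _ _ [_ _ /(_ k) [h _ _]] _] := sdP lam; exact: h. Qed.

Let jD lam k i j : i != j ->
  (wX R i - wX R j) * jet (D lam k i j) = jet (g lam k i) - jet (g lam k j).
Proof.
move=> ij; have [_ _ _ [_ _ /(_ k) [_ h _]] _] := sdP lam.
have co (m : 'I_N) := laur_coord R m.
have lN (f : rv -> R) : laur f -> laur (cst (-1) \* f).
  by move=> lf; apply: laurM => //; exact: laur_cst.
have -> : wX R i - wX R j = jet ((fun u : rv => u ord0 i) \+ (cst (-1) \* (fun u : rv => u ord0 j))).
  rewrite (ljetD (co i) (lN _ (co j))) (ljetM (laur_cst _ _) (co j)) jet_cst !jet_coord.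
  by rewrite scaleN1r mulN1r opprD addrACA subrr add0r.
have -> : jet (g lam k i) - jet (g lam k j) = jet (g lam k i \+ (cst (-1) \* g lam k j)).
  by rewrite (ljetD (lg _ _ _) (lN _ (lg _ _ _))) (ljetM (laur_cst _ _) (lg _ _ _)) jet_cst scaleN1r mulN1r.
rewrite -ljetM //; last by apply: laurD => //; exact: lN.
by apply: ljet_ext => u pu; rewrite /= !mulN1r h.
Qed.

Let jg lam k i : jet (g lam k.+1 i) = (1 + wX R i) * wd i (jet (g lam k i)) +
  \sum_(j | j != i) (1 + wX R i) * jet (D lam k i j).
Proof.
have [_ _ _ [_ _ /(_ k) [_ _ h]] _] := sdP lam.
have co (m : 'I_N) := laur_coord R m.
rewrite (ljet_ext (h i)) wd_jet -jet_coord.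
have l1 : laur ((fun u : rv => u ord0 i) \* pdiff i (g lam k i)).
  by apply: laurM => //; exact: laur_pdiff.
have l2 j : laur ((fun u : rv => u ord0 i) \* D lam k i j) by exact: laurM.
have := ljetD l1 (laur_sum (index_enum 'I_N) (fun j => j != i) l2) => /= ->.
rewrite (ljetM (co i) (laur_pdiff i (lg lam k i))) (jet_sum (index_enum 'I_N) (fun j => j != i) l2).
by congr (_ + _); apply: eq_bigr => j _; rewrite (ljetM (co i) (lD lam k i j)).
Qed.

Let cjD lam k i j : wcomm (jet (D lam k i j)). Proof. exact: wcomm_jet. Qed.
Let cjg lam k i : wcomm (jet (g lam k i)). Proof. exact: wcomm_jet. Qed.

(** By [wdiv_coef] each derivative of the quotient is a finite combination of derivatives of the two
    vectors; the induction is on the number of letters [j]. *)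
Let Avok_D cf k i j : i != j -> Avok cf (fun lam => jet (g lam k i)) ->
  Avok cf (fun lam => jet (g lam k j)) -> Avok cf (fun lam => jet (D lam k i j)).
Proof.
move=> ij oi oj w; have [n] := ubnP (count_mem j w).
elim: n w => [//|n IH] w hw.
have coef lam := wdiv_coef w ij (cjD lam k i j) (jD lam k ij).
have n0 : (count_mem i w).+1%:R != 0 :> R by rewrite pnatr_eq0.
have e lam : jet (D lam k i j) w = (count_mem i w).+1%:R^-1 *
   ((jet (g lam k i) (i :: w) - jet (g lam k j) (i :: w)) +
    (count_mem j w)%:R * jet (D lam k i j) (i :: rem j w)).
  by rewrite -warrB -coef mulKf.
case: (posnP (count_mem j w)) => cj.
  apply: asum_le (asumZ (count_mem i w).+1%:R^-1 (asumD (oi (i :: w)) (asumN (oj (i :: w))))) => lam.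
  by rewrite e cj mul0r addr0 -mulrBr [X in _ <= `|X|]mulrCA.
have s3 : asum (fun lam => wt lam * cf lam * jet (D lam k i j) (i :: rem j w)).
  apply: IH; move: hw; rewrite /= (negPf ij) add0n.
  have jw : j \in w by rewrite -has_pred1 has_count.
  by have /seq.permP/(_ (pred1 j)) := perm_to_rem jw; rewrite /= eqxx => ->; rewrite ltnS.
apply: asum_le (asumZ (count_mem i w).+1%:R^-1
  (asumD (asumD (oi (i :: w)) (asumN (oj (i :: w)))) (asumZ (count_mem j w)%:R s3))) => lam.
rewrite e [X in X <= _](_ : _ = `|(count_mem i w).+1%:R^-1 *
  ((wt lam * cf lam * jet (g lam k i) (i :: w) - wt lam * cf lam * jet (g lam k j) (i :: w)) +
   (count_mem j w)%:R * (wt lam * cf lam * jet (D lam k i j) (i :: rem j w)))|) //.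
by congr `|_|; rewrite -mulrBr; ring.
Qed.

Lemma Avok_g cf k i : Avok cf (fun lam => jet (chi lam)) ->
  Avok cf (fun lam => jet (g lam k i)).
Proof.
move=> oc; elim: k i => [|k IH] i.
  move=> w; apply: asum_le (oc w) => lam.
  by have [_ _ _ [h _ _] _] := sdP lam; rewrite /g h.
have oX (F : sig_t N -> warr) : (forall lam, wcomm (F lam)) -> Avok cf F ->
    Avok cf (fun lam => (1 + wX R i) * F lam).
  move=> cF oF w; apply: asum_le (AvokD oF (Avok_wX i cF oF) w) => lam.
  by rewrite mulrDl mul1r.
have o1 : Avok cf (fun lam => (1 + wX R i) * wd i (jet (g lam k i))).
  by apply: oX; [move=> lam; exact: wcomm_wd|exact: Avok_wd].
have o2 : Avok cf (fun lam => \sum_(j | j != i) (1 + wX R i) * jet (D lam k i j)).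
  by apply: Avok_sum => j ji; apply: oX => //; apply: Avok_D; rewrite // eq_sym.
by move=> w; apply: asum_le (AvokD o1 o2 w) => lam; rewrite jg.
Qed.

Lemma Av_g0 cf i : Av cf (fun lam => jet (g lam 0 i)) = Av cf (fun lam => jet (chi lam)).
Proof.
by congr Av; apply/funext => lam; have [_ _ _ [h _ _] _] := sdP lam; rewrite /g h.
Qed.

(** The recursion is linear with coefficients independent of the signature, so it passes to
    averages. *)
Lemma Av_gS cf k i : Avok cf (fun lam => jet (chi lam)) ->
  Av cf (fun lam => jet (g lam k.+1 i)) =
  (1 + wX R i) * wd i (Av cf (fun lam => jet (g lam k i))) +
  \sum_(j | j != i) (1 + wX R i) * Av cf (fun lam => jet (D lam k i j)).
Proof.
move=> oc; have og l j := @Avok_g cf l j oc.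
have oX (F : sig_t N -> warr) : (forall lam, wcomm (F lam)) -> Avok cf F ->
    Avok cf (fun lam => (1 + wX R i) * F lam).
  move=> cF oF w; apply: asum_le (AvokD oF (Avok_wX i cF oF) w) => lam.
  by rewrite mulrDl mul1r.
have AX (F : sig_t N -> warr) : (forall lam, wcomm (F lam)) -> Avok cf F ->
    Av cf (fun lam => (1 + wX R i) * F lam) = (1 + wX R i) * Av cf F.
  move=> cF oF; rewrite mulrDl mul1r -Av_wX // -AvD //; last exact: Avok_wX.
  by congr Av; apply/funext => lam; rewrite mulrDl mul1r.
have cwd lam : wcomm (wd i (jet (g lam k i))) by exact: wcomm_wd.
have o1 : Avok cf (fun lam => (1 + wX R i) * wd i (jet (g lam k i))).
  by apply: oX => //; exact: Avok_wd.
have oD j : j != i -> Avok cf (fun lam => jet (D lam k i j)).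
  by move=> ji; apply: Avok_D; rewrite // eq_sym.
have o2 : Avok cf (fun lam => \sum_(j | j != i) (1 + wX R i) * jet (D lam k i j)).
  by apply: Avok_sum => j ji; apply: oX => //; exact: oD.
transitivity (Av cf (fun lam => (1 + wX R i) * wd i (jet (g lam k i)) +
  \sum_(j | j != i) (1 + wX R i) * jet (D lam k i j))).
  by congr Av; apply/funext => lam; rewrite jg.
rewrite AvD // Av_sum => [|j ji]; last by apply: oX => //; exact: oD.
rewrite AX //; last exact: Avok_wd.
rewrite -Av_wd; congr (_ + _); apply: eq_bigr => j ji.
by rewrite AX //; exact: oD.
Qed.

Lemma Av_D cf k i j : i != j -> Avok cf (fun lam => jet (chi lam)) ->
  (wX R i - wX R j) * Av cf (fun lam => jet (D lam k i j)) =
  Av cf (fun lam => jet (g lam k i)) - Av cf (fun lam => jet (g lam k j)).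
Proof.
move=> ij oc; have og l m := @Avok_g cf l m oc.
have oD := Avok_D ij (og k i) (og k j).
rewrite -AvB // mulrBl -!Av_wX // -AvB; [|exact: Avok_wX|exact: Avok_wX].
by congr Av; apply/funext => lam; rewrite -mulrBl jD.
Qed.

Lemma Av_eig cf k : Avok cf (fun lam => jet (chi lam)) ->
  \sum_i Av cf (fun lam => jet (g lam k i)) =
  Av (fun lam => cf lam * dunkl_eig R (sigl lam) k) (fun lam => jet (chi lam)).
Proof.
move=> oc; rewrite -Av_sum => [|j _]; last exact: Avok_g.
apply/funext => w; apply: eq_rsum => lam; rewrite -jet_sum //.
have [_ _ _ _ h] := sdP lam.
rewrite (ljet_ext (h k)) (jetZ (dunkl_eig R (sigl lam) k) (lchi lam)) warrZ.
by rewrite !mulrA.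
Qed.

Lemma Avok_eig cf k : Avok cf (fun lam => jet (chi lam)) ->
  Avok (fun lam => cf lam * dunkl_eig R (sigl lam) k) (fun lam => jet (chi lam)).
Proof.
move=> oc w.
apply: asum_le (Avok_sum (index_enum 'I_N) (P := xpredT) (fun i _ => @Avok_g cf k i oc) w) => lam.
rewrite -jet_sum //; have [_ _ _ _ h] := sdP lam.
rewrite (ljet_ext (h k)) (jetZ (dunkl_eig R (sigl lam) k) (lchi lam)) warrZ.
by rewrite !mulrA.
Qed.

End WithRadius.
End Expectation.

(** * The averaged recursion *)

Lemma pp_atomE (R : realType) N (lam : sig_t N) (i : 'I_N) : pp_atom R lam i = (sigl lam i)%:~R / N%:R.
Proof.
rewrite /pp_atom /sigl intrD -pmulrn; have -> : (N - 1 - i = N - i.+1)%N by rewrite -subnDA add1n.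
by rewrite natrB ?ltn_ord // addrA.
Qed.

Lemma pplE (R : realType) N (lam : sig_t N) (j : 'I_N) : ppl R lam j = (sigl lam j)%:~R - N%:R.
Proof.
rewrite /sigl /ppl intrD -pmulrn; have -> : (N - 1 - j = N - j.+1)%N by rewrite -subnDA add1n.
by rewrite natrB ?ltn_ord //; ring.
Qed.

Lemma gamma_algebra (R : realType) (A : comAlgType R) (c : R) (I S x L g d D : A) :
  I * (x * (c *: (L * S) * g + S * d) + x * D) =
  c *: (x * (L * g)) * (S * I) + (x * d) * (S * I) + x * (I * D).
Proof.
(* The scalar is made an element of the algebra, so that [ring] sees only one multiplication. *)
have [e He] : exists e : A, forall v : A, c *: v = e * v.
  by exists c%:A => v; rewrite mulr_algl.
by rewrite !He; ring.
Qed.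

Lemma gamma_scaling (R : realType) (V : lmodType R) (c p : R) (a b d : V) : c != 0 ->
  (c^-1 * p) *: (c *: a + b + d) = p *: a + c^-1 *: (p *: b + p *: d).
Proof.
by move=> c0; rewrite !scalerDr !scalerA mulrAC mulVf // mul1r -addrA.
Qed.

Section GammaRecursion.
Variables (R : realType) (N : nat).
Notation rv := 'rV[R]_N.
Notation warr := (warr R 'I_N).

(* The Dunkl recursion for the vectors divided by [N ^ k] times the Schur
   generating function, with [F i] the jet of its normalized logarithmic
   derivative and [del i j] that of the divided difference of [gam i] and [gam j]. *)
Definition gamma_step (F gam gam' : 'I_N -> warr) := exists del : 'I_N -> 'I_N -> warr,
  [/\ forall i j, i != j -> wcomm (del i j),
      forall i j, i != j -> (wX R i - wX R j) * del i j = gam i - gam j &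
      forall i, gam' i = (1 + wX R i) * (F i * gam i) +
        N%:R^-1 *: ((1 + wX R i) * (wd i (gam i) + \sum_(j | j != i) del i j))].

Lemma pp_moment_eig (lam : sig_t N) k : (0 < N)%N ->
  pp_moment 1 lam k = N%:R ^- k.+1 * dunkl_eig R (sigl lam) k.
Proof.
move=> N0; have n0 : N%:R != 0 :> R by rewrite pnatr_eq0 -lt0n.
rewrite /pp_moment /dunkl_eig exprS invfM -mulrA; congr (_ * _).
rewrite mulr_sumr; apply: eq_bigr => i _.
rewrite pp_atomE.
rewrite expr_div_n mulrA mulrC; congr (_ * (_ * _)).
by apply: eq_bigr => j _; rewrite !pplE; congr (_ / _); ring.
Qed.

Section Data.
Variable rho : sig_t N -> R.
Hypothesis N0 : (0 < N)%N.
Hypothesis rhoP : is_prob rho.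
Hypothesis rhoU : sgf_unif_conv rho.
Hypothesis rhoS : all_partials_exist (logsgf rho) (ones N).

Let n0 : N%:R != 0 :> R. Proof. by rewrite pnatr_eq0 -lt0n. Qed.

Definition lnjet (i : 'I_N) : warr := jet (pdiff i (logsgf rho)).

(** Since [d_i S = N F_i S], differentiating [S] times a vector produces a term of order [N]. After
    division by [N] it becomes [F i * gam i], while the derivative of the vector and the divided
    differences keep the factor [1 / N]. *)
Lemma gamma_data : exists gam : nat -> 'I_N -> warr,
  [/\ forall i, gam 0%N i = 1,
      forall k, gamma_step lnjet (gam k) (gam k.+1),
      forall k, asum (fun lam => rho lam * pp_moment 1 lam k) /\
        rsum (fun lam => rho lam * pp_moment 1 lam k) = N%:R^-1 * \sum_i gam k i [::] &
      forall k0, exists gam' : nat -> 'I_N -> warr,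
      [/\ forall i, gam' 0%N i = N%:R^-1 *: \sum_i gam k0 i,
          forall k, gamma_step lnjet (gam' k) (gam' k.+1) &
          forall k, asum (fun lam => rho lam * (pp_moment 1 lam k0 * pp_moment 1 lam k)) /\
            rsum (fun lam => rho lam * (pp_moment 1 lam k0 * pp_moment 1 lam k)) =
            N%:R^-1 * \sum_i gam' k i [::]]].
Proof.
pose sd lam := projT1 (cid (@schur_data_exists R N lam)).
have sdP lam : schur_data_spec (sd lam) := projT2 (cid (@schur_data_exists R N lam)).
have [a a1 aS] := sgf_corner rhoU sdP.
pose S : warr := jet (sgf rho).
pose chi lam := sd_chi (sd lam).
have SE := jet_sgf rhoP sdP a1 aS.
have S1 : S [::] = 1 by rewrite /S jet0 (sgf1 rhoP sdP).
have cS : wcomm S.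
  rewrite /S SE; apply: wcomm_Av => lam; apply: wcomm_jet.
  by apply: laur_sum => m; exact: laur_mon.
have iS := winvM S1.
have cI := wcomm_winv S1 cS.
(* [S] is positive near the base point, so its derivative is recovered from that of its logarithm;
   both are considered on a common open neighbourhood. *)
have wdS i : wd i S = N%:R *: (lnjet i * S).
  have [U [oU U1 sU]] := all_partials_smooth rhoS.
  pose V := U `&` box a.
  have oV : open V by apply: openI => //; exact: open_box.
  have V1 : V (ones N) by split => //; exact: box1.
  have sub W f : V `<=` W -> smooth_on W f -> smooth_on V f.
    move=> VW sf n; have {sf} := sf n; elim: n f => [//|n IH] f H j; have [h1 h2] := H j.
    by split; [move=> u /VW; exact: h1|exact: IH].
  have sL : smooth_on V (logsgf rho) by apply: sub sU => u [].
  have sG : smooth_on V (sgf rho) by apply: sub (sgf_smooth rhoP sdP a1 aS) => u [].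
  have e u : V u -> pdiff i (sgf rho) u = ((cst N%:R \* pdiff i (logsgf rho)) \* sgf rho) u.
    move=> Vu; have G0 := sgf_gt0 rhoP sdP a1 aS (proj2 Vu).
    have dG := @smooth_derivable R N V _ i u sG Vu.
    have dL := @smooth_derivable R N V _ i u sL Vu.
    rewrite /=; have -> : pdiff i (logsgf rho) u = N%:R^-1 * (pdiff i (sgf rho) u / sgf rho u).
      rewrite -(pdiff_ln G0 dG).
      have dln : derivable (fun w => ln (sgf rho w)) u (evec N i).
        have -> : (fun w => ln (sgf rho w)) = cst N%:R \* logsgf rho.
          by apply/funext => w; rewrite /logsgf /= mulrA mulfV // mul1r.
        exact: derivableM.
      have := pdiffM (@derivable_cst _ _ _ (N%:R^-1 : R) u (evec N i)) dln.
      by rewrite pdiff_cst mul0r add0r.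
    by rewrite /= mulrA mulfV // mul1r divfK // gt_eqF.
  rewrite /S wd_jet (jet_ext oV V1 e).
  have sc : smooth_on V (cst N%:R : rv -> R).
    apply: (@sub [set u | posv u]); last by apply: laur_smooth; exact: laur_cst.
    by move=> u [_ bu]; exact: box_posv bu.
  rewrite (jetM oV V1 _ sG); last by move=> n; apply: CnM => //; exact: smooth_pdiff.
  rewrite (jetM oV V1 sc); last exact: smooth_pdiff.
  by rewrite jet_cst -scalerAl -scalerAl mul1r.
(* One construction for both families: [h = 1] gives the first moments, and [cf] equal to the moment
   of order [k0], with [h] the mean of the vectors of step [k0], gives the mixed ones. *)
have main (cf : sig_t N -> R) (h : warr) : Avok rho sd cf (fun lam => jet (chi lam)) ->
    Av rho sd cf (fun lam => jet (chi lam)) = S * h ->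
    exists gam : nat -> 'I_N -> warr, [/\ forall i, gam 0%N i = h,
      forall k, gamma_step lnjet (gam k) (gam k.+1) &
      forall k, N%:R ^+ k *: (S * \sum_i gam k i) =
        Av rho sd (fun lam => cf lam * dunkl_eig R (sigl lam) k) (fun lam => jet (chi lam))].
  move=> oc eh.
  pose G k i := Av rho sd cf (fun lam => jet (sd_g (sd lam) k i)).
  pose DD k i j := Av rho sd cf (fun lam => jet (sd_D (sd lam) k i j)).
  exists (fun k i => N%:R ^- k *: (winv S * G k i)); split.
  - move=> i; rewrite expr0 invr1 scale1r /G (Av_g0 rho sdP) eh mulrA.
    by rewrite [winv S * S]mulrC iS mul1r.
  - move=> k; exists (fun i j => N%:R ^- k *: (winv S * DD k i j)); split.
    + move=> i j ij; apply: wcommZ; apply: wcommM => //; apply: wcomm_Av => lam.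
      apply: wcomm_jet; have [_ _ _ [_ _ /(_ k) [h0 _ _]] _] := sdP lam; exact: h0.
    + move=> i j ij; rewrite -scalerBr -mulrBr -(Av_D sdP k ij oc).
      by rewrite -scalerAr; congr (_ *: _); rewrite mulrCA.
    + move=> i; rewrite /G (Av_gS sdP k i oc) -/(G k i).
      have GE : G k i = S * (winv S * G k i) by rewrite mulrA iS mul1r.
      set gm := winv S * G k i in GE *.
      rewrite GE wdM wdS.
      rewrite (wdZ i) -mulr_sumr -/(DD k i) -scaler_sumr -mulr_sumr.
      set SD := \sum_(j | j != i) _; set x := 1 + wX R i; set L := lnjet i.
      rewrite gamma_algebra.
      rewrite iS !mulr1 exprS invfM gamma_scaling // [in RHS]mulrDr.
      by rewrite -![in RHS]scalerAr.
  - move=> k; rewrite -(Av_eig sdP k oc) -scaler_sumr -mulr_sumr.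
    by rewrite -scalerAr scalerA mulfV ?expf_neq0 // scale1r mulrA iS mul1r.
have ok1 := Avok_chi rhoP sdP a1 aS.
have [|gam [g0 gS gE]] := main (fun=> 1) 1 ok1; first by rewrite mulr1 /S SE.
have sumS (x : 'I_N -> warr) : \sum_i x i [::] = (S * \sum_i x i) [::].
  by rewrite warrM0 S1 mul1r warr_sum.
have ppE lam k := @pp_moment_eig lam k N0.
have okE := fun cf k => @Avok_eig R N rho sd sdP cf k.
have rE (X : R) lam : rho lam / sd_chi (sd lam) (ones N) * X * jet (chi lam) [::] = rho lam * X.
  exact: (rsum_rho rho sdP (fun=> X) lam).
exists gam; split => //.
- move=> k; split.
    apply: asum_le (asumZ (N%:R ^- k.+1) (okE _ k ok1 [::])) => lam.
    by rewrite rE mul1r ppE mulrCA.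
  rewrite (sumS (gam k)).
  have -> : S * \sum_i gam k i = N%:R ^- k *: Av rho sd (fun lam => 1 * dunkl_eig R (sigl lam) k)
      (fun lam => jet (chi lam)).
    by rewrite -gE scalerA mulVf ?expf_neq0 // scale1r.
  rewrite warrZ mulrA -invfM -exprS /Av -rsumZ; last exact: okE.
  by apply: eq_rsum => lam; rewrite rE mul1r ppE mulrCA.
move=> k0.
pose cf (lam : sig_t N) : R := pp_moment 1 lam k0.
have okc : Avok rho sd cf (fun lam => jet (chi lam)).
  move=> w; apply: asum_le (asumZ (N%:R ^- k0.+1) (okE _ k0 ok1 w)) => lam.
  by rewrite /cf ppE mul1r !normrM !mulrA [_ * `|N%:R ^- _|]mulrC !mulrA.
have [|gam' [g0' gS' gE']] := main cf (N%:R^-1 *: \sum_i gam k0 i) okc.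
  rewrite -scalerAr.
  have -> : S * \sum_i gam k0 i = N%:R ^- k0 *: Av rho sd (fun lam => 1 * dunkl_eig R (sigl lam) k0)
      (fun lam => jet (chi lam)).
    by rewrite -gE scalerA mulVf ?expf_neq0 // scale1r.
  rewrite scalerA -invfM -exprS; apply/funext => w; rewrite warrZ /Av -rsumZ; last exact: okE.
  by apply: eq_rsum => lam; rewrite /cf ppE mul1r; ring.
exists gam'; split => // k.
have e lam : rho lam * (pp_moment 1 lam k0 * pp_moment 1 lam k) =
   N%:R ^- k.+1 * (rho lam * (cf lam * dunkl_eig R (sigl lam) k)).
  by rewrite [pp_moment 1 lam k]ppE /cf; ring.
split.
  apply: asum_le (asumZ (N%:R ^- k.+1) (okE _ k okc [::])) => lam.
  by rewrite rE e.
rewrite (sumS (gam' k)).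
have -> : S * \sum_i gam' k i = N%:R ^- k *: Av rho sd (fun lam => cf lam * dunkl_eig R (sigl lam) k)
    (fun lam => jet (chi lam)).
  by rewrite -gE' scalerA mulVf ?expf_neq0 // scale1r.
rewrite warrZ mulrA -invfM -exprS /Av -rsumZ; last exact: okE.
by apply: eq_rsum => lam; rewrite rE e.
Qed.

End Data.
End GammaRecursion.

(** * The limit of the recursion *)

Section OneVariable.
Variables (R : realType) (I : eqType).
Notation warr := (warr R I).
Notation fser := (fser R).
Implicit Types (A B : fser) (i x : I) (w : seq I).

(* The derivatives of the function [A] of the [i]-th variable alone. *)
Definition wT i A : warr := fun w => if all (pred1 i) w then (size w)`!%:R * A (size w) else 0.

Lemma wd_wT i A : wd i (wT i A) = wT i (fD A).
Proof.
apply/funext => w; rewrite /wd /wT /= eqxx /=; case: ifP => // _.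
by rewrite /fD factS natrM; ring.
Qed.

Lemma wd_wT0 x i A : x != i -> wd x (wT i A) = 0.
Proof. by move=> xi; apply/funext => w; rewrite /wd /wT /= (negPf xi). Qed.

Lemma wTD i A B : wT i (A + B) = wT i A + wT i B.
Proof.
by apply/funext => w; rewrite warrD /wT; case: ifP => _; rewrite ?addr0 // fserD mulrDr.
Qed.

Lemma wTM i A B : wT i (A * B) = wT i A * wT i B.
Proof.
apply/funext => w; elim: w A B => [|x w IH] A B.
  by rewrite warrM0 /wT /= fact0 !mul1r fserM0.
rewrite warrMS -[LHS]/(wd x (wT i (A * B)) w).
case: (eqVneq x i) => [->|xi].
  by rewrite !wd_wT fDM wTD warrD !IH.
by rewrite !wd_wT0 // mul0r mulr0 warr0 addr0.
Qed.

Lemma wT1 i : wT i 1 = 1.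
Proof.
apply/funext => -[|x w]; first by rewrite /wT /= fact0 mul1r.
by rewrite /wT warr1; case: ifP => // _; rewrite fser1 mulr0.
Qed.

Lemma wTX i : wT i (fX R) = wX R i.
Proof.
apply/funext => -[|x [|y w]]; rewrite /wT /wX /fX /=.
- by rewrite mulr0.
- by rewrite eqseq_cons eqxx !andbT; case: eqP => _; rewrite ?fact_gt0 //= mulr1.
- by rewrite eqseq_cons andbF; case: ifP => _ //; rewrite mulr0.
Qed.

Lemma wTZ i (c : R) A : wT i (c *: A) = c *: wT i A.
Proof.
by apply/funext => w; rewrite warrZ /wT; case: ifP => _; rewrite ?mulr0 // fserZ mulrCA.
Qed.

(** The iterated Leibniz rule has [2 ^+ size w] terms. *)
Lemma wmul_bound (F G : warr) w (a b : R) :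
  (forall v, (size v <= size w)%N -> `|F v| <= a) ->
  (forall v, (size v <= size w)%N -> `|G v| <= b) ->
  `|(F * G) w| <= 2 ^+ size w * (a * b).
Proof.
elim: w F G => [|x w IH] F G hF hG.
  rewrite warrM0 expr0 mul1r normrM; apply: ler_pM => //; [exact: hF|exact: hG].
rewrite warrMS /= exprS (le_trans (ler_normD _ _)) //.
have h1 := IH (wd x F) G (fun v hv => hF (x :: v) hv) (fun v hv => hG v (leqW hv)).
have h2 := IH F (wd x G) (fun v hv => hF v (leqW hv)) (fun v hv => hG (x :: v) hv).
by apply: le_trans (lerD h1 h2) _; rewrite -mulrA mulr_natl mulr2n.
Qed.

Definition fbnd (D : nat) A : R := \sum_(n < D.+1) n`!%:R * `|A n|.

Lemma fbnd_ge0 D A : 0 <= fbnd D A.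
Proof. by apply: sumr_ge0 => n _; rewrite mulr_ge0. Qed.

Lemma wT_bound i A D w : (size w <= D)%N -> `|wT i A w| <= fbnd D A.
Proof.
move=> hw; rewrite /wT; case: ifP => _; last by rewrite normr0 fbnd_ge0.
rewrite -ltnS in hw.
rewrite /fbnd (bigD1 (Ordinal hw)) //= normrM normr_nat lerDl.
by apply: sumr_ge0 => n _; rewrite mulr_ge0.
Qed.

End OneVariable.

Section UniformLimit.
Variable R : realType.
Notation fser := (fser R).

(* [ncvg F A]: as N grows, the derivatives of [F N i] at the point (1, ..., 1)
   approach, uniformly in [i], those of the series [A] in the [i]-th variable. *)
Definition ncvg (F : forall N, 'I_N -> warr R 'I_N) (A : fser) :=
  forall (D : nat) (e : R), 0 < e -> \forall N \near \oo,
    forall (i : 'I_N) w, (size w <= D)%N -> `|F N i w - wT i A w| <= e.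

Implicit Types (F G : forall N, 'I_N -> warr R 'I_N) (A B : fser).

Lemma ncvg_wT A : ncvg (fun N i => wT i A) A.
Proof.
by move=> D e e0; near=> N => i w _; rewrite subrr normr0 ltW.
Unshelve. all: by end_near. Qed.

Lemma ncvg_ext F G A : (\forall N \near \oo, F N = G N) -> ncvg F A -> ncvg G A.
Proof.
move=> FG cF D e e0; have := cF D e e0; apply: filterS2 FG => N <-; exact.
Qed.

Lemma ncvgD F G A B : ncvg F A -> ncvg G B -> ncvg (fun N i => F N i + G N i) (A + B).
Proof.
move=> cF cG D e e0; have e2 : 0 < e / 2 by rewrite divr_gt0.
apply: filterS2 (cF D _ e2) (cG D _ e2) => N hF hG i w hw.
rewrite wTD !warrD opprD addrACA (le_trans (ler_normD _ _)) //.
by rewrite [leRHS](splitr e) lerD // ?hF ?hG.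
Qed.

Lemma ncvgM F G A B : ncvg F A -> ncvg G B -> ncvg (fun N i => F N i * G N i) (A * B).
Proof.
move=> cF cG D e e0.
pose M := 1 + fbnd D A + fbnd D B.
have A0 := fbnd_ge0 D A; have B0 := fbnd_ge0 D B.
have M0 : 0 < M by rewrite /M; lra.
pose d := Num.min 1 (e / (2 ^+ D * (2 * M))).
have d0 : 0 < d by rewrite lt_min ltr01 divr_gt0 // !mulr_gt0 // exprn_gt0.
have d1 : d <= 1 by rewrite ge_min lexx.
have de : 2 ^+ D * (2 * M) * d <= e.
  rewrite mulrC -ler_pdivlMr; last by rewrite !mulr_gt0 // exprn_gt0.
  by rewrite ge_min lexx orbT.
apply: filterS2 (cF D d d0) (cG D d d0) => N hF hG i w hw.
rewrite wTM.
rewrite -warrB.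
have -> : F N i * G N i - wT i A * wT i B =
  (F N i - wT i A) * G N i + wT i A * (G N i - wT i B) by rewrite mulrBl mulrBr addrA subrK.
have sz (v : seq 'I_N) : (size v <= size w)%N -> (size v <= D)%N by move/leq_trans; exact.
have bG v : (size v <= size w)%N -> `|G N i v| <= M.
  move=> /sz hv; have := hG i v hv; have := wT_bound i B hv.
  have := ler_normD (G N i v - wT i B v) (wT i B v); rewrite subrK /M; lra.
have bA v : (size v <= size w)%N -> `|wT i A v| <= M.
  by move=> /sz hv; have := wT_bound i A hv; rewrite /M; lra.
have h1 := wmul_bound (fun v hv => hF i v (sz v hv)) bG.
have h2 := wmul_bound bA (fun v hv => hG i v (sz v hv)).
rewrite warrD (le_trans (ler_normD _ _)) // (le_trans (lerD h1 h2)) //.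
have p2 : 2 ^+ size w <= 2 ^+ D :> R by rewrite ler_weXn2l // ler1n.
apply: le_trans de.
have -> : 2 ^+ size w * (d * M) + 2 ^+ size w * (M * d) = 2 ^+ size w * (2 * M * d) :> R by ring.
by rewrite -[leRHS]mulrA ler_wpM2r // !mulr_ge0 // ltW.
Qed.

Lemma ncvg_wd F A : ncvg F A -> ncvg (fun N i => wd i (F N i)) (fD A).
Proof.
move=> cF D e e0; apply: filterS (cF D.+1 e e0) => N hF i w hw.
by rewrite -wd_wT; exact: (hF i (i :: w)).
Qed.

Lemma invn_near (C e : R) : 0 < e -> \forall N \near \oo, C * N%:R^-1 <= e.
Proof.
move=> e0; near=> N.
have N0 : 0 < N%:R :> R by rewrite ltr0n; near: N; exact: nbhs_infty_gt.
rewrite ler_pdivrMr // -ler_pdivrMl //.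
near: N; exact: nbhs_infty_ger.
Unshelve. all: by end_near. Qed.

Lemma ncvg_invn F A : ncvg F A -> ncvg (fun N i => N%:R^-1 *: F N i) 0.
Proof.
move=> cF D e e0.
apply: filterS2 (cF D 1 ltr01) (invn_near (1 + fbnd D A) e0) => N hF hN i w hw.
have -> : wT i 0 w = 0 :> R by rewrite /wT; case: ifP => // _; rewrite fser0 mulr0.
rewrite subr0 warrZ normrM ger0_norm ?invr_ge0 // mulrC (le_trans _ hN) // ler_wpM2r ?invr_ge0 //.
have := hF i w hw; have := wT_bound i A hw.
have := ler_normD (F N i w - wT i A w) (wT i A w); rewrite subrK; lra.
Qed.

(** The series [(A y - A 0) / y]: the divided difference of [A] in the variables [i] and [j], seen
    in the variable [i] alone. *)
Definition fshift A : fser := fun n => A n.+1.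

Section DividedDifferences.
Variables (N : nat) (gam : 'I_N -> warr R 'I_N) (del : 'I_N -> 'I_N -> warr R 'I_N).
Hypothesis delC : forall i j, i != j -> wcomm (del i j).
Hypothesis delE : forall i j, i != j -> (wX R i - wX R j) * del i j = gam i - gam j.

(** Each use of [wdiv_coef] trades a letter [j] for a letter [i] at the price of an additive [2 * B]
    and a factor at most [D]; there are at most [D] letters to trade. *)
Lemma divdiff_bound (D : nat) (B : R) :
  (forall i w, (size w <= D.+1)%N -> `|gam i w| <= B) ->
  forall i j w, i != j -> (size w <= D)%N -> `|del i j w| <= 2 * B * D.+1%:R ^+ D.
Proof.
move=> hB i j w ij hw.
have B0 : 0 <= B by apply: le_trans (hB i [::] isT).
suff H : `|del i j w| <= 2 * B * D.+1%:R ^+ count_mem j w.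
  apply: le_trans H _; rewrite ler_wpM2l ?mulr_ge0 // ler_weXn2l ?ler1n //.
  exact: leq_trans (count_size _ _) hw.
have [n] := ubnP (count_mem j w); elim: n w hw => [//|n IH] w hw hn.
have := wdiv_coef w ij (delC ij) (delE ij); rewrite warrB => e.
have h0 : `|del i j w| <= `|(count_mem i w).+1%:R * del i j w|.
  by rewrite normrM normr_nat ler_peMl // ler1n.
apply: le_trans h0 _; rewrite e (le_trans (ler_normD _ _)) //.
have h1 : `|gam i (i :: w) - gam j (i :: w)| <= 2 * B.
  have := ler_normB (gam i (i :: w)) (gam j (i :: w)).
  have := hB i (i :: w) hw; have := hB j (i :: w) hw; lra.
case: (posnP (count_mem j w)) => cj; first by rewrite cj mul0r normr0 addr0 expr0 mulr1.
have jw : j \in w by rewrite -has_pred1 has_count.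
have cw : count_mem j w = (count_mem j (i :: rem j w)).+1.
  have /seq.permP/(_ (pred1 j)) := perm_to_rem jw.
  by rewrite /= eqxx (negPf ij) add0n => ->.
have sw : (size (i :: rem j w) <= D)%N by rewrite /= size_rem // prednK //; case: (w) jw.
have := IH _ sw; rewrite -ltnS -cw => /(_ hn).
move=> h2; rewrite [count_mem j w in leRHS]cw exprS normrM normr_nat.
set m := count_mem j (i :: rem j w) in h2 *.
have c1 : (count_mem j w)%:R <= D%:R :> R by rewrite ler_nat (leq_trans (count_size _ _)).
have p1 : 1 <= D.+1%:R ^+ m :> R by rewrite exprn_ege1 // ler1n.
have d0 : 0 <= D%:R :> R by [].
have h3 : (count_mem j w)%:R * `|del i j (i :: rem j w)| <= D%:R * (2 * B * D.+1%:R ^+ m).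
  by apply: ler_pM.
apply: le_trans (lerD h1 h3) _.
move: p1 d0; rewrite -[D.+1%:R]natr1; move: ((D%:R + 1) ^+ m) => P; move: (D%:R : R) => d p1 d0; nra.
Qed.

(** For a word without [j] a single use of [wdiv_coef] suffices. As [wT j A] vanishes on words
    containing [i], only the contribution of [gam i] remains in the limit. *)
Lemma divdiff_off (A : fser) (D : nat) (e : R) :
  (forall i w, (size w <= D.+1)%N -> `|gam i w - wT i A w| <= e) ->
  forall i j w, i != j -> j \notin w -> (size w <= D)%N ->
    `|del i j w - wT i (fshift A) w| <= 2 * e.
Proof.
move=> hg i j w ij jw hw.
have := wdiv_coef w ij (delC ij) (delE ij); rewrite warrB (count_memPn jw) mul0r addr0 => E.
have n0 : (0 : R) < (count_mem i w).+1%:R by [].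
have hi := hg i (i :: w) hw; have hj := hg j (i :: w) hw.
have Tj : wT j A (i :: w) = 0 by rewrite /wT /= (negPf ij).
have Ti : (count_mem i w).+1%:R * wT i (fshift A) w = wT i A (i :: w).
  rewrite /wT /= eqxx /=; case: ifP => aw; last by rewrite mulr0.
  by move: (aw); rewrite all_count => /eqP ->; rewrite /fshift factS natrM mulrA.
rewrite Tj subr0 in hj.
have : `|(count_mem i w).+1%:R * (del i j w - wT i (fshift A) w)| <= 2 * e.
  rewrite mulrBr E Ti.
  have -> : gam i (i :: w) - gam j (i :: w) - wT i A (i :: w) =
    gam i (i :: w) - wT i A (i :: w) - gam j (i :: w) by ring.
  by apply: le_trans (ler_normB _ _) _; lra.
by apply: le_trans; rewrite normrM normr_nat ler_peMl // ler1n.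
Qed.

(** At most [D] indices [j] occur in [w]; for these the crude bound costs [O(1 / N)], and all others
    are within [2 * e]. The last [fbnd D (fshift A)] accounts for the missing index [j = i]. *)
Lemma divdiff_avg (A : fser) (D : nat) (e : R) : (0 < N)%N -> 0 <= e <= 1 ->
  (forall i w, (size w <= D.+1)%N -> `|gam i w - wT i A w| <= e) ->
  forall i w, (size w <= D)%N ->
    `|N%:R^-1 * (\sum_(j | j != i) del i j w) - wT i (fshift A) w| <=
    2 * e + (D%:R * (2 * (1 + fbnd D.+1 A) * D.+1%:R ^+ D + fbnd D (fshift A)) +
             fbnd D (fshift A)) * N%:R^-1.
Proof.
move=> N0 /andP[e0 e1] hg i w hw.
have n0 : 0 < N%:R :> R by rewrite ltr0n.
set M := fbnd D (fshift A); set B := 1 + fbnd D.+1 A.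
have M0 : 0 <= M := fbnd_ge0 D _.
have hB j v : (size v <= D.+1)%N -> `|gam j v| <= B.
  move=> hv; have := hg j v hv; have := wT_bound j A hv.
  have := ler_normD (gam j v - wT j A v) (wT j A v); rewrite subrK /B; lra.
set K := 2 * B * D.+1%:R ^+ D.
have K0 : 0 <= K.
  by rewrite !mulr_ge0 ?exprn_ge0 //; apply: le_trans (hB i [::] isT).
set T := wT i (fshift A) w.
have TM : `|T| <= M := wT_bound i _ hw.
have -> : N%:R^-1 * (\sum_(j | j != i) del i j w) - T =
   N%:R^-1 * (\sum_(j | j != i) (del i j w - T) - T).
  rewrite big_split /= sumr_const cardC1 card_ord -subn1 -[X in _ + X - _]mulr_natr natrB //.
  by field; rewrite lt0r_neq0.
rewrite normrM ger0_norm ?invr_ge0 // ler_pdivrMl // mulrDr [N%:R * (_ * N%:R^-1)]mulrC.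
rewrite divfK ?lt0r_neq0 //.
have S1 : `|\sum_(j | j != i) (del i j w - T)| <= N%:R * (2 * e) + D%:R * (K + M).
  apply: le_trans (ler_norm_sum _ _ _) _.
  have H j : j != i -> `|del i j w - T| <= 2 * e + (if j \in w then K + M else 0).
    rewrite eq_sym => ij; case: ifP => jw.
      have := divdiff_bound hB ij hw; rewrite -/K.
      have := ler_normB (del i j w) T; lra.
    by rewrite addr0; apply: divdiff_off hw => //; rewrite jw.
  apply: le_trans (ler_sum _ H) _; rewrite big_split /= lerD //.
    rewrite sumr_const -[_ *+ _]mulr_natl ler_wpM2r ?mulr_ge0 // ler_nat.
    by rewrite cardC1 card_ord leq_pred.
  rewrite -big_mkcondr /= sumr_const -[_ *+ _]mulr_natl ler_wpM2r ?addr_ge0 // ler_nat.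
  apply: leq_trans hw; apply: leq_trans (card_size w); apply: subset_leq_card.
  by apply/fintype.subsetP => j; rewrite unfold_in => /andP[].
have := ler_normB (\sum_(j | j != i) (del i j w - T)) T; lra.
Qed.

End DividedDifferences.

Lemma ncvg_avg F (del : forall N, 'I_N -> 'I_N -> warr R 'I_N) A : ncvg F A ->
  (\forall N \near \oo, [/\ forall i j, i != j -> wcomm (del N i j) &
     forall i j, i != j -> (wX R i - wX R j) * del N i j = F N i - F N j]) ->
  ncvg (fun N i => N%:R^-1 *: \sum_(j | j != i) del N i j) (fshift A).
Proof.
move=> cF Hd D e e0.
pose d := Num.min 1 (e / 4).
have d0 : 0 < d by rewrite lt_min ltr01 divr_gt0.
have de : d <= e / 4 by rewrite ge_min lexx orbT.
have d1 : 0 <= d <= 1 by rewrite ltW //= ge_min lexx.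
have e2 : 0 < e / 2 by rewrite divr_gt0.
near=> N => i w hw.
have N0 : (0 < N)%N by near: N; exact: nbhs_infty_gt.
have [h1 h2] : [/\ forall i j, i != j -> wcomm (del N i j) &
     forall i j, i != j -> (wX R i - wX R j) * del N i j = F N i - F N j] by near: N.
have h3 : forall i w, (size w <= D.+1)%N -> `|F N i w - wT i A w| <= d.
  by near: N; exact: cF.
rewrite warrZ warr_sum; apply: le_trans (divdiff_avg h1 h2 N0 d1 h3 i hw) _.
have : (D%:R * (2 * (1 + fbnd D.+1 A) * D.+1%:R ^+ D + fbnd D (fshift A)) +
             fbnd D (fshift A)) * N%:R^-1 <= e / 2 by near: N; exact: invn_near.
by move: de; lra.
Unshelve. all: by end_near. Qed.

Definition gamma_lim (psi A : fser) : fser := (1 + fX R) * (psi * A) + (1 + fX R) * fshift A.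

Lemma gamma_lim_fphi psi A :
  fX R * gamma_lim psi A = fphi psi * A - A 0%N *: (1 + fX R).
Proof.
have e : fX R * fshift A = A - A 0%N *: 1.
  apply/funext => n; rewrite fXM fserB fserZ fser1; case: n => [|n] /=.
    by rewrite mulr1 subrr.
  by rewrite mulr0 subr0.
rewrite /gamma_lim /fphi mulrDr [fX R * (_ * fshift A)]mulrCA e.
rewrite mulrBr -[in LHS]scalerAr mulr1; move: (_ *: _) => c; ring.
Qed.

Lemma ncvg_step F gam gam' psi A : ncvg F psi -> ncvg gam A ->
  (\forall N \near \oo, gamma_step (F N) (gam N) (gam' N)) -> ncvg gam' (gamma_lim psi A).
Proof.
move=> cF cg H.
(* The recursion is available for large [N] only; elsewhere the value 0 is harmless. *)
pose del N : 'I_N -> 'I_N -> warr R 'I_N :=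
  if pselect (gamma_step (F N) (gam N) (gam' N)) is left h then projT1 (cid h)
  else fun _ _ => 0.
have delP : \forall N \near \oo,
  [/\ forall i j, i != j -> wcomm (del N i j),
      forall i j, i != j -> (wX R i - wX R j) * del N i j = gam N i - gam N j &
      forall i, gam' N i = (1 + wX R i) * (F N i * gam N i) +
        N%:R^-1 *: ((1 + wX R i) * (wd i (gam N i) + \sum_(j | j != i) del N i j))].
  apply: filterS H => N HN; rewrite /del; case: pselect => // h.
  exact: (projT2 (cid h)).
have c1 : ncvg (fun N i => 1 + wX R i) (1 + fX R).
  move=> D e e0; apply: filterS (ncvg_wT (1 + fX R) D e0) => N h i w hw.
  by rewrite -wTX -(@wT1 R 'I_N i) -wTD; exact: h.
have cd := ncvg_avg cg (filterS _ delP).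
have {}cd : ncvg (fun N i => N%:R^-1 *: \sum_(j | j != i) del N i j) (fshift A).
  by apply: cd => N [].
have := ncvgD (ncvgM c1 (ncvgM cF cg))
  (ncvgM c1 (ncvgD (ncvg_invn (ncvg_wd cg)) cd)).
rewrite add0r; apply: ncvg_ext; apply: filterS delP => N [_ _ h].
apply/funext => i; rewrite h; congr (_ + _).
by rewrite -scalerDr -scalerAr.
Qed.

(** On a nonempty word at most one of the functions of a single variable is nonzero, so the mean
    retains only the constant terms. This makes the restarted recursion begin, in the limit, with a
    constant. *)
Lemma ncvg_mean F A : ncvg F A ->
  ncvg (fun N _ => N%:R^-1 *: \sum_j F N j) (A 0%N *: 1).
Proof.
move=> cF D e e0.
have e2 : 0 < e / 2 by rewrite divr_gt0.
near=> N => i w hw.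
have N0 : (0 < N)%N by near: N; exact: nbhs_infty_gt.
have n0 : 0 < N%:R :> R by rewrite ltr0n.
have hF : forall i w, (size w <= D)%N -> `|F N i w - wT i A w| <= e / 2.
  by near: N; exact: cF.
have hN : fbnd D A * N%:R^-1 <= e / 2 by near: N; exact: invn_near.
rewrite wTZ wT1 !warrZ warr_sum warr1.
have -> : N%:R^-1 * \sum_j F N j w - A 0%N * (w == [::])%:R =
  N%:R^-1 * (\sum_j (F N j w - wT j A w)) +
  N%:R^-1 * (\sum_j (wT j A w - A 0%N * (w == [::])%:R)).
  rewrite -mulrDr -big_split /=; under [in RHS]eq_bigr do rewrite addrA subrK.
  rewrite big_split /= sumr_const card_ord mulrDr; congr (_ + _).
  by rewrite -[X in _ = _ * X]mulr_natl mulKf ?lt0r_neq0.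
have H1 : `|N%:R^-1 * (\sum_j (F N j w - wT j A w))| <= e / 2.
  rewrite normrM ger0_norm ?invr_ge0 // ler_pdivrMl //.
  apply: le_trans (ler_norm_sum _ _ _) _.
  apply: le_trans (ler_sum _ (fun j _ => hF j w hw)) _.
  by rewrite sumr_const card_ord -[(e / 2) *+ N]mulr_natl.
have H2 : `|N%:R^-1 * (\sum_j (wT j A w - A 0%N * (w == [::])%:R))| <= e / 2.
  apply: le_trans hN; rewrite normrM ger0_norm ?invr_ge0 // mulrC ler_wpM2r ?invr_ge0 //.
  clear H1; case: w hw => [|x w] hw.
    rewrite big1 ?normr0 ?fbnd_ge0 // => j _.
    by rewrite /wT /= fact0 mul1r mulr1 subrr.
  rewrite (bigD1 x) //= big1 => [|j jx].
    by rewrite mulr0 subr0 addr0; exact: wT_bound.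
  by rewrite mulr0 subr0 /wT /= eq_sym (negPf jx).
by have := ler_normD (N%:R^-1 * (\sum_j (F N j w - wT j A w))) 
  (N%:R^-1 * (\sum_j (wT j A w - A 0%N * (w == [::])%:R))); lra.
Unshelve. all: by end_near. Qed.

Lemma ncvg_mean0 F A : ncvg F A -> (fun N => N%:R^-1 * \sum_j F N j [::]) @ \oo --> A 0%N.
Proof.
move=> cF; apply/cvgrPdist_le => e e0.
near=> N.
have N0 : (0 < N)%N by near: N; exact: nbhs_infty_gt.
have H : forall (i : 'I_N) w, (size w <= 0)%N ->
   `|(N%:R^-1 *: \sum_j F N j) w - wT i (A 0%N *: 1) w| <= e.
  by near: N; exact: (ncvg_mean cF).
have := H (Ordinal N0) [::] isT.
by rewrite wTZ wT1 !warrZ warr1 eqxx mulr1 warr_sum distrC.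
Unshelve. all: by end_near. Qed.

End UniformLimit.

(** * Convergence for q = 1 *)

Section Symmetry.
Variables (R : realType) (N : nat).
Notation rv := 'rV[R]_N.

Lemma sgf_perm (rho : sig_t N -> R) (s : 'S_N) (u : rv) : posv u ->
  sgf rho (permv s u) = sgf rho u.
Proof.
move=> pu; apply: eq_rsum => lam; have [d [_ e h _ _]] := @schur_data_exists R N lam.
by rewrite /sgf_term (e u pu) (e _ (posv_perm s pu)) h.
Qed.

Lemma partials_perm (s : 'S_N) (f : rv -> R) (l : seq 'I_N) u :
  partials (map val (map s l)) (f \o permv s) u = partials (map val l) f (permv s u).
Proof.
elim: l u => [//|i l IH] u /=; rewrite -pdiff_perm.
by congr (pdiff _ _ u); apply/funext.
Qed.

Lemma jet_perm (s : 'S_N) (f : rv -> R) (w : seq 'I_N) :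
  (forall u, posv u -> f (permv s u) = f u) -> jet f (map s w) = jet f w.
Proof.
move=> fs; rewrite /jet -map_rev.
rewrite -(partials_ext (f := f \o permv s) _ (open_posv (R := R) (N := N)) fs (@posv1 R N)).
rewrite partials_perm; congr (partials _ _ _).
by apply/matrixP => i j; rewrite !mxE.
Qed.

(** Moves the letters of a word below its length. By symmetry, finitely many of the assumed limits
    then control all words of bounded length over all [N] letters. *)
Lemma perm_to_initial (w : seq 'I_N) :
  exists s : 'S_N, forall x, x \in w -> (s x < size w)%N.
Proof.
pose e := undup w ++ [seq x <- enum 'I_N | x \notin w].
have ue : uniq e.
  rewrite cat_uniq undup_uniq filter_uniq ?enum_uniq // andbT /=.
  by apply/hasPn => x; rewrite mem_filter => /andP[xw _]; rewrite mem_undup.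
have me x : x \in e.
  by rewrite mem_cat mem_undup mem_filter mem_enum andbT orbN.
have se : size e = N.
  rewrite -[RHS]card_ord cardE; apply/perm_size/uniq_perm => //; first exact: enum_uniq.
  by move=> x; rewrite me mem_enum.
have he x : (index x e < N)%N by rewrite -[X in (_ < X)%N]se index_mem.
have inj : injective (fun x => Ordinal (he x)).
  by move=> x y [] h; rewrite -(nth_index x (me x)) h (nth_index x (me y)).
exists (perm inj) => x xw; rewrite permE /= index_cat mem_undup xw.
by apply: leq_trans (size_undup w); rewrite index_mem mem_undup.
Qed.

End Symmetry.

Section LogDerivatives.
Variables (R : realType) (rho : forall N : nat, sig_t N -> R) (a : nat -> R).
Arguments rho : clear implicits.
Hypothesis lim1 : forall (k : nat) (i0 : nat), (0 < k)%N ->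
  (fun N => partials (nseq k i0) (logsgf (rho N)) (ones N)) @ \oo --> a k.
Hypothesis lim2 : forall l : seq nat, (2 <= size (undup l))%N ->
  (fun N => partials l (logsgf (rho N)) (ones N)) @ \oo --> (0 : R).

Definition psi_series : fser R := fun n => a n.+1 / n`!%:R.

Lemma near_partials (D : nat) (e : R) : 0 < e -> \forall N \near \oo,
  (forall n x, (n < D)%N -> (x < D)%N ->
     `|partials (nseq n.+1 x) (logsgf (rho N)) (ones N) - a n.+1| <= e) /\
  (forall l, (size l <= D)%N -> all (ltn^~ D) l -> (2 <= size (undup l))%N ->
     `|partials l (logsgf (rho N)) (ones N)| <= e).
Proof.
move=> e0.
have H1 : \forall N \near \oo, forall p : 'I_D * 'I_D,
    `|partials (nseq p.1.+1 (val p.2)) (logsgf (rho N)) (ones N) - a p.1.+1| <= e.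
  apply: filter_forall => p; have /cvgrPdist_le/(_ e e0) := @lim1 p.1.+1 (val p.2) isT.
  by apply: filterS => N; rewrite distrC.
have H2 : \forall N \near \oo, forall (n : 'I_D.+1) (t : n.-tuple 'I_D),
    (2 <= size (undup (map val t)))%N ->
    `|partials (map val t) (logsgf (rho N)) (ones N)| <= e.
  apply: filter_forall => n; apply: filter_forall => t.
  case: (leqP 2 (size (undup (map val t)))) => h; last by near=> N.
  have /cvgrPdist_le/(_ e e0) := lim2 h.
  by apply: filterS => N; rewrite sub0r normrN.
apply: filterS2 H1 H2 => N h1 h2; split.
  by move=> n x hn hx; exact: (h1 (Ordinal hn, Ordinal hx)).
move=> l hl la.
have [l' E] : exists l' : seq 'I_D, l = map val l'.
  elim: l la {hl} => [_|x l IH /= /andP[hx /IH [l' ->]]]; first by exists [::].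
  by exists (Ordinal hx :: l').
move=> h; have sl : (size l' < D.+1)%N by move: hl; rewrite E size_map ltnS.
rewrite E in h *.
by have := h2 (Ordinal sl) (in_tuple l') h.
Unshelve. all: by end_near. Qed.

Lemma ncvg_lnjet : ncvg (fun N i => lnjet (rho N) i) psi_series.
Proof.
move=> D e e0; apply: filterS (near_partials D.+1 e0) => N [h1 h2] i w hw.
have [s hs] := perm_to_initial (i :: w).
have -> : lnjet (rho N) i w = jet (logsgf (rho N)) (i :: w) by rewrite /lnjet -wd_jet.
rewrite -(@jet_perm _ _ s); last by move=> u pu; rewrite /logsgf sgf_perm.
rewrite /jet; set l := map val _.
have sl : size l = (size w).+1 by rewrite /l size_map size_rev size_map.
rewrite /wT; case: ifP => aw.
  have -> : l = nseq (size w).+1 (val (s i)).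
    move/all_pred1P : aw => aw; rewrite /l [in LHS]aw.
    by rewrite -[i :: nseq _ i]/(nseq (size w).+1 i) map_nseq rev_nseq map_nseq.
  rewrite /psi_series mulrCA mulfV ?mulr1; last by rewrite pnatr_eq0 -lt0n fact_gt0.
  apply: h1 => //; apply: leq_trans (hs i (mem_head _ _)) _; exact: hw.
rewrite subr0; apply: h2; rewrite ?sl //.
  apply/allP => x; rewrite /l map_rev mem_rev => /mapP[y /mapP[z zw ->] ->].
  exact: leq_trans (hs z zw) _.
have /allPn[x xw xi] : ~~ all (pred1 i) w by rewrite aw.
rewrite /= in xi.
(* The word contains [i] and some [x] different from it, so the hypothesis on mixed derivatives
   applies. *)
have -> : 2%N = size [:: val (s x); val (s i)] by [].
apply: uniq_leq_size.
  by rewrite /= andbT inE val_eqE (inj_eq perm_inj).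
move=> y; rewrite !inE mem_undup /l map_rev mem_rev.
case/orP => /eqP ->; apply: map_f; apply: map_f; rewrite inE ?eqxx //.
by rewrite xw orbT.
Qed.

End LogDerivatives.

Section Chebyshev.
Variables (R : realType) (N : nat) (rho : sig_t N -> R).
Hypothesis rhoP : is_prob rho.
Implicit Types (X : sig_t N -> R) (A B : set (sig_t N)).

Lemma rho_ge0 lam : 0 <= rho lam.
Proof. by case: rhoP. Qed.

Lemma asum_rho : asum rho.
Proof.
rewrite /asum /nsum (eq_esum (b := fun lam => (rho lam)%:E)); last first.
  by move=> lam _; rewrite ger0_norm // rho_ge0.
by case: rhoP => _ ->; rewrite ltry.
Qed.

Lemma rsum_rho1 : rsum rho = 1.
Proof.
rewrite rsum_ge0E; [|exact: rho_ge0|exact: asum_rho].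
by case: rhoP => _; rewrite /nsum => ->.
Qed.

Lemma asum_rho_indic A : asum (fun lam => rho lam * \1_A lam).
Proof.
apply: asum_le asum_rho => lam; rewrite normrM ler_piMr // indicE.
by case: (_ \in _); rewrite ?normr1 // normr0.
Qed.

Lemma probE A : prob rho A = rsum (fun lam => rho lam * \1_A lam).
Proof.
rewrite rsum_ge0E; [|by move=> lam; rewrite mulr_ge0 ?rho_ge0|exact: asum_rho_indic].
rewrite /prob /nsum esum_mkcond; congr fine; apply: eq_esum => lam _.
by rewrite indicE; case: ifP => _; rewrite ?mulr1 ?mulr0.
Qed.

Lemma prob_ge0 A : 0 <= prob rho A.
Proof.
by rewrite probE rsum_ge0 //; [move=> lam; rewrite mulr_ge0 ?rho_ge0|exact: asum_rho_indic].
Qed.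

Lemma le_prob A B : A `<=` B -> prob rho A <= prob rho B.
Proof.
move=> AB; rewrite !probE; apply: rsum_le => [||lam]; try exact: asum_rho_indic.
rewrite ler_wpM2l ?rho_ge0 // !indicE ler_nat.
by case: (boolP (lam \in A)) => //; rewrite inE => /AB/mem_set ->.
Qed.

Lemma prob_setU A B : prob rho (A `|` B) <= prob rho A + prob rho B.
Proof.
rewrite !probE -rsumD; try exact: asum_rho_indic.
apply: rsum_le => [||lam]; first exact: asum_rho_indic.
  by apply: asumD; exact: asum_rho_indic.
rewrite -mulrDr ler_wpM2l ?rho_ge0 // !indicE in_setU.
by case: (lam \in A); case: (lam \in B); rewrite /= ?addr0 ?add0r // lerDl.
Qed.

Lemma prob_chebyshev X (m eps : R) : 0 < eps ->
  asum (fun lam => rho lam * X lam) -> asum (fun lam => rho lam * (X lam * X lam)) ->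
  prob rho [set lam | eps < `|X lam - m|] <=
  eps ^- 2 * (rsum (fun lam => rho lam * (X lam * X lam)) -
    2 * m * rsum (fun lam => rho lam * X lam) + m ^+ 2).
Proof.
move=> e0 s1 s2; rewrite probE.
have -> : rsum (fun lam => rho lam * (X lam * X lam)) -
    2 * m * rsum (fun lam => rho lam * X lam) + m ^+ 2 =
    rsum (fun lam => rho lam * (X lam - m) ^+ 2).
  have e1 : m ^+ 2 = rsum (fun lam => m ^+ 2 * rho lam).
    by rewrite (rsumZ _ asum_rho) rsum_rho1 mulr1.
  rewrite [X in _ + X = _]e1 -(rsumZ _ s1) -rsumB //; last exact: asumZ.
  rewrite -rsumD //; last 2 first.
  - by apply: asumD => //; apply: asumN; exact: asumZ.
  - exact: asumZ asum_rho.
  by apply: eq_rsum => lam; ring.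
have s3 : asum (fun lam => rho lam * (X lam - m) ^+ 2).
  apply: asum_le (asumD s2 (asumD (asumZ (- (2 * m)) s1) (asumZ (m ^+ 2) asum_rho))) => lam.
  by rewrite le_eqVlt; apply/orP; left; apply/eqP; congr `|_|; ring.
rewrite -rsumZ //; apply: rsum_le => [||lam]; first exact: asum_rho_indic.
  exact: asumZ.
rewrite mulrCA ler_wpM2l ?rho_ge0 // indicE; case: (boolP (lam \in _)) => h; last first.
  by rewrite mulr_ge0 ?sqr_ge0 // invr_ge0 exprn_ge0 // ltW.
move: h; rewrite inE /= => h.
rewrite mulrC ler_pdivlMr ?exprn_gt0 // mul1r -[leRHS]real_normK ?num_real //.
by rewrite lerXn2r ?nnegrE // ltW.
Qed.

End Chebyshev.

Definition pcvg (R : realType) (rho : forall N, sig_t N -> R) (X : forall N, sig_t N -> R)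
  (x : R) := forall eps : R, 0 < eps ->
  (fun N => prob (rho N) [set lam | eps < `|X N lam - x|]) @ \oo --> (0 : R).

Section FirstMoments.
Variables (R : realType) (rho : forall N : nat, sig_t N -> R) (a : nat -> R).
Arguments rho : clear implicits.
Hypothesis rhoP : forall N, is_prob (rho N).
Hypothesis rhoU : forall N, sgf_unif_conv (rho N).
Hypothesis rhoS : forall N, all_partials_exist (logsgf (rho N)) (ones N).
Hypothesis lim1 : forall (k : nat) (i0 : nat), (0 < k)%N ->
  (fun N => partials (nseq k i0) (logsgf (rho N)) (ones N)) @ \oo --> a k.
Hypothesis lim2 : forall l : seq nat, (2 <= size (undup l))%N ->
  (fun N => partials l (logsgf (rho N)) (ones N)) @ \oo --> (0 : R).
Notation psi := (psi_series a).

Let near_gt0 : \forall N \near \oo, (0 < N)%N.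
Proof. exact: nbhs_infty_gt. Qed.

Let A k : fser R := iter k (gamma_lim psi) 1.

Let A0 k : A k 0%N = fmoment psi 1 k.
Proof.
apply: dunkl_recursion_fmoment => //.
by move=> j; rewrite /A iterS gamma_lim_fphi.
Qed.

Let gamma_limZ (c : R) B : gamma_lim psi (c *: B) = c *: gamma_lim psi B.
Proof.
rewrite /gamma_lim scalerDr !scalerAr; congr (_ + _ * _).
Qed.

Let ncvg_gamma (gam : forall N, nat -> 'I_N -> warr R 'I_N) B :
  ncvg (fun N i => gam N 0%N i) B ->
  (\forall N \near \oo, forall k, gamma_step (@lnjet R N (rho N)) (gam N k) (gam N k.+1)) ->
  forall k, ncvg (fun N i => gam N k i) (iter k (gamma_lim psi) B).
Proof.
move=> c0 H; elim=> [//|k IH].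
apply: ncvg_step (ncvg_lnjet lim1 lim2) IH _.
by apply: filterS H => N h; exact: h.
Qed.

Lemma first_moments : (forall k, (fun N => rsum (fun lam : sig_t N => rho N lam * pp_moment 1 lam k))
    @ \oo --> fmoment psi 1 k) /\
  (forall k0 k, (fun N => rsum (fun lam : sig_t N => rho N lam * (pp_moment 1 lam k0 * pp_moment 1 lam k)))
    @ \oo --> fmoment psi 1 k0 * fmoment psi 1 k).
Proof.
pose P N (gam : nat -> 'I_N -> warr R 'I_N) :=
  [/\ forall i, gam 0%N i = 1,
      forall k, gamma_step (@lnjet R N (rho N)) (gam k) (gam k.+1),
      forall k, asum (fun lam : sig_t N => rho N lam * pp_moment 1 lam k) /\
        rsum (fun lam : sig_t N => rho N lam * pp_moment 1 lam k) = N%:R^-1 * \sum_i gam k i [::] &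
      forall k0, exists gam' : nat -> 'I_N -> warr R 'I_N,
      [/\ forall i, gam' 0%N i = N%:R^-1 *: \sum_i gam k0 i,
          forall k, gamma_step (@lnjet R N (rho N)) (gam' k) (gam' k.+1) &
          forall k, asum (fun lam : sig_t N => rho N lam * (pp_moment 1 lam k0 * pp_moment 1 lam k)) /\
            rsum (fun lam : sig_t N => rho N lam * (pp_moment 1 lam k0 * pp_moment 1 lam k)) =
            N%:R^-1 * \sum_i gam' k i [::]]].
have HP N : exists gam, (0 < N)%N -> P N gam.
  case: (posnP N) => [->|N0]; first by exists (fun _ _ => 0).
  by have [gam h] := gamma_data N0 (rhoP N) (rhoU N) (rhoS N); exists gam => _.
pose gam N := projT1 (cid (HP N)).
have gamP N : (0 < N)%N -> P N (gam N) := projT2 (cid (HP N)).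
have cg k : ncvg (fun N i => gam N k i) (A k).
  apply: ncvg_gamma.
    apply: ncvg_ext (ncvg_wT (1 : fser R)); apply: filterS near_gt0 => N /gamP[h _ _ _].
    by apply/funext => i; rewrite h wT1.
  by apply: filterS near_gt0 => N /gamP[_ h _ _].
split=> [k|k0 k].
  rewrite -A0; apply: cvg_trans (ncvg_mean0 (cg k)); apply: near_eq_cvg.
  by apply: filterS near_gt0 => N /gamP[_ _ /(_ k)[_ ->] _].
pose P' N (gam' : nat -> 'I_N -> warr R 'I_N) :=
  [/\ forall i, gam' 0%N i = N%:R^-1 *: \sum_i gam N k0 i,
      forall k, gamma_step (@lnjet R N (rho N)) (gam' k) (gam' k.+1) &
      forall k, asum (fun lam : sig_t N => rho N lam * (pp_moment 1 lam k0 * pp_moment 1 lam k)) /\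
        rsum (fun lam : sig_t N => rho N lam * (pp_moment 1 lam k0 * pp_moment 1 lam k)) =
        N%:R^-1 * \sum_i gam' k i [::]].
have HP' N : exists gam', (0 < N)%N -> P' N gam'.
  case: (posnP N) => [->|/gamP[_ _ _ /(_ k0)[gam' h]]]; first by exists (fun _ _ => 0).
  by exists gam' => _.
pose gam' N := projT1 (cid (HP' N)).
have gamP' N : (0 < N)%N -> P' N (gam' N) := projT2 (cid (HP' N)).
have cg' : ncvg (fun N i => gam' N k i) (iter k (gamma_lim psi) (A k0 0%N *: 1)).
  apply: ncvg_gamma.
    apply: ncvg_ext (ncvg_mean (cg k0)); apply: filterS near_gt0 => N /gamP'[h _ _].
    by apply/funext => i; rewrite h.
  by apply: filterS near_gt0 => N /gamP'[_ h _].
(* The limit recursion is linear, so starting from a constant multiplies every step by it. Hence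
   second moments factorize and the variance tends to 0. *)
have eA : iter k (gamma_lim psi) (A k0 0%N *: 1) = A k0 0%N *: A k.
  by elim: (k) => [//|j IH]; rewrite !iterS IH gamma_limZ.
rewrite -!A0 -fserZ -eA; apply: cvg_trans (ncvg_mean0 cg'); apply: near_eq_cvg.
by apply: filterS near_gt0 => N /gamP'[_ _ /(_ k)[_ ->]].
Qed.

Lemma pcvg_pp_moment1 k : pcvg rho (fun N lam => pp_moment 1 lam k) (fmoment psi 1 k).
Proof.
move=> eps e0; have [/(_ k) h1 /(_ k k) h2] := first_moments.
set m := fmoment psi 1 k in h1 h2 *.
have lim0 : (fun N => eps ^- 2 * (rsum (fun lam : sig_t N => rho N lam *
     (pp_moment 1 lam k * pp_moment 1 lam k)) -
    2 * m * rsum (fun lam : sig_t N => rho N lam * pp_moment 1 lam k) + m ^+ 2)) @ \oo --> (0 : R).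
  have -> : 0 = eps ^- 2 * (m * m - 2 * m * m + m ^+ 2) :> R by ring.
  apply: cvgM; first exact: cvg_cst.
  apply: cvgD; last exact: cvg_cst.
  apply: cvgB => //; apply: cvgM => //; exact: cvg_cst.
apply: squeeze_cvgr (cvg_cst (0 : R)) lim0.
apply: filterS near_gt0 => N N0; rewrite prob_ge0 //=.
have [gam [_ _ h h']] := gamma_data N0 (rhoP N) (rhoU N) (rhoS N).
have [gam' [_ _ h'']] := h' k.
by apply: prob_chebyshev => //; [case: (h k)|case: (h'' k)].
Qed.

End FirstMoments.

(** * Transfer to all q *)

Section ConvergenceInProbability.
Variables (R : realType) (rho : forall N : nat, sig_t N -> R).
Arguments rho : clear implicits.
Hypothesis rhoP : forall N, is_prob (rho N).
Implicit Types (X Y Z : forall N, sig_t N -> R) (x y z : R).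

(** Continuity of an operation at the limit point: outside two events of small probability, [Z] is
    close to [z]. *)
Lemma pcvg_map2 X Y Z x y z : pcvg rho X x -> pcvg rho Y y ->
  (forall eps, 0 < eps -> exists2 d, 0 < d & \forall N \near \oo, forall lam : sig_t N,
     `|X N lam - x| <= d -> `|Y N lam - y| <= d -> `|Z N lam - z| <= eps) ->
  pcvg rho Z z.
Proof.
move=> cX cY H eps e0; have [d d0 Hd] := H eps e0.
have lim0 : (fun N => prob (rho N) [set lam | d < `|X N lam - x|] +
    prob (rho N) [set lam | d < `|Y N lam - y|]) @ \oo --> (0 : R).
  by rewrite -[X in _ --> X]addr0; exact: (cvgD (cX d d0) (cY d d0)).
apply: squeeze_cvgr (cvg_cst (0 : R)) lim0.
apply: filterS Hd => N h; rewrite prob_ge0 //=.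
apply: le_trans (prob_setU _ _ _) => //; apply: le_prob => // lam /= hz.
case: (leP `|X N lam - x| d) => hx; last by left.
case: (leP `|Y N lam - y| d) => hy; last by right.
by have := h lam hx hy; rewrite leNgt hz.
Qed.

Lemma pcvg_ext X Y x : (\forall N \near \oo, X N = Y N) -> pcvg rho X x -> pcvg rho Y x.
Proof.
move=> XY cX; apply: (pcvg_map2 cX cX) => eps e0; exists eps => //.
by apply: filterS XY => N <-.
Qed.

Lemma pcvg_seq (c : nat -> R) x : c @ \oo --> x -> pcvg rho (fun N _ => c N) x.
Proof.
move=> /cvgrPdist_le cx eps e0.
apply: cvg_near_cst; apply: filterS (cx eps e0) => N h.
rewrite /prob esum1 // => lam /=; by rewrite distrC ltNge h.
Qed.

Lemma pcvg_cst x : pcvg rho (fun _ _ => x) x.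
Proof. exact: pcvg_seq (cvg_cst x). Qed.

Lemma pcvgD X Y x y : pcvg rho X x -> pcvg rho Y y ->
  pcvg rho (fun N lam => X N lam + Y N lam) (x + y).
Proof.
move=> cX cY; apply: (pcvg_map2 cX cY) => eps e0; exists (eps / 2); first by rewrite divr_gt0.
near=> N => lam hx hy; rewrite opprD addrACA (le_trans (ler_normD _ _)) //.
by rewrite [leRHS]splitr lerD.
Unshelve. all: by end_near. Qed.

Lemma pcvgM X Y x y : pcvg rho X x -> pcvg rho Y y ->
  pcvg rho (fun N lam => X N lam * Y N lam) (x * y).
Proof.
move=> cX cY; apply: (pcvg_map2 cX cY) => eps e0.
pose K := 1 + `|x| + `|y|; have K0 : 0 < K by rewrite /K -addrA ltr_pwDl // addr_ge0.
exists (Num.min 1 (eps / K)); first by rewrite lt_min ltr01 divr_gt0.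
near=> N => lam; set d := Num.min _ _ => hx hy.
have d1 : d <= 1 by rewrite ge_min lexx.
have dK : d * K <= eps by rewrite -ler_pdivlMr // ge_min lexx orbT.
have d0 : 0 <= d by apply: le_trans hx.
have -> : X N lam * Y N lam - x * y =
  (X N lam - x) * (Y N lam - y) + (x * (Y N lam - y) + y * (X N lam - x)) by ring.
apply: le_trans dK; have -> : d * K = d + (`|x| * d + `|y| * d) by rewrite /K; ring.
apply: le_trans (ler_normD _ _) _; rewrite lerD //.
  rewrite normrM -[leRHS]mulr1; apply: ler_pM => //; exact: le_trans hy d1.
apply: le_trans (ler_normD _ _) _; rewrite !normrM.
by rewrite lerD // ler_wpM2l.
Unshelve. all: by end_near. Qed.

Lemma pcvgZ (c : R) X x : pcvg rho X x -> pcvg rho (fun N lam => c * X N lam) (c * x).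
Proof. by move=> cX; exact: pcvgM (pcvg_cst c) cX. Qed.

Lemma pcvgB X Y x y : pcvg rho X x -> pcvg rho Y y ->
  pcvg rho (fun N lam => X N lam - Y N lam) (x - y).
Proof.
move=> cX cY; have := pcvgD cX (pcvgZ (-1) cY); rewrite mulN1r.
by apply: pcvg_ext; apply: nearW => N; apply/funext => lam; rewrite mulN1r.
Qed.

Lemma pcvg_sum (J : Type) (r : seq J) (F : J -> forall N, sig_t N -> R) (f : J -> R) :
  (forall j, pcvg rho (F j) (f j)) ->
  pcvg rho (fun N lam => \sum_(j <- r) F j N lam) (\sum_(j <- r) f j).
Proof.
move=> H; elim: r => [|j r IH].
  rewrite big_nil; apply: pcvg_ext (pcvg_cst 0); apply: nearW => N.
  by apply/funext => lam; rewrite big_nil.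
rewrite big_cons; apply: pcvg_ext (pcvgD (H j) IH); apply: nearW => N.
by apply/funext => lam; rewrite big_cons.
Qed.

Definition fpcvg (E : forall N, sig_t N -> fser R) (e : fser R) :=
  forall n, pcvg rho (fun N lam => E N lam n) (e n).

Section LogarithmicDerivative.
Variables (E H : forall N, sig_t N -> fser R) (e h : fser R).
Arguments E : clear implicits.
Arguments H : clear implicits.
Hypothesis E0 : forall N lam, E N lam 0%N = 1.
Hypothesis EH : forall N lam, fD (E N lam) = H N lam * E N lam.
Hypothesis e0 : e 0%N = 1.
Hypothesis eh : fD e = h * e.

(** The coefficients of [E] are polynomials in those of its logarithmic derivative, so convergence
    in probability passes through; the next lemma is the converse, where [E 0 = 1] makes the system
    triangular. *)
Lemma fpcvg_solve : fpcvg H h -> fpcvg E e.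
Proof.
move=> cH; elim/ltn_ind => -[_|n IH].
  rewrite e0; apply: pcvg_ext (pcvg_cst 1); apply: nearW => N.
  by apply/funext => lam; rewrite E0.
have eS (F G : fser R) : fD F = G * F -> F n.+1 = n.+1%:R^-1 * \sum_(i < n.+1) G i * F (n - i)%N.
  move/(congr1 (@^~ n)); rewrite fserM /fD => <-.
  by rewrite mulrC mulfK // pnatr_eq0.
rewrite (eS _ _ eh).
apply: (@pcvg_ext (fun N lam => n.+1%:R^-1 * \sum_(i < n.+1) H N lam i * E N lam (n - i)%N)).
  by apply: nearW => N; apply/funext => lam; rewrite -eS.
apply: pcvgZ; apply: (@pcvg_sum _ (index_enum 'I_n.+1) (fun (i : 'I_n.+1) N lam => H N lam (val i) * E N lam (n - i)%N)
  (fun i : 'I_n.+1 => h (val i) * e (n - i)%N)) => i.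
by apply: pcvgM; [exact: cH|apply: IH; rewrite ltnS leq_subr].
Qed.

Lemma fpcvg_logderiv : fpcvg E e -> fpcvg H h.
Proof.
move=> cE; elim/ltn_ind => n IH.
have hS (F G : fser R) : F 0%N = 1 -> fD F = G * F ->
    G n = n.+1%:R * F n.+1 - \sum_(i < n) G i * F (n - i)%N.
  move=> F0 /(congr1 (@^~ n)); rewrite fserM big_ord_recr /= subnn F0 mulr1 /fD.
  by rewrite mulrC => ->; rewrite [X in X - _]addrC addrK.
rewrite (hS _ _ e0 eh).
apply: (@pcvg_ext (fun N lam => n.+1%:R * E N lam n.+1 - \sum_(i < n) H N lam i * E N lam (n - i)%N)).
  by apply: nearW => N; apply/funext => lam; rewrite -hS.
apply: pcvgB; first exact: pcvgZ.
apply: (@pcvg_sum _ (index_enum 'I_n) (fun (i : 'I_n) N lam => H N lam (val i) * E N lam (n - i)%N)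
  (fun i : 'I_n => h (val i) * e (n - i)%N)) => i.
by apply: pcvgM; [apply: IH; exact: ltn_ord|exact: cE].
Qed.

End LogarithmicDerivative.
End ConvergenceInProbability.

(** * Rational generating functions as products of geometric series *)

Section Geometric.
Variable R : realType.
Notation fser := (fser R).

Definition geo (x : R) : fser := fun n => x ^+ n.

Lemma geoE x : geo x - x *: (fX R * geo x) = 1.
Proof.
apply/funext => -[|n]; rewrite fserB fserZ fXM fser1 /geo ?expr0 ?mulr0 ?subr0 //.
by rewrite exprS subrr.
Qed.

Lemma geo_inv x : (1 - x *: fX R) * geo x = 1.
Proof. by rewrite mulrBl mul1r -scalerAl geoE. Qed.

Lemma geo_mulI (f g : fser) x : (1 - x *: fX R) * f = (1 - x *: fX R) * g -> f = g.
Proof.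
by move=> e; rewrite -[f]mul1r -[g]mul1r -(geo_inv x) ![_ * geo x]mulrC -!mulrA e.
Qed.

Lemma fD_geo x : fD (geo x) = x *: (geo x * geo x).
Proof.
apply: (@geo_mulI _ _ x); rewrite -scalerAr mulrA geo_inv mul1r.
have := congr1 (@fD R) (geo_inv x); rewrite fDM fDB fDZ fDX fD1 sub0r => e.
by apply/eqP; rewrite -subr_eq0 -e addrC mulNr -scalerAl mul1r.
Qed.

Lemma scale_as_mul (c : R) : exists e : fser, forall v : fser, c *: v = e * v.
Proof. by exists c%:A => v; rewrite mulr_algl. Qed.

Lemma fD_geo_ratio x y : fD ((1 - y *: fX R) * geo x) =
  (x *: geo x - y *: geo y) * ((1 - y *: fX R) * geo x).
Proof.
rewrite fDM fD_geo fDB fDZ fDX fD1 sub0r; have := geo_inv y.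
set A := 1 - y *: fX R => Ay.
have [X HX] := scale_as_mul x; have [Y HY] := scale_as_mul y; rewrite !HX !HY.
have -> : (X * geo x - Y * geo y) * (A * geo x) =
  X * geo x * A * geo x - Y * (A * geo y) * geo x by ring.
by rewrite Ay; ring.
Qed.

Lemma fD_prod_geo_ratio (J : Type) (r : seq J) (x y : J -> R) :
  fD (\prod_(j <- r) ((1 - y j *: fX R) * geo (x j))) =
  (\sum_(j <- r) (x j *: geo (x j) - y j *: geo (y j))) *
  \prod_(j <- r) ((1 - y j *: fX R) * geo (x j)).
Proof.
elim: r => [|j r IH]; first by rewrite !big_nil fD1 mul0r.
rewrite !big_cons fDM fD_geo_ratio IH; move: (_ - _) (_ * geo _) => a b; ring.
Qed.

Lemma geo_ratioE x c : (1 - (x + c) *: fX R) * geo x = 1 - c *: (fX R * geo x).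
Proof. by rewrite scalerDl opprD addrA mulrBl geo_inv -scalerAl. Qed.

Lemma fX_geo_partial u v : u != v ->
  (fX R * geo u) * (fX R * geo v) = (u - v)^-1 *: (fX R * geo u - fX R * geo v).
Proof.
move=> uv; have d : u - v != 0 by rewrite subr_eq0.
apply: (scalerI d); rewrite scalerA mulfV // scale1r.
apply: (@geo_mulI _ _ u); apply: (@geo_mulI _ _ v).
have -> : (1 - v *: fX R) * ((1 - u *: fX R) * ((u - v) *: (fX R * geo u * (fX R * geo v)))) =
  (u - v) *: (fX R * fX R * (((1 - u *: fX R) * geo u) * ((1 - v *: fX R) * geo v))).
  rewrite -!scalerAr; congr (_ *: _); ring.
have -> : (1 - v *: fX R) * ((1 - u *: fX R) * (fX R * geo u - fX R * geo v)) =
  fX R * ((1 - v *: fX R) * ((1 - u *: fX R) * geo u) -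
          (1 - u *: fX R) * ((1 - v *: fX R) * geo v)) by ring.
rewrite !geo_inv !mulr1 scalerBl.
by have [U HU] := scale_as_mul u; have [V HV] := scale_as_mul v; rewrite !HU !HV; ring.
Qed.

(** Partial fractions in [z] of the product of the [(1 - (u_i + c) z) / (1 - u_i z)]. When a node
    [m0] is added, each product of two simple fractions splits by [fX_geo_partial]. *)
Lemma prod_geo_ratio (I : finType) (u : I -> R) (c : R) : injective u ->
  \prod_i ((1 - (u i + c) *: fX R) * geo (u i)) =
  1 - c *: \sum_i (\prod_(j | j != i) (1 - c / (u i - u j))) *: (fX R * geo (u i)).
Proof.
move=> uinj.
suff H (s : seq I) : uniq s -> \prod_(i <- s) ((1 - (u i + c) *: fX R) * geo (u i)) =
  1 - c *: \sum_(i <- s) (\prod_(j <- s | j != i) (1 - c / (u i - u j))) *: (fX R * geo (u i)).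
  exact: H (index_enum_uniq I).
elim: s => [|m0 s IH] us; first by rewrite !big_nil scaler0 subr0.
case/andP: us => m0s us.
pose Q j := \prod_(n <- s | n != j) (1 - c / (u j - u n)).
pose g j := fX R * geo (u j).
have {}IH : \prod_(i <- s) ((1 - (u i + c) *: fX R) * geo (u i)) =
  1 - c *: \sum_(j <- s) Q j *: g j by exact: IH.
rewrite !big_cons IH geo_ratioE eqxx /=.
have pf := @partial_fractions_seq R I s (fun=> 1) (fun=> - c) u (u m0) us (in2W uinj) _.
have {}pf : \prod_(j <- s | j != m0) (1 - c / (u m0 - u j)) =
    1 + \sum_(m <- s) - c / (u m0 - u m) * Q m.
  have -> : \prod_(j <- s | j != m0) (1 - c / (u m0 - u j)) =
     \prod_(m <- s) (1 + - c / (u m0 - u m)).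
    rewrite big_seq_cond [RHS]big_seq; apply: eq_big => [j|j _]; last by rewrite mulNr.
    by case: (boolP (j \in s)) => //= js; apply: contraNneq m0s => <-.
  rewrite pf ?big1_eq.
    by congr (_ + _); apply: eq_bigr => m _; congr (_ * _); apply: eq_bigr => n _; rewrite mulNr.
  by move=> m ms; rewrite (inj_eq uinj); apply: contraNneq m0s => ->.
have -> : \sum_(j <- s) (\prod_(n <- m0 :: s | n != j) (1 - c / (u j - u n))) *:
    (fX R * geo (u j)) = \sum_(j <- s) (1 - c / (u j - u m0)) *: (Q j *: g j).
  rewrite !big_seq; apply: eq_bigr => j js; rewrite big_cons scalerA.
  by rewrite ifT //; apply: contraNneq m0s => ->.
have gg j : j \in s -> g m0 * g j = (u m0 - u j)^-1 *: (g m0 - g j).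
  by move=> js; apply: fX_geo_partial; rewrite (inj_eq uinj); apply: contraNneq m0s => ->.
rewrite pf -/(g m0).
(* [S0] corrects the coefficient at the new node and [S2] those at the old ones; [gS] shows that
   both come from the cross terms. *)
pose S0 := \sum_(j <- s) - c / (u m0 - u j) * Q j.
pose S1 := \sum_(j <- s) Q j *: g j.
pose S2 := \sum_(j <- s) (c / (u m0 - u j)) *: (Q j *: g j).
have -> : \sum_(j <- s) (1 - c / (u j - u m0)) *: (Q j *: g j) = S1 + S2.
  rewrite -big_split; apply: eq_bigr => j _ /=.
  by rewrite scalerBl scale1r -scaleNr -mulrN -invrN opprB.
have gS : c *: (g m0 * S1) = - (S0 *: g m0) - S2.
  rewrite mulr_sumr scaler_sumr scaler_suml -!sumrN -big_split /=.
  rewrite !big_seq; apply: eq_bigr => j js.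
  rewrite -scalerAr gg // !scalerA mulNr mulNr scaleNr opprK -scalerBr.
  by congr (_ *: _); ring.
rewrite -/S0 -/S1 mulrBr mulr1 mulrBl mul1r -scalerAl -scalerAr gS.
rewrite scalerDl scale1r.
rewrite !scalerDr !scalerN.
have [C HC] := scale_as_mul c; rewrite !HC; ring.
Qed.

End Geometric.

Section Transfer.
Variable R : realType.
Notation fser := (fser R).

Lemma sigl_lt N (lam : sig_t N) (i j : 'I_N) : (i < j)%N -> sigl lam j < sigl lam i.
Proof. exact: sigl_dec. Qed.

Lemma sigl_inj N (lam : sig_t N) : injective (sigl lam).
Proof.
move=> i j e; apply: ord_inj; apply/eqP; rewrite eqn_leq (leqNgt i) (leqNgt j).
by apply/andP; split; apply/negP => /(sigl_lt lam); rewrite e ltxx.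
Qed.

Lemma pp_atom_inj N (lam : sig_t N) : injective (pp_atom R lam).
Proof.
move=> i j; have N0 : (0 < N)%N by case: (N) i => [[]|].
rewrite !pp_atomE => /(mulIf _) e; apply/(@sigl_inj _ lam)/(@intr_inj R)/e.
by rewrite invr_eq0 pnatr_eq0 -lt0n.
Qed.

Lemma pp_weightE (q : R) N (lam : sig_t N) (i : 'I_N) :
  pp_weight q lam i = \prod_(j | j != i) (1 - (q / N%:R) / (pp_atom R lam i - pp_atom R lam j)).
Proof.
have n0 : N%:R != 0 :> R by rewrite pnatr_eq0; case: (N) i => [[]|].
apply: eq_bigr => j ji; rewrite !pplE !pp_atomE.
have d : (sigl lam i)%:~R - (sigl lam j)%:~R != 0 :> R.
  by rewrite subr_eq0 eqr_int (inj_eq (@sigl_inj _ lam)) eq_sym.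
rewrite -mulrBl opprB addrA subrK.
by field; rewrite n0 d.
Qed.

Definition pp_gf (q : R) N (lam : sig_t N) : fser :=
  1 - q *: (shifted_gf (pp_moment q lam) : fser).

Definition pp_logderiv (q : R) N (lam : sig_t N) : fser := fun n =>
  \sum_i (pp_atom R lam i ^+ n.+1 - (pp_atom R lam i + q / N%:R) ^+ n.+1).

Lemma pp_gfE (q : R) N (lam : sig_t N) :
  pp_gf q lam = \prod_i ((1 - (pp_atom R lam i + q / N%:R) *: fX R) * geo (pp_atom R lam i)).
Proof.
rewrite (prod_geo_ratio _ (@pp_atom_inj _ lam)) /pp_gf; congr (1 - _).
apply/funext => n; rewrite !fserZ -mulrA; congr (_ * _).
rewrite fser_sum; case: n => [|n] /=.
  by rewrite big1 ?mulr0 // => i _; rewrite fserZ fXM mulr0.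
rewrite /pp_moment; congr (_ * _); apply: eq_bigr => i _.
by rewrite fserZ fXM -pp_weightE.
Qed.

Lemma pp_gf0 (q : R) N (lam : sig_t N) : pp_gf q lam 0%N = 1.
Proof. by rewrite /pp_gf fserB fserZ fser1 /= mulr0 subr0. Qed.

Lemma fD_pp_gf (q : R) N (lam : sig_t N) : fD (pp_gf q lam) = pp_logderiv q lam * pp_gf q lam.
Proof.
rewrite pp_gfE fD_prod_geo_ratio; congr (_ * _); apply/funext => n.
rewrite fser_sum; apply: eq_bigr => i _.
by rewrite fserB !fserZ /geo !exprS.
Qed.

Lemma pp_moment0 N (lam : sig_t N) k :
  pp_moment 0 lam k = N%:R^-1 * \sum_i pp_atom R lam i ^+ k.
Proof.
rewrite /pp_moment; congr (_ * _); apply: eq_bigr => i _; rewrite /pp_weight big1 ?mul1r // => j ji.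
rewrite subr0 mulfV // !pplE opprB addrA subrK subr_eq0 eqr_int.
by rewrite (inj_eq (@sigl_inj _ lam)) eq_sym.
Qed.

(* Binomial expansion: the leading coefficient is [- q (n + 1)] and the other ones are O(1/N). *)
Lemma pp_logderivE (q : R) N (lam : sig_t N) n : (0 < N)%N ->
  pp_logderiv q lam n = - q * \sum_(r < n.+1)
    'C(n.+1, r.+1)%:R * (q / N%:R) ^+ r * pp_moment 0 lam (n - r).
Proof.
move=> N0; have n0 : N%:R != 0 :> R by rewrite pnatr_eq0 -lt0n.
have e i : pp_atom R lam i ^+ n.+1 - (pp_atom R lam i + q / N%:R) ^+ n.+1 =
   - (q / N%:R) * \sum_(r < n.+1) 'C(n.+1, r.+1)%:R * (q / N%:R) ^+ r * pp_atom R lam i ^+ (n - r).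
  rewrite exprDn big_ord_recl /= subn0 expr0 mulr1 bin0 mulr1n opprD addrA subrr add0r.
  rewrite mulNr mulr_sumr; congr (- _); apply: eq_bigr => r _.
  by rewrite /bump /= add1n subSS exprS -[_ *+ 'C(_, _)]mulr_natl; ring.
rewrite /pp_logderiv (eq_bigr _ (fun i _ => e i)) -mulr_sumr exchange_big /=.
rewrite !mulNr -[in LHS]mulrA; congr (- (_ * _)).
rewrite mulr_sumr; apply: eq_bigr => r _.
by rewrite pp_moment0 -mulr_sumr mulrCA.
Qed.

Section Limit.
Variables (rho : forall N : nat, sig_t N -> R) (psi : fser).
Arguments rho : clear implicits.
Hypothesis rhoP : forall N, is_prob (rho N).
Hypothesis pcvg1 : forall k, pcvg rho (fun N lam => pp_moment 1 lam k) (fmoment psi 1 k).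

Let L : fser := lagr (fphi psi) (fell R).
Let e (q : R) : fser := fps_exp (- q *: L).
Let h (q : R) : fser := - q *: fD L.

Let L0 : L 0%N = 0. Proof. exact: fell0. Qed.
Let e0 q : e q 0%N = 1. Proof. exact: fps_exp0. Qed.
Let eh q : fD (e q) = h q * e q.
Proof. by rewrite /e fD_fps_exp ?fDZ // fserZ L0 mulr0. Qed.
Let eE q : e q = 1 - q *: (shifted_gf (fmoment psi q) : fser).
Proof. by rewrite shifted_fmoment. Qed.

Let Nnear : \forall N \near \oo, (0 < N)%N.
Proof. exact: nbhs_infty_gt. Qed.

Let cvg_invX (q : R) r : (fun N : nat => (q / N%:R) ^+ r) @ \oo --> ((r == 0%N)%:R : R).
Proof.
have c1 : (fun N : nat => q / N%:R) @ \oo --> (0 : R).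
  rewrite -[X in _ --> X](mulr0 q); apply: cvgM; first exact: cvg_cst.
  apply/cvgrPdist_le => eps e0'; apply: filterS2 (invn_near 1 e0') Nnear => N + N0.
  by rewrite mul1r sub0r normrN ger0_norm ?invr_ge0.
elim: r => [|r IH]; first by under eq_fun do rewrite expr0; exact: cvg_cst.
under eq_fun do rewrite exprS.
have -> : ((r.+1 == 0%N)%:R : R) = 0 * (r == 0%N)%:R by rewrite mul0r.
exact: (cvgM c1 IH).
Qed.

(** For [q = 1] the logarithmic derivative is [- (n + 1)] times a normalized power sum plus lower
    power sums with powers of [1 / N]. Strong induction inverts this triangular system, since the
    lower power sums already converge. *)
Let pcvg0 k : pcvg rho (fun N lam => pp_moment 0 lam k) (fD L k / k.+1%:R).
Proof.
have cE : fpcvg rho (fun N lam => pp_gf 1 lam) (e 1).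
  move=> [|n]; rewrite eE.
    apply: (pcvg_ext rhoP _ (pcvg_cst rho _)); apply: nearW => N; apply/funext => lam.
    by rewrite pp_gf0 fserB fserZ fser1 /= mulr0 subr0.
  rewrite fserB fserZ fser1 mul1r /=.
  apply: (pcvg_ext rhoP _ (pcvgB rhoP (pcvg_cst rho 0) (pcvg1 n))); apply: nearW => N.
  by apply/funext => lam; rewrite /pp_gf fserB fserZ fser1 mul1r.
have cH := fpcvg_logderiv rhoP (fun N lam => pp_gf0 1 lam) (fun N lam => fD_pp_gf 1 lam)
  (e0 1) (eh 1) cE.
elim/ltn_ind: k => n IH.
have n1 : n.+1%:R != 0 :> R by rewrite pnatr_eq0.
pose rest (i : 'I_n) N (lam : sig_t N) : R :=
  ('C(n.+1, i.+2)%:R * (1 / N%:R) ^+ i.+1) * pp_moment 0 lam (n - i.+1) .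
have crest i : pcvg rho (rest i) 0.
  rewrite -[X in pcvg _ _ X](mul0r (fD L (n - i.+1)%N / (n - i.+1).+1%:R)).
  apply: (pcvgM rhoP); last by apply: IH; have := ltn_ord i; lia.
  apply: (@pcvg_seq _ _ (fun N => 'C(n.+1, i.+2)%:R * (1 / N%:R) ^+ i.+1)).
  rewrite -[X in _ --> X](mulr0 ('C(n.+1, i.+2)%:R : R)).
  have c0 : (fun N : nat => (1 / N%:R) ^+ i.+1) @ \oo --> (0 : R) := @cvg_invX 1 i.+1.
  by apply: cvgM; [exact: cvg_cst|exact: c0].
have := pcvgZ rhoP (- n.+1%:R^-1) (pcvgD rhoP (cH n) (pcvg_sum rhoP (index_enum 'I_n) crest)).
rewrite big1 ?addr0; last by [].
have -> : - n.+1%:R^-1 * h 1 n = fD L n / n.+1%:R.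
  by rewrite /h fserZ mulN1r mulrNN mulrC.
apply: (pcvg_ext rhoP); apply: filterS Nnear => N N0; apply/funext => lam.
rewrite pp_logderivE // big_ord_recl /= expr0 mulr1 bin1 subn0 mulN1r.
rewrite opprD -addrA [X in - _ + X]addrC.
have -> : \sum_(j <- index_enum 'I_n) rest j N lam =
  \sum_(i < n) 'C(n.+1, (bump 0 i).+1)%:R * (1 / N%:R) ^+ bump 0 i * pp_moment 0 lam (n - bump 0 i).
  by [].
by rewrite subrr addr0 mulrNN mulKf.
Qed.

Lemma pcvg_pp_moment (q : R) k :
  pcvg rho (fun N lam => pp_moment q lam k) (fmoment psi q k).
Proof.
case: (eqVneq q 0) => [->|q0].
  have -> : fmoment psi 0 k = fD L k / k.+1%:R; last exact: pcvg0.
  rewrite /fD mulfK ?pnatr_eq0 //.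
  by rewrite /L -shifted_fmoment0.
have cH : fpcvg rho (fun N lam => pp_logderiv q lam) (h q).
  move=> n.
  pose T (r : 'I_n.+1) N (lam : sig_t N) : R :=
    ('C(n.+1, r.+1)%:R * (q / N%:R) ^+ r) * pp_moment 0 lam (n - r).
  (* Only the term [r = 0] has a nonzero limit. *)
  have cT r : pcvg rho (T r) ('C(n.+1, r.+1)%:R * (val r == 0%N)%:R * (fD L (n - r)%N / (n - r).+1%:R)).
    apply: (pcvgM rhoP); last exact: pcvg0.
    apply: (@pcvg_seq _ _ (fun N => 'C(n.+1, r.+1)%:R * (q / N%:R) ^+ r)).
    by apply: cvgM; [exact: cvg_cst|exact: (@cvg_invX q r)].
  have := pcvgZ rhoP (- q) (pcvg_sum rhoP (index_enum 'I_n.+1) cT).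
  rewrite big_ord_recl big1 ?addr0 => [|i _]; last by rewrite /= mulr0 mul0r.
  rewrite /= bin1 mulr1 subn0 [n.+1%:R * _]mulrCA mulfV ?pnatr_eq0 // mulr1.
  rewrite -[- q * fD L n]/(h q n).
  apply: (pcvg_ext rhoP); apply: filterS Nnear => N N0; apply/funext => lam.
  by rewrite pp_logderivE.
have := fpcvg_solve rhoP (fun N lam => pp_gf0 q lam) (fun N lam => fD_pp_gf q lam)
  (e0 q) (eh q) cH => /(_ k.+1) /(pcvgZ rhoP (- q^-1)).
rewrite eE fserB fserZ fser1 sub0r mulrNN mulKf //=.
apply: (pcvg_ext rhoP); apply: nearW => N; apply/funext => lam.
by rewrite /pp_gf fserB fserZ fser1 sub0r mulrNN mulKf.
Qed.

End Limit.
End Transfer.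

(** * Quantile functions and the limit measure *)

Section Quantile.
Variables (R : realType).
Notation mu := (@lebesgue_measure R).

Lemma quantile_exists (N : nat) (x w : nat -> R) :
  (forall i, (i.+1 < N)%N -> x i.+1 <= x i) -> (forall i, 0 <= w i) ->
  \sum_(i < N) w i = 1 ->
  exists2 X : R -> R, nonincreasing_fun X &
    forall f : R -> R, measurable_fun setT f -> (forall y, 0 <= f y) ->
    (\int[mu]_(t in `[0%R, 1%R]) (f (X t))%:E = (\sum_(i < N) w i * f (x i))%:E)%E.
Proof.
move=> xd w0 w1.
pose c n := \sum_(i < n) w i.
have cS n : c n.+1 = c n + w n by rewrite /c big_ord_recr.
have cd m n : (m <= n)%N -> c m <= c n.
  move=> /subnKC <-; elim: (n - m)%N => [|k IH]; first by rewrite addn0.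
  by rewrite addnS cS (le_trans IH) // lerDl.
(* The step function equal to [x i] between consecutive partial sums of the weights, written as a
   sum of jumps so that monotonicity is visible. *)
pose X (t : R) : R := x 0%N + \sum_(j < N.-1) (x j.+1 - x j) * (c j.+1 < t)%R%:R.
have Xd : nonincreasing_fun X.
  move=> s t ts; rewrite /X lerD2l; apply: ler_sum => j _.
  rewrite ler_wnM2l //; first by rewrite subr_le0 xd //; have := ltn_ord j; lia.
  rewrite ler_nat; case: (ltP (c j.+1) s) => // h.
  by rewrite (lt_le_trans h ts).
have XE i t : (i < N)%N -> c i < t <= c i.+1 -> X t = x i.
  move=> iN /andP[h1 h2]; rewrite /X.
  have -> : \sum_(j < N.-1) (x j.+1 - x j) * (c j.+1 < t)%R%:R =
     \sum_(j < N.-1 | (j < i)%N) (x j.+1 - x j).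
    rewrite [RHS]big_mkcond; apply: eq_bigr => j _; case: ltnP => ji.
      by rewrite (le_lt_trans (cd _ _ ji) h1) mulr1.
    by rewrite ltNge (le_trans h2 (cd _ _ _)) ?mulr0.
  have iN' : (i <= N.-1)%N by lia.
  rewrite -(big_ord_widen _ (fun j => x j.+1 - x j) iN').
  by rewrite -(big_mkord xpredT (fun j => x j.+1 - x j)) telescope_sumr // addrC subrK.
exists X => // f mf f0.
have mX (D : set R) : measurable D -> measurable_fun D X by move=> mD; exact: (nonincreasing_measurable mD Xd).
have mfX (D : set R) : measurable D -> measurable_fun D (fun t => (f (X t))%:E).
  by move=> mD; apply/measurable_EFinP; apply: measurableT_comp => //; exact: mX.
have H n : (n <= N)%N ->
  (\int[mu]_(t in `]0%R, c n]) (f (X t))%:E = (\sum_(i < n) w i * f (x i))%:E)%E.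
  elim: n => [|n IH] nN.
    by rewrite /c !big_ord0 set_itvoc0 integral_set0.
  have c0 : 0 <= c n by rewrite sumr_ge0.
  have cn : c n <= c n.+1 by exact: cd.
  have -> : `]0, c n.+1]%classic = `]0, c n] `|` `]c n, c n.+1] :> set R.
    by rewrite -itv_bndbnd_setU // bnd_simp.
  rewrite ge0_integral_setU //=.
  - rewrite (IH (ltnW nN)) big_ord_recr EFinD; congr (_ + _)%E.
    rewrite (eq_integral (cst (f (x n))%:E)); last first.
      by move=> t; rewrite inE /= in_itv /= => ht; rewrite (XE n).
    rewrite integral_cst //= lebesgue_measure_itv /= lte_fin.
    rewrite EFinM muleC; case: ltP => [_|h]; first by rewrite -EFinD cS addrAC subrr add0r.
    have -> : w n = 0 by have := cS n; have := w0 n; lra.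
    by [].
  - by apply: mfX; exact: measurableU.
  - by move=> t _; rewrite lee_fin.
  - rewrite disj_set2E; apply/eqP; apply/seteqP; split => t //= []; rewrite !in_itv /=.
    by move=> /andP[_ h1] /andP[h2 _]; move: (lt_le_trans h2 h1); rewrite ltxx.
have := H N (leqnn N); rewrite [c N]w1 => <-.
by rewrite [RHS]integral_itv_obnd_cbnd //; exact: mfX.
Qed.

(** If [X t] is nonnegative then [X] is at least as large on all of [[0, t]], otherwise it is at
    least as negative on [[t, 1]]; the integral of the square over that interval bounds [X t]. *)
Lemma nonincreasing_L2_bound (X : R -> R) (B : R) : nonincreasing_fun X ->
  (\int[mu]_(t in `[0%R, 1%R]) (X t ^+ 2)%:E <= B%:E)%E ->
  forall t, 0 < t < 1 -> `|X t| <= 1 + B / t + B / (1 - t).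
Proof.
move=> Xd XB t /andP[t0 t1].
have s0 : 0 < 1 - t by rewrite subr_gt0.
have mX2 (D : set R) : measurable D -> measurable_fun D (fun t => (X t ^+ 2)%:E).
  move=> mD; apply/measurable_EFinP; apply: (@measurableT_comp _ _ _ _ _ _ (fun y : R => y ^+ 2)) => //.
  exact: (nonincreasing_measurable mD Xd).
have key (D : set R) (c : R) : measurable D -> D `<=` `[0%R, 1%R] -> mu D = c%:E ->
    (forall s, D s -> X t ^+ 2 <= X s ^+ 2) -> X t ^+ 2 * c <= B.
  move=> mD D01 Dc HD; rewrite -lee_fin; apply: le_trans XB.
  apply: (@le_trans _ _ (\int[mu]_(s in D) (X s ^+ 2)%:E)%E); last first.
    by apply: ge0_subset_integral => //; [exact: mX2|move=> s _; rewrite lee_fin sqr_ge0].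
  have -> : ((X t ^+ 2 * c)%:E = \int[mu]_(s in D) (cst (X t ^+ 2)%:E s))%E.
    by rewrite integral_cst // [X in (_ * X)%E]Dc EFinM.
  by apply: ge0_le_integral => //; [move=> s _; rewrite lee_fin sqr_ge0|exact: mX2].
have B0 : 0 <= B.
  by rewrite -lee_fin; apply: le_trans XB; apply: integral_ge0 => s _; rewrite lee_fin sqr_ge0.
have d1 : 0 <= B / t by rewrite divr_ge0 // ltW.
have d2 : 0 <= B / (1 - t) by rewrite divr_ge0 // ltW.
have n2 : `|X t| <= 1 + X t ^+ 2 by rewrite -[X t ^+ 2]real_normK ?num_real //; nra.
case: (leP 0 (X t)) => X0.
  have : X t ^+ 2 * t <= B.
    apply: (key `[0%R, t]%classic) => //.
    - by move=> s /=; rewrite !in_itv /= => /andP[-> h]; rewrite (le_trans h) // ltW.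
    - by rewrite lebesgue_measure_itv /= lte_fin t0 -EFinD subr0.
    - move=> s /=; rewrite in_itv /= => /andP[_ st].
      by rewrite lerXn2r ?nnegrE ?(le_trans X0) // Xd.
  rewrite -ler_pdivlMr // => h; lra.
have : X t ^+ 2 * (1 - t) <= B.
  apply: (key `[t, 1%R]%classic) => //.
  - by move=> s /=; rewrite !in_itv /= => /andP[h ->]; rewrite andbT (le_trans _ h) // ltW.
  - by rewrite lebesgue_measure_itv /= lte_fin t1 -EFinD.
  - move=> s /=; rewrite in_itv /= => /andP[ts _].
    have h := Xd _ _ ts; rewrite -sqrrN -[leRHS]sqrrN lerXn2r ?nnegrE ?lerN2 // oppr_ge0 ?(ltW X0) //.
    by rewrite (le_trans h) // ltW.
rewrite -ler_pdivlMr // => h; lra.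
Qed.

Section Selection.
Variables (X : nat -> R -> R) (C : R -> R).
Hypothesis Xd : forall n, nonincreasing_fun (X n).
Hypothesis XC : forall n t, 0 < t < 1 -> `|X n t| <= C t.

Lemma ultra_limit (U : set_system nat) (x : nat -> R) (c : R) : UltraFilter U ->
  (forall n, `|x n| <= c) -> exists l : R, x @ U --> l.
Proof.
move=> UU xc.
have [l [_ cl]] : `[- c, c]%classic `&` cluster (x @ U) !=set0.
  apply: (@segment_compact R (- c) c).
  apply: (@filterE _ U _ (fun n => `[- c, c]%classic (x n))) => n /=.
  by rewrite in_itv /= -ler_norml xc.
exists l => V nV; have [//|UV] := in_ultra_setVsetC (x @^-1` V) UU.
by have [y []] := cl (~` V) V UV nV.
Qed.

(** An ultrafilter gives limits at all points of the interval at once, and [L] inherits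
    monotonicity. An honest sequence of indices is then extracted for the countably many rational
    points. *)
Lemma helly_selection : exists (phi : nat -> nat) (L : R -> R),
  (forall n, (n <= phi n)%N) /\
  (forall s t, 0 < s -> s <= t -> t < 1 -> L t <= L s) /\
  (forall r : rat, 0 < (ratr r : R) < 1 -> (fun n => X (phi n) (ratr r)) @ \oo --> L (ratr r)).
Proof.
have [U [UU Uoo]] := @ultraFilterLemma nat \oo _.
have HL t : exists l : R, 0 < t < 1 -> (X ^~ t) @ U --> l.
  case: (boolP (0 < t < 1)) => ht; last by exists 0.
  by have [l hl] := ultra_limit UU (fun n => XC n ht); exists l.
pose L t := projT1 (cid (HL t)).
have LP t : 0 < t < 1 -> (X ^~ t) @ U --> L t := projT2 (cid (HL t)).
have near_L t e : 0 < t < 1 -> 0 < e -> U [set n | `|L t - X n t| < e].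
  by move=> ht e0; have /cvgrPdist_lt/(_ e e0) := LP t ht.
(* The index [n] is close to the limit at the rationals among the first [m] in the enumeration by
   [pickle]. *)
have pick (m : nat) : exists n, (m <= n)%N /\ forall r : rat, (pickle r < m)%N ->
    0 < (ratr r : R) < 1 -> `|L (ratr r) - X n (ratr r)| < m.+1%:R^-1.
  have h1 : U [set n | (m <= n)%N] by apply: Uoo; exact: nbhs_infty_ge.
  have h2 : U [set n | forall j : 'I_m, forall r : rat, pickle r = j ->
      0 < (ratr r : R) < 1 -> `|L (ratr r) - X n (ratr r)| < m.+1%:R^-1].
    apply: filter_forall => j.
    case: (pselect (exists2 r : rat, pickle r = j & 0 < (ratr r : R) < 1)) => [[r rj hr]|h].
      apply: filterS (near_L (ratr r) m.+1%:R^-1 hr _) => [n hn r' r'j _|]; last by rewrite invr_gt0.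
      by have -> : r' = r by apply: (pcan_inj pickleK); rewrite r'j.
    by apply: filterE => n r rj hr; exfalso; apply: h; exists r.
  have [n [n1 n2]] := filter_ex (filterI h1 h2).
  by exists n; split => // r hr hr'; exact: (n2 (Ordinal hr) r).
pose phi m := projT1 (cid (pick m)).
have phiP m := projT2 (cid (pick m)).
exists phi, L; split; first by move=> n; have [] := phiP n.
split=> [s t s0 st t1|r hr].
  have hs : 0 < s < 1 by rewrite s0 (le_lt_trans st t1).
  have ht : 0 < t < 1 by rewrite (lt_le_trans s0 st).
  rewrite leNgt; apply/negP => h.
  have e0 : 0 < (L t - L s) / 2 by rewrite divr_gt0 // subr_gt0.
  have [n [n1 n2]] := filter_ex (filterI (near_L s _ hs e0) (near_L t _ ht e0)).
  have := Xd n st; move: n1 n2 => /=; rewrite !ltr_norml => /andP[a _] /andP[_ c] d; lra.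
apply/cvgrPdist_le => e e0.
near=> m; have [_ H] := phiP m.
apply/ltW/(lt_le_trans (H r _ hr)).
  by near: m; exact: nbhs_infty_gt.
by near: m; apply: filterS (near_infty_natSinv_lt (PosNum e0)) => n /ltW.
Unshelve. all: by end_near. Qed.

Section JumpPoints.
Variable L : R -> R.
Hypothesis Ld : forall s t, 0 < s -> s <= t -> t < 1 -> L t <= L s.

(* A rational [q] as below determines the point [t]. *)
Definition jump_set := [set t : R | 0 < t < 1 /\ exists q : rat,
  (forall r, 0 < r < t -> ratr q < L r) /\ (forall r, t < r < 1 -> L r <= ratr q)].

Lemma countable_jump_set : countable jump_set.
Proof.
have [q Hq] : {q : R -> rat | forall t, jump_set t ->
   (forall r, 0 < r < t -> ratr (q t) < L r) /\ (forall r, t < r < 1 -> L r <= ratr (q t))}.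
  have H (t : R) : {q : rat | jump_set t ->
   (forall r, 0 < r < t -> ratr q < L r) /\ (forall r, t < r < 1 -> L r <= ratr q)}.
    apply: cid; case: (pselect (jump_set t)) => [[_ [q h]]|h]; first by exists q.
    by exists 0.
  by exists (fun t => projT1 (H t)) => t; exact: (projT2 (H t)).
(* The chosen rationals strictly decrease along the jump points, hence determine them. *)
have lt_q s t : jump_set s -> jump_set t -> s < t -> ratr (q t) < ratr (q s) :> R.
  move=> Es Et st; have [_ hs] := Hq s Es; have [ht _] := Hq t Et.
  have [/andP[s0 s1] _] := Es; have [/andP[t0 t1] _] := Et.
  have m1 : s < (s + t) / 2 by rewrite midf_lt.
  have m2 : (s + t) / 2 < t by rewrite midf_lt.
  apply: lt_le_trans (ht ((s + t) / 2) _) (hs ((s + t) / 2) _).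
    by rewrite m2 (lt_trans s0 m1).
  by rewrite m1 (lt_trans m2 t1).
apply/countable_injP; exists (fun t => pickle (q t)) => s t; rewrite !inE => Es Et e.
have {}e : q s = q t by apply: (pcan_inj pickleK).
case: (ltgtP s t) => // h.
  by have := lt_q s t Es Et h; rewrite e ltxx.
by have := lt_q t s Et Es h; rewrite e ltxx.
Qed.

(** If the left values stayed above [L t + e], a rational between [L t] and [L t + e] would separate
    the two sides and [t] would be a jump; the right side is similar. *)
Lemma jump_setP t e : 0 < t < 1 -> ~ jump_set t -> 0 < e ->
  (exists r : rat, 0 < (ratr r : R) < t /\ L (ratr r) <= L t + e) /\
  (exists r : rat, t < (ratr r : R) < 1 /\ L t - e <= L (ratr r)).
Proof.
move=> ht nE e0; have /andP[t0 t1] := ht; split; apply: contrapT => H; apply: nE; split => //.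
  have h : L t < L t + e by rewrite ltrDl.
  have [q] := rat_in_itvoo h; rewrite in_itv /= => /andP[q1 q2].
  exists q; split=> r /andP[r0 r1].
    have [p] := rat_in_itvoo r1; rewrite in_itv /= => /andP[p1 p2].
    apply: lt_trans q2 _; apply: lt_le_trans (Ld r0 (ltW p1) (lt_trans p2 t1)).
    rewrite ltNge; apply/negP => hp; apply: H; exists p; split => //.
    by rewrite (lt_trans r0 p1).
  by apply/ltW/(le_lt_trans _ q1)/Ld => //; exact: ltW.
have h : L t - e < L t by rewrite ltrBlDr ltrDl.
have [q] := rat_in_itvoo h; rewrite in_itv /= => /andP[q1 q2].
exists q; split=> r /andP[r0 r1].
  by apply: (lt_le_trans q2); apply: Ld => //; exact: ltW.
have [p] := rat_in_itvoo r0; rewrite in_itv /= => /andP[p1 p2].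
apply/ltW/(le_lt_trans (Ld (lt_trans t0 p1) (ltW p2) r1))/(lt_trans _ q1).
rewrite ltNge; apply/negP => hp; apply: H; exists p; split => //.
by rewrite p1 (lt_trans p2 r1).
Qed.

Lemma cvg_off_jumps (Y : nat -> R -> R) : (forall n, nonincreasing_fun (Y n)) ->
  (forall r : rat, 0 < (ratr r : R) < 1 -> (fun n => Y n (ratr r)) @ \oo --> L (ratr r)) ->
  forall t, 0 < t < 1 -> ~ jump_set t -> (fun n => Y n t) @ \oo --> L t.
Proof.
move=> Yd YL t ht nE; have /andP[t0 t1] := ht.
apply/cvgrPdist_le => e e0; have e2 : 0 < e / 2 by rewrite divr_gt0.
have [[r [/andP[r0 r1] hr]] [p [/andP[p0 p1] hp]]] := jump_setP ht nE e2.
have hr01 : 0 < (ratr r : R) < 1 by rewrite r0 (lt_trans r1).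
have hp01 : 0 < (ratr p : R) < 1 by rewrite p1 (lt_trans t0 p0).
have /cvgrPdist_le/(_ _ e2) cr := YL r hr01.
have /cvgrPdist_le/(_ _ e2) cp := YL p hp01.
apply: filterS2 cr cp => n; rewrite !ler_norml => /andP[a1 a2] /andP[b1 b2].
have := Yd n _ _ (ltW r1); have := Yd n _ _ (ltW p0); move: hr hp a1 b2.
move: (Y n (ratr r)) (Y n (ratr p)) (Y n t) (L (ratr r)) (L (ratr p)) (L t).
by move=> *; apply/andP; split; lra.
Qed.

End JumpPoints.

Lemma nonincreasing_open_measurable (L : R -> R) :
  (forall s t, 0 < s -> s <= t -> t < 1 -> L t <= L s) ->
  measurable_fun (`]0%R, 1%R[%classic : set R) L.
Proof.
move=> Ld; apply: (measurability (@RGenCInfty.G R)) => [|/= _ [_] [r] -> <-].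
  exact: RGenCInfty.measurableE.
apply: is_interval_measurable => s t [] /=.
rewrite !in_itv /= !andbT => /andP[s0 s1] hs [/andP[t0 t1] ht] u /andP[su ut] /=.
by rewrite !in_itv /= andbT (lt_le_trans s0 su) (le_lt_trans ut t1) (le_trans ht) // Ld // (lt_le_trans s0).
Qed.

End Selection.

(** [P] is the law of the limiting quantile function under the uniform distribution. Convergence
    holds off a countable set, and Fatou's lemma then gives an inequality only, since mass could
    escape to infinity. *)
Lemma quantile_limit (X : nat -> R -> R) (B : R) : (forall n, nonincreasing_fun (X n)) ->
  (forall n, (\int[mu]_(t in `[0%R, 1%R]) (X n t ^+ 2)%:E <= B%:E)%E) ->
  exists P : probability R R, forall (f : R -> R) (l : \bar R), continuous f ->
    (forall y, 0 <= f y) ->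
    (fun n => \int[mu]_(t in `[0%R, 1%R]) (f (X n t))%:E)%E @ \oo --> l ->
    (\int[P]_y (f y)%:E <= l)%E.
Proof.
move=> Xd XB.
pose C t := 1 + B / t + B / (1 - t).
have XC n t : 0 < t < 1 -> `|X n t| <= C t := nonincreasing_L2_bound (Xd n) (XB n) (t := t).
have [phi [L [phi_ge [Ld XL]]]] := helly_selection Xd XC.
pose Y n := X (phi n).
have Yd n : nonincreasing_fun (Y n) := Xd (phi n).
pose D : set R := `]0%R, 1%R[%classic.
have mD : measurable D by exact: measurable_itv.
pose J : set R := jump_set L.
have cJ : countable J by exact: countable_jump_set.
have J0 : mu J = 0 by exact: countable_lebesgue_measure0.
have mJ : measurable J by apply: countable_measurable => // t _; exact: measurable_set1.
(* [L] is controlled only inside the open interval, so it is set to 0 outside. *)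
have mL : measurable_fun setT (L \_ D).
  by apply/(measurable_restrictT L mD); exact: nonincreasing_open_measurable.
pose P0 := [the probability _ R of uniform_prob (@ltr01 R)].
pose Lm : {mfun _ >-> _} := MeasurableFun.Pack (MeasurableFun.Class
  (isMeasurableFun.Build _ _ (measurableTypeR R) R (L \_ D) mL)).
have LE t : D t -> (L \_ D) t = L t by move=> Dt; rewrite patchE mem_set.
have reduce (g : R -> R) : measurable_fun setT g -> (forall t, 0 <= g t) ->
    (\int[mu]_(t in `[0%R, 1%R]) (g t)%:E = \int[mu]_(t in D `\` J) (g t)%:E)%E.
  move=> mg g0.
  have mgE (A : set R) : measurable_fun A (fun t => (g t)%:E).
    by apply/measurable_EFinP; apply: measurable_funTS.
  rewrite -integral_itv_obnd_cbnd // -integral_itv_bndo_bndc //.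
  have e := @ge0_negligible_integral _ _ R mu D J (fun t => (g t)%:E) mJ mD (mgE D).
  by apply: e => // t _; rewrite lee_fin.
exists (distribution P0 Lm) => f l cf f0 cl.
have mf : measurable_fun setT f := continuous_measurable_fun cf.
have mfE : measurable_fun setT (fun y => (f y)%:E) by exact/measurable_EFinP.
rewrite ge0_integral_distribution //.
rewrite integral_uniform //; last 2 first.
- exact: (measurableT_comp mfE mL).
- by move=> y; rewrite lee_fin.
rewrite subr0 invr1 mul1e.
rewrite (reduce (f \o (L \_ D)) (measurableT_comp mf mL) (fun t => f0 _)).
have mfY n (A : set R) : measurable A -> measurable_fun A (fun t => (f (Y n t))%:E).
  move=> mA; apply/measurable_EFinP.
  exact: (measurableT_comp mf (nonincreasing_measurable mA (Yd n))).
have -> : (\int[mu]_(t in D `\` J) ((f \o (L \_ D)) t)%:E =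
           \int[mu]_(t in D `\` J) limn_einf (fun n => (f (Y n t))%:E))%E.
  apply: eq_integral => t; rewrite inE => -[Dt nJ] /=; rewrite LE //.
  have ct : (fun n => Y n t) @ \oo --> L t.
    by apply: (cvg_off_jumps Ld Yd) => //; move: Dt; rewrite /D /= in_itv.
  apply/esym; apply: (cvg_limn_einf_sup _).1.
  apply/cvg_EFin; first by near=> n.
  exact: (continuous_cvg _ (cf (L t)) ct).
have mDJ : measurable (D `\` J) by exact: measurableD.
have := @fatou _ _ R mu (D `\` J) mDJ (fun n t => (f (Y n t))%:E) (fun n => mfY n _ mDJ).
move=> /(_ (fun n t _ => f0 (Y n t))) h; apply: le_trans h _.
have cl' : (fun n => \int[mu]_(t in D `\` J) (f (Y n t))%:E)%E @ \oo --> l.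
  have e n : (\int[mu]_(t in D `\` J) (f (Y n t))%:E = \int[mu]_(t in `[0%R, 1%R]) (f (Y n t))%:E)%E.
    apply/esym/(reduce (f \o Y n)) => [|t]; last exact: f0.
    exact: (measurableT_comp mf (nonincreasing_measurable measurableT (Yd n))).
  under eq_fun do rewrite e.
  apply: (@cvg_comp _ _ _ phi _ _ \oo _ _ cl).
  by move=> A [k _ kA]; exists k => // n /= kn; apply: kA => /=; exact: leq_trans kn (phi_ge n).
by rewrite (cvg_limn_einf_sup cl').1.
Unshelve. all: by end_near. Qed.

End Quantile.

Lemma bounded_of_cvg (R : realType) (u : nat -> R) (l : R) : u @ \oo --> l ->
  exists B : R, forall n, u n <= B.
Proof.
move=> cu; have [B [_ HB]] := cvg_seq_bounded (cvgP _ cu).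
exists (B + 1) => n; apply: le_trans (ler_norm _) _.
by apply: (HB (B + 1) _ n I); rewrite ltrDl.
Qed.

(** Bounds on even moments give integrability of all powers. Equality of the moments is recovered
    from the one-sided bound because a small multiple of [y ^ (2 k)] plus a constant compensates the
    sign of [y ^ k], and constants are integrated exactly. *)
Lemma moment_limit_exists (R : realType) (N : nat -> nat) (x w : nat -> nat -> R) (m : nat -> R) :
  (forall n i, (i.+1 < N n)%N -> x n i.+1 <= x n i) -> (forall n i, 0 <= w n i) ->
  (forall n, \sum_(i < N n) w n i = 1) ->
  (forall k, (fun n => \sum_(i < N n) w n i * x n i ^+ k) @ \oo --> m k) ->
  exists P : probability R R, forall k,
    P.-integrable setT (fun y : R => (y ^+ k)%:E) /\ (\int[P]_y (y ^+ k)%:E = (m k)%:E)%E.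
Proof.
move=> xd w0 w1 cm.
have HX n : exists X : R -> R, nonincreasing_fun X /\
    forall f : R -> R, measurable_fun setT f -> (forall y, 0 <= f y) ->
    (\int[lebesgue_measure]_(t in `[0%R, 1%R]) (f (X t))%:E = (\sum_(i < N n) w n i * f (x n i))%:E)%E.
  by have [X h1 h2] := quantile_exists (xd n) (w0 n) (w1 n); exists X.
pose X n := projT1 (cid (HX n)).
have XP n := projT2 (cid (HX n)).
have cX (k : nat) : continuous (fun y : R => y ^+ k) by exact: exprn_continuous.
have [B HB] := bounded_of_cvg (cm 2).
have XB n : (\int[lebesgue_measure]_(t in `[0%R, 1%R]) (X n t ^+ 2)%:E <= B%:E)%E.
  have e := (XP n).2 (fun y => y ^+ 2) (continuous_measurable_fun (cX 2%N)) (fun y => sqr_ge0 y).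
  by rewrite e lee_fin.
have [P HP] := quantile_limit (fun n => (XP n).1) XB.
have {}HP (f : R -> R) (l : R) : continuous f -> (forall y, 0 <= f y) ->
    (fun n => \sum_(i < N n) w n i * f (x n i)) @ \oo --> l -> (\int[P]_y (f y)%:E <= l%:E)%E.
  move=> cf f0 cl; apply: HP => //.
  have e n : (\int[lebesgue_measure]_(t in `[0%R, 1%R]) (f (X n t))%:E =
      (\sum_(i < N n) w n i * f (x n i))%:E)%E.
    by apply: (XP n).2 => //; exact: continuous_measurable_fun.
  under eq_fun do rewrite e.
  by apply/cvg_EFin; first by near=> n.
have m_fun (f : R -> R) : continuous f -> measurable_fun setT (EFin \o f).
  by move=> cf; apply/measurable_EFinP; exact: continuous_measurable_fun.
have even_le k : (\int[P]_y (y ^+ (2 * k))%:E <= (m (2 * k)%N)%:E)%E.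
  by apply: HP => // y; rewrite mulnC exprM sqr_ge0.
have int_even k : P.-integrable setT (EFin \o (fun y : R => y ^+ (2 * k))).
  apply/integrableP; split; first exact: m_fun.
  apply: le_lt_trans (ltry (m (2 * k)%N)); apply: le_trans (even_le k).
  rewrite le_eqVlt; apply/orP; left; apply/eqP/eq_integral => y _ /=.
  by rewrite ger0_norm // mulnC exprM sqr_ge0.
have int_cst (c : R) : P.-integrable setT (EFin \o cst c) by exact: finite_measure_integrable_cst.
have int_pow k : P.-integrable setT (EFin \o (fun y : R => y ^+ k)).
  have := integrableD measurableT (int_cst 1) (int_even k).
  apply: le_integrable => //; first exact: m_fun.
  move=> y _; rewrite -[leLHS]/((`|y ^+ k|%R)%:E) -[leRHS]/((`|1 + y ^+ (2 * k)|%R)%:E).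
  rewrite lee_fin [leRHS]ger0_norm; last first.
    by rewrite addr_ge0 // mulnC exprM sqr_ge0.
  rewrite mulnC exprM -[X in 1 + X]real_normK ?num_real //.
  by move: `|y ^+ k| => z; nra.
have P1 : fine (P setT) = 1 by rewrite probability_setT.
exists P => k; split; first exact: int_pow.
rewrite -[LHS]fineK; last by apply: integrable_fin_num => //; exact: int_pow.
congr (_%:E); rewrite -/(Rintegral P setT (fun y => y ^+ k)).
set M := Rintegral _ _ _.
pose S := Rintegral P setT (fun y => y ^+ (2 * k)).
have key (s e : R) : s ^+ 2 = 1 -> 0 < e -> s * (M - m k) <= e * (m (2 * k)%N - S).
  move=> s1 e0; have [v vE] : exists v, v = (4 * e)^-1 by exists (4 * e)^-1.
  (* [f] is the nonnegative function [e * (y ^ k + s / (2 * e)) ^ 2]: its integral is only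
     known to be at most the limit, which for [s = 1] and [s = -1] gives two-sided bounds *)
  pose f y := e * y ^+ (2 * k) + (s * y ^+ k + v).
  have fE y : f y = e * (y ^+ k + s / (2 * e)) ^+ 2.
    rewrite /f mulnC exprM vE; have -> : (4 * e)^-1 = s ^+ 2 / (4 * e) by rewrite s1 mul1r.
    by field; rewrite gt_eqF.
  have cf : continuous f.
    move=> y; apply: cvgD; first by apply: cvgM; [exact: cvg_cst|exact: (cX (2 * k)%N y)].
    apply: cvgD; last exact: cvg_cst.
    by apply: cvgM; [exact: cvg_cst|exact: (cX k y)].
  have f0 y : 0 <= f y by rewrite fE mulr_ge0 ?sqr_ge0 // ltW.
  have cl : (fun n => \sum_(i < N n) w n i * f (x n i)) @ \oo -->
      e * m (2 * k)%N + (s * m k + v).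
    have E n : \sum_(i < N n) w n i * f (x n i) =
      e * (\sum_(i < N n) w n i * x n i ^+ (2 * k)) +
      (s * (\sum_(i < N n) w n i * x n i ^+ k) + v).
      have e4 : v = \sum_(i < N n) w n i * v by rewrite -mulr_suml w1 mul1r.
      rewrite [X in _ = _ + (_ + X)]e4 !mulr_sumr -!big_split /=.
      by apply: eq_bigr => i _; rewrite /f; ring.
    under eq_fun do rewrite E.
    apply: cvgD; first by apply: cvgM; [exact: cvg_cst|exact: cm].
    apply: cvgD; last exact: cvg_cst.
    by apply: cvgM; [exact: cvg_cst|exact: cm].
  have := HP f _ cf f0 cl.
  have i1 : P.-integrable setT (EFin \o (fun y : R => e * y ^+ (2 * k))).
    by apply: (integrableZl measurableT e (int_even k)).
  have i2 : P.-integrable setT (EFin \o (fun y : R => s * y ^+ k)).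
    by apply: (integrableZl measurableT s (int_pow k)).
  have i3 : P.-integrable setT (EFin \o (fun y : R => s * y ^+ k + v)).
    by apply: (integrableD measurableT i2 (int_cst v)).
  have i4 : P.-integrable setT (EFin \o f) by apply: (integrableD measurableT i1 i3).
  rewrite -[X in (X <= _)%E]fineK; last exact: (integrable_fin_num measurableT i4).
  rewrite lee_fin -/(Rintegral P setT f) /f (RintegralD measurableT i1 i3).
  rewrite (RintegralD measurableT i2 (int_cst _)) (RintegralZl _ measurableT (int_even k)).
  rewrite (RintegralZl _ measurableT (int_pow k)) -/M -/S Rintegral_cst //.
  rewrite [fine _]P1; rewrite mulr1 !mulrBr; lra.
have d0 : 0 <= m (2 * k)%N - S.
  rewrite subr_ge0 -lee_fin /S /Rintegral fineK ?even_le //.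
  exact: (integrable_fin_num measurableT (int_even k)).
have n1 : (-1) ^+ 2 = 1 :> R by rewrite sqrrN expr1n.
apply/eqP; rewrite -subr_eq0 -normr_le0; apply/ler_addgt0Pl => e e0; rewrite addr0.
(* Scaled so that the error from the even moment of order [2 k] is at most [e]; the 1 avoids a zero
   denominator. *)
have c0 : 0 < e / (1 + (m (2 * k)%N - S)) by rewrite divr_gt0 // ltr_pwDl.
have ce : e / (1 + (m (2 * k)%N - S)) * (m (2 * k)%N - S) <= e.
  rewrite mulrAC ler_pdivrMr ?ltr_pwDl //; nra.
have := key 1 _ (expr1n _ _) c0; have := key (-1) _ n1 c0 => a2 a1.
by rewrite ler_norml; apply/andP; split; lra.
Unshelve. all: by end_near. Qed.

(** * Positivity of the weights and existence of the limit measure *)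

Section PerelomovPopovMeasure.
Variables (R : realType) (q : R).

(** The differences of the shifted coordinates are nonzero integers, so subtracting [q] with
    [|q| <= 1] never reverses their sign. *)
Lemma pp_weight_ge0 N (lam : sig_t N) (i : 'I_N) : -1 <= q <= 1 -> 0 <= pp_weight q lam i.
Proof.
move=> /andP[q0 q1]; apply: prodr_ge0 => j ji.
have -> : ppl R lam i - ppl R lam j = (sigl lam i - sigl lam j)%:~R.
  by rewrite !pplE intrB opprB addrA subrK.
have : sigl lam i - sigl lam j != 0 by rewrite subr_eq0 (inj_eq (@sigl_inj _ lam)) eq_sym.
move: (sigl lam i - sigl lam j) => z z0.
case: (ltrgt0P z) => [zp|zn|z00]; last by rewrite z00 eqxx in z0.
- have h : (1 : R) <= z%:~R by rewrite -[1]/(1%:~R) ler_int.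
  by rewrite divr_ge0 //; lra.
- have h : z%:~R <= (-1 : R) by rewrite -[-1]/((-1)%:~R) ler_int; lia.
  by rewrite -mulrNN -invrN divr_ge0 //; lra.
Qed.

(** The constant coefficient of the logarithmic derivative of [pp_gf] is [N] times [- q / N], and it
    equals [- q] times the mass. *)
Lemma pp_moment_mass N (lam : sig_t N) : (0 < N)%N -> pp_moment q lam 0 = 1.
Proof.
move=> N0; have n0 : N%:R != 0 :> R by rewrite pnatr_eq0 -lt0n.
case: (eqVneq q 0) => [->|q0].
  by rewrite pp_moment0; under eq_bigr do rewrite expr0; rewrite sumr_const card_ord mulVf.
have := congr1 (@^~ 0%N) (fD_pp_gf q lam).
rewrite /= fserM0 pp_gf0 mulr1 /fD mulr1 /pp_gf fserB fserZ fser1 /= sub0r.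
rewrite /pp_logderiv (eq_bigr (fun=> - (q / N%:R))) => [|i _]; last by rewrite !expr1; ring.
rewrite sumr_const card_ord mulNrn -[_ *+ N]mulr_natl => e.
apply: (mulfI q0); apply: oppr_inj; rewrite e; field.
by [].
Qed.

Lemma pp_atom_noninc N (lam : sig_t N) (i j : 'I_N) : (i <= j)%N ->
  pp_atom R lam j <= pp_atom R lam i.
Proof.
rewrite leq_eqVlt => /orP[/eqP e|ij]; first by rewrite (ord_inj e).
by rewrite !pp_atomE ler_wpM2r ?invr_ge0 // ler_int ltW // sigl_lt.
Qed.

Variables (rho : forall N : nat, sig_t N -> R) (m : nat -> R).
Arguments rho : clear implicits.
Hypothesis rhoP : forall N, is_prob (rho N).
Hypothesis cm : forall k, pcvg rho (fun N lam => pp_moment q lam k) (m k).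

Lemma typical_signature (n : nat) (e : R) : 0 < e ->
  exists (N : nat) (lam : sig_t N), (0 < N)%N /\
    forall k, (k <= n)%N -> `|pp_moment q lam k - m k| <= e.
Proof.
move=> e0.
(* The sum of squared deviations handles the first moments simultaneously: it tends to 0 in
   probability, so for some [N] not every signature can exceed the bound. *)
pose F (k : 'I_n.+1) N (lam : sig_t N) : R :=
  (pp_moment q lam k - m k) * (pp_moment q lam k - m k).
have cF k : pcvg rho (F k) ((m k - m k) * (m k - m k)).
  have c1 := pcvgB rhoP (cm k) (pcvg_cst rho (m k)).
  exact: (pcvgM rhoP c1 c1).
have e20 : 0 < e ^+ 2 by rewrite exprn_gt0.
have := pcvg_sum rhoP (index_enum 'I_n.+1) cF e20.
rewrite big1 => [|k _]; last by rewrite subrr mul0r.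
move=> /cvgrPdist_lt/(_ 1 ltr01) H.
have [N [+ N0]] := filter_ex (filterI H (nbhs_infty_gt 0%N)).
rewrite /= sub0r normrN ger0_norm ?prob_ge0 // => p1.
have [lam hl] : exists lam : sig_t N, ~ (e ^+ 2 < `|\sum_(k < n.+1) F k N lam - 0|).
  apply: contrapT => Hn; move: p1.
  rewrite [X in prob _ X](_ : _ = setT); last first.
    by apply/seteqP; split=> lam //= _; apply: contrapT => h; apply: Hn; exists lam.
  by rewrite /prob; case: (rhoP N) => _ ->; rewrite ltxx.
exists N, lam; split => // k kn.
move/negP: hl; rewrite subr0 -leNgt => hl.
rewrite -ltnS in kn.
have hk : F (Ordinal kn) N lam <= e ^+ 2.
  apply: le_trans hl; apply: le_trans (ler_norm _).
  by rewrite (bigD1 (Ordinal kn)) //= lerDl sumr_ge0 // => j _; rewrite /F -expr2 sqr_ge0.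
rewrite -(ler_pXn2r (n := 2)) ?nnegrE ?(ltW e0) //.
by rewrite real_normK ?num_real // expr2.
Qed.

(** Choosing for each [n] a signature whose moments up to order [n] are within [1 / (n + 1)] of the
    limits replaces the random measures by a deterministic sequence of probability measures. *)
Lemma limit_measure_exists : -1 <= q <= 1 ->
  exists mu : probability R R, forall k : nat,
    mu.-integrable setT (fun x : R => (x ^+ k)%:E) /\
    (\int[mu]_x (x ^+ k)%:E = (m k)%:E)%E.
Proof.
move=> q1.
have T n : {N : nat & {lam : sig_t N | (0 < N)%N /\
    forall k, (k <= n)%N -> `|pp_moment q lam k - m k| <= n.+1%:R^-1}}.
  have [N h] := cid (@typical_signature n n.+1%:R^-1 (ltac:(by rewrite invr_gt0))).
  by exists N; exact: cid h.
pose N n := projT1 (T n).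
pose lam n : sig_t (N n) := projT1 (projT2 (T n)).
have N0 n : (0 < N n)%N := (projT2 (projT2 (T n))).1.
have lamP n : forall k, (k <= n)%N -> `|pp_moment q (lam n) k - m k| <= n.+1%:R^-1 :=
  (projT2 (projT2 (T n))).2.
(* Weights and atoms are extended by 0 to all natural indices, where nonnegativity of the weights is
   also required. *)
pose w n (i : nat) := if insub i is Some j then (N n)%:R^-1 * pp_weight q (lam n) j else 0.
pose x n (i : nat) := if insub i is Some j then pp_atom R (lam n) j else 0.
have momE n k : \sum_(i < N n) w n i * x n i ^+ k = pp_moment q (lam n) k.
  rewrite /pp_moment mulr_sumr; apply: eq_bigr => i _.
  by rewrite /w /x valK mulrA.
apply: (@moment_limit_exists R N x w).
- move=> n i iN; rewrite /x (insubT (fun j => (j < N n)%N) iN) (insubT (fun j => (j < N n)%N) (ltnW iN)).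
  exact: pp_atom_noninc.
- move=> n i; rewrite /w; case: insub => // j.
  by rewrite mulr_ge0 ?invr_ge0 // pp_weight_ge0.
- move=> n; rewrite -(pp_moment_mass (lam n) (N0 n)) -momE.
  by apply: eq_bigr => i _; rewrite expr0 mulr1.
- move=> k; under eq_fun do rewrite momE.
  apply/cvgrPdist_le => e e0; near=> n.
  rewrite distrC (le_trans (lamP n k _)) //; first by near: n; exact: nbhs_infty_ge.
  by near: n; apply: filterS (near_infty_natSinv_lt (PosNum e0)) => n /ltW.
Unshelve. all: by end_near. Qed.

End PerelomovPopovMeasure.

Theorem theorem1 (R : realType) (rho : forall N : nat, sig_t N -> R)
  (a : nat -> R) :
  (forall N, is_prob (rho N)) ->
  (forall N, sgf_unif_conv (rho N)) ->
  (forall N, all_partials_exist (logsgf (rho N)) (ones N)) ->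
  (forall (k : nat) (i0 : nat), (0 < k)%N ->
     (fun N => partials (nseq k i0) (logsgf (rho N)) (ones N)) @ \oo --> a k) ->
  (forall l : seq nat, (2 <= size (undup l))%N ->
     (fun N => partials l (logsgf (rho N)) (ones N)) @ \oo --> (0 : R)) ->
  (exists2 r : R, 0 < r & forall z : R, `|z - 1| < r ->
     cvgn (series (fun k => a k * (z - 1) ^+ k / (k`!)%:R))) ->
  (forall q : R, -1 <= q <= 1 ->
     (exists mu : probability R R, forall k : nat,
        mu.-integrable setT (fun x : R => (x ^+ k)%:E) /\
        (\int[mu]_x (x ^+ k)%:E = (limit_moment a q k)%:E)%E) /\
     (forall (k : nat) (eps : R), 0 < eps ->
        (fun N => prob (rho N)
                    [set lam | eps < `| pp_moment q lam k - limit_moment a q k |])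
          @ \oo --> (0 : R))) /\
  (forall q q' : R, -1 <= q <= 1 -> -1 <= q' <= 1 ->
     qpow q (shifted_gf (limit_moment a q)) =
     qpow q' (shifted_gf (limit_moment a q'))).
Proof.
move=> rhoP rhoU rhoS lim1 lim2 ca.
have mE q : limit_moment a q = fmoment (psi_series a) q.
  by apply/funext => k; exact: limit_moment_fmoment.
have cm q k : pcvg rho (fun N lam => pp_moment q lam k) (fmoment (psi_series a) q k).
  apply: pcvg_pp_moment => // j.
  exact: (pcvg_pp_moment1 rhoP rhoU rhoS lim1 lim2).
split=> [q q1|q q' _ _]; last by rewrite !mE !qpow_fmoment.
rewrite mE; split; last by move=> k eps e0; exact: cm.
exact: (limit_measure_exists rhoP (cm q)).
Qed.
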